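(* Let $\theta$ be a smooth symmetric probability density on $\mathbb{R}^2$ supported in $B(0,1)$. Let $\Gamma$ be a real random variable with $\mathbb{E}[\Gamma]=0$ and $\mathbb{E}[|\Gamma|^p]<\infty$ for some $p>2$, let $L$ be a positive random variable, and let $X_0$ be uniformly distributed on $\mathbb{T}^2$ and independent of $(\Gamma,L)$. Then the covariance function of the random field $\Gamma K_L(x,X_0)$ is homogeneous, $Q_{\mathrm{vortex}}(x,x')=Q_{\mathrm{vortex}}(x-x')$, with $$Q_{\mathrm{vortex}}(x)=\sum_{\mathbf{k}\in\mathbb{Z}^2_0}\mathbb{E}\Big[\Gamma^2\big|\widehat\theta(L\mathbf{k})\big|^2\Big]\frac{1}{|\mathbf{k}|^2}P_{\mathbf{k}}\,e^{i\mathbf{k}\cdot x}.$$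
   Context: $\mathbb{T}^2=\mathbb{R}^2/(2\pi\mathbb{Z})^2$, and all integrals $dx$ over $\mathbb{T}^2$ are with respect to the normalized (total mass one) Haar measure. $\mathbb{Z}^2_0=\mathbb{Z}^2\setminus\{0\}$; $P_{\mathbf{k}}=I-\frac{\mathbf{k}\otimes\mathbf{k}}{|\mathbf{k}|^2}$. $\widehat\theta(\xi)=\int_{\mathbb{R}^2}\theta(z)e^{-i\xi\cdot z}dz$ (Lebesgue measure). For $\ell>0$, $\theta_\ell$ is the periodized rescaled mollifier, normalized as a density for normalized Haar measure: $\theta_\ell(x)=(2\pi)^2\sum_{m\in\mathbb{Z}^2}\ell^{-2}\theta(\ell^{-1}(x+2\pi m))$. $K(x,y)=K(x-y)$ is the Biot–Savart kernel on the torus, with Fourier coefficients $\widehat K(\mathbf{k})=i\,\mathbf{k}^\perp/|\mathbf{k}|^2$ for $\mathbf{k}\in\mathbb{Z}^2_0$ and $\widehat K(0)=0$, where $\mathbf{k}^\perp=(k_2,-k_1)$, i.e. $K(x)=\sum_{\mathbf{k}\in\mathbb{Z}_0^2}\widehat K(\mathbf{k})e^{i\mathbf{k}\cdot x}$. $K_\ell(x,x_0)=\int_{\mathbb{T}^2}K(x,y)\theta_\ell(y-x_0)\,dy$. The covariance function is $Q_{\mathrm{vortex}}(x,x')=\mathbb{E}[\Gamma K_L(x,X_0)\otimes\Gamma K_L(x',X_0)]$, characterized by $$\int\!\!\int v(x)^TQ_{\mathrm{vortex}}(x,x')w(x')\,dx\,dx'=\mathbb{E}\Big[\Gamma^2\int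 K_L(x,X_0)\cdot v(x)dx\int K_L(x',X_0)\cdot w(x')dx'\Big]$$ for (e.g. smooth) vector fields $v,w$ on $\mathbb{T}^2$; the series for $Q_{\mathrm{vortex}}$ is understood as a Fourier series (convergent in $L^2(\mathbb{T}^2)$). *)

(* Defs.v *)
From HB Require Import structures.
From mathcomp Require Import all_boot all_order all_algebra finmap.
From mathcomp Require Import all_classical all_reals all_analysis.
From mathcomp Require Import complex.
From mathcomp Require summability.

Set Implicit Arguments.
Unset Strict Implicit.
Unset Printing Implicit Defensive.

Import Order.TTheory GRing.Theory Num.Theory numFieldNormedType.Exports.

Local Open Scope classical_set_scope.
Local Open Scope ring_scope.
Local Open Scope complex_scope.

(* Points of R^2 have type R * R.  The torus T^2 = R^2/(2 pi Z)^2 is handled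
   through 2 pi-periodic functions on R^2, integrated over [0, 2 pi]^2.
   Vector (resp. matrix) values have type 'cV[R]_2 (resp. 'M[R]_2). *)

Lemma two_pi_gt0 (R : realType) : 0 < 2 * pi :> R.
Proof. by rewrite mulr_gt0 ?pi_gt0. Qed.

Definition haar (R : realType) :
    probability (measurableTypeR R * measurableTypeR R)%type R :=
  (uniform_prob (two_pi_gt0 R) \x uniform_prob (two_pi_gt0 R))%E.

Section Torus.
Variable R : realType.
Implicit Types (x y z xi : R * R) (k : int * int).

Definition dot x y : R := x.1 * y.1 + x.2 * y.2.

Definition intpt k : R * R := (k.1%:~R, k.2%:~R).

Definition torus_periodic (T : Type) (f : R * R -> T) : Prop :=
  forall x (m : int * int), f (x + (2 * pi) *: intpt m) = f x.

Fixpoint Cdiff (n : nat) (f : R * R -> R) : Prop :=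
  continuous f /\
  if n is n'.+1 then
    forall e, e = ((1, 0) : R * R) \/ e = ((0, 1) : R * R) ->
      (forall x, derivable f x e) /\ Cdiff n' ('D_e f)
  else True.

Definition smooth (f : R * R -> R) : Prop := forall n, Cdiff n f.

Definition smooth_field (v : R * R -> 'cV[R]_2) : Prop :=
  torus_periodic v /\ forall i, smooth (fun x => v x i 0).

(* exp (i t) *)
Definition expi (t : R) : R[i] := cos t +i* sin t.

Definition cintegral d (T : measurableType d)
    (mu : {measure set T -> \bar R}) (f : T -> R[i]) : R[i] :=
  (\int[mu]_x complex.Re (f x)) +i* (\int[mu]_x complex.Im (f x)).

Definition fourier_coef (f : R * R -> R) k : R[i] :=
  cintegral (haar R) (fun x => (f x)%:C * expi (- dot (intpt k) x)).

Definition fourier_transform (f : R * R -> R) xi : R[i] :=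
  cintegral (lebesgue_measure \x lebesgue_measure)%E
    (fun z : R * R => (f z)%:C * expi (- dot xi z)).

Definition sqnorm k : R := dot (intpt k) (intpt k).

Definition freq k : 'cV[R]_2 := \col_j (if j == 0 then k.1 else k.2)%:~R.

Definition freq_perp k : 'cV[R]_2 := \col_j (if j == 0 then k.2 else - k.1)%:~R.

(* P_k = I - (k (x) k) / |k|^2 *)
Definition leray k : 'M[R]_2 := 1%:M - (sqnorm k)^-1 *: (freq k *m (freq k)^T).

(* An integrable representative of the kernel with the prescribed Fourier
   coefficients; these determine it almost everywhere.  It is not square
   integrable. *)
Definition biot_savart (K : R * R -> 'cV[R]_2) : Prop :=
  [/\ torus_periodic K,
      forall j, (haar R).-integrable setT (fun x => (K x j 0)%:E) &
      forall k j, fourier_coef (fun x => K x j 0) k =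
        if k == 0 then 0 else 0 +i* (freq_perp k j 0 / sqnorm k)].

Definition symmetric_mollifier (theta : R * R -> R) : Prop :=
  [/\ smooth theta,
      forall z, theta (- z) = theta z,
      forall z, 0 <= theta z,
      (\int[lebesgue_measure \x lebesgue_measure]_z (theta z)%:E = 1)%E &
      forall z, theta z != 0 -> dot z z <= 1].

Definition mollifier (theta : R * R -> R) (l : R) x : R :=
  (2 * pi) ^+ 2 *
  fine (\esum_(m in [set: int * int])
          (l ^- 2 * theta (l^-1 *: (x + (2 * pi) *: intpt m)))%:E).

Definition smoothed_kernel (K : R * R -> 'cV[R]_2) (theta : R * R -> R)
    (l : R) x x0 : 'cV[R]_2 :=
  \col_j \int[haar R]_y (K (x - y) j 0 * mollifier theta l (y - x0)).

Definition field_pairing (u v : R * R -> 'cV[R]_2) : R :=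
  \int[haar R]_x ((u x)^T *m v x) 0 0.

(* f in L^2(T^2) is the sum, unconditionally in L^2(T^2), of
   c k * exp (i k.x) over the nonzero k in Z^2: the partial sums range over
   finite subsets F of Z^2 ordered by inclusion. *)
Definition L2_fourier_sum (f : R * R -> R) (c : int * int -> R[i]) : Prop :=
  [/\ measurable_fun [set: R * R] f,
      (\int[haar R]_x (f x ^+ 2)%:E < +oo)%E &
      (fun F : {fset int * int} => \int[haar R]_x
         (Normc.normc ((f x)%:C -
            \sum_(k <- F | k != 0%R) c k * expi (dot (intpt k) x)) ^+ 2)%:E)%E
        @ summability.totally --> (0 : \bar R)%E].

End Torus.

Section Probability.
Context {R : realType} {d : measure_display} {Omega : measurableType d}.
Variable P : probability Omega R.
Implicit Type U : Omega -> R * R -> 'cV[R]_2.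

Definition independent d1 d2 (T1 : measurableType d1) (T2 : measurableType d2)
    (X : Omega -> T1) (Y : Omega -> T2) : Prop :=
  forall A B, measurable A -> measurable B ->
    P (X @^-1` A `&` Y @^-1` B) = (P (X @^-1` A) * P (Y @^-1` B))%E.

(* The uniform law on the torus, carried by the representative of the
   class in [0, 2 pi]^2. *)
Definition uniform_on_torus (X : {RV P >-> (R * R)%type}) : Prop :=
  forall A, measurable A -> distribution P X A = haar R A.

(* E[U(x) (x) U(x')] *)
Definition covariance_fun U (x x' : R * R) : 'M[R]_2 :=
  \matrix_(i, j) fine 'E_P[fun w => U w x i 0 * U w x' j 0].

(* The expectations above may diverge on a null set of pairs (x, x'), where
   [fine] returns a junk value. *)
Definition covariance_ae_defined U : Prop :=
  {ae (haar R \x haar R)%E, forall z : (R * R) * (R * R), forall i j,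
    P.-integrable setT (fun w => (U w z.1 i 0 * U w z.2 j 0)%:E)}.

Definition covariance_identity U (Q : R * R -> R * R -> 'M[R]_2) : Prop :=
  forall v w : R * R -> 'cV[R]_2, smooth_field v -> smooth_field w ->
    let vQw (z : (R * R) * (R * R)) : R :=
      ((v z.1)^T *m Q z.1 z.2 *m w z.2) 0 0 in
    (haar R \x haar R)%E.-integrable setT (fun z => (vQw z)%:E) /\
    (\int[haar R \x haar R]_z (vQw z)%:E =
     'E_P[fun om => (field_pairing (U om) v * field_pairing (U om) w)%R])%E.

End Probability.

(* Main.v *)
(* The smoothed kernel is a function G_L of x - X0, where G_l is the convolution
   of K with theta_l.  Averaging over the uniform X0, independent of (Gamma, L),
   gives the covariance E[Gamma^2 int G_L(x - y) (x) G_L(x' - y) dy], which only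
   depends on x - x'.  Unfolding the periodization, the k-th Fourier coefficient
   of G_l is i (k^perp / |k|^2) theta^(l k), and k^perp (x) k^perp / |k|^2 = P_k,
   so the k-th coefficient of the covariance is the asserted one.  It is
   O(|k|^-2), hence square summable on Z^2: the partial sums of the series
   converge in L^2, and almost everywhere along a subsequence, to a function with
   the same Fourier coefficients as the covariance, hence equal to it almost
   everywhere, because an integrable function with vanishing Fourier
   coefficients vanishes almost everywhere. *)

Require Import Defs.
From HB Require Import structures.
From mathcomp Require Import all_boot all_order all_algebra finmap.
From mathcomp Require Import all_classical all_reals all_analysis.
From mathcomp Require Import measurable_realfun complex ring lra.
From mathcomp Require summability.

Set Implicit Arguments.
Unset Strict Implicit.
Unset Printing Implicit Defensive.

Import Order.TTheory GRing.Theory Num.Theory numFieldNormedType.Exports.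

Local Open Scope classical_set_scope.
Local Open Scope ring_scope.
Local Open Scope complex_scope.

(** The kernel is only in L^1, so an expectation defining the covariance may diverge at individual
    pairs of points. What survives is joint integrability in (x, x', omega): for a fixed outcome the
    double integral over the torus factors, and by Young's inequality each factor is at most |Gamma|
    times the L^1 norm of a component of K, uniformly in L. Homogeneity still holds at every pair,
    because the translation of X0 is carried out on positive and negative parts separately and
    equates extended-valued integrals. Uniqueness of Fourier coefficients uses no summability
    kernel. The sets whose indicators preserve the property of having vanishing coefficients against
    [f] form a sigma-algebra; step functions of cosines and sines, reached as limits of explicit
    polynomials, put the coordinate half-planes into it. Computations are done with real cosines and
    sines. The asserted coefficients are real and even, so the cosine integrals of the covariance
    carry them and its sine integrals vanish. *)

(** * Unordered sums over countable types *)

(** Enumerating by codes, with 0 for the codes that decode to nothing, gives access to the monotone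
    convergence results for series. *)
Lemma esum_countType (R : realType) (I : countType) (a : I -> \bar R) :
  (forall i, 0 <= a i)%E ->
  (\esum_(i in [set: I]) a i =
   \sum_(n <oo) (if pickle_inv n is Some i then a i else 0))%E.
Proof.
move=> a0; have [[i0 _]|I0] := pselect (exists i : I, True); last first.
  have -> : [set: I] = set0 by apply/seteqP; split => // i _; case: I0; exists i.
  rewrite esum_set0 eseries0// => n _ _.
  by case: pickle_inv => // i; case: I0; exists i.
(* [i0] is a dummy value at the codes that decode to nothing; [Q] discards them. *)
pose e n := odflt i0 (pickle_inv n); pose Q n := pickle_inv (T := I) n != None.
rewrite [RHS](_ : _ = \sum_(n <oo | Q n) a (e n))%E; last first.
  rewrite [RHS]eseries_mkcond; congr (limn _); apply/funext => n.
  by apply: eq_bigr => k _; rewrite /Q /e; case: pickle_inv.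
rewrite -(esum_pred_image _ e).
- congr (esum _ _); apply/seteqP; split => // i _; exists (choice.pickle i).
    by rewrite /= /Q pickleK_inv.
  by rewrite /e pickleK_inv.
- by move=> n _; exact: a0.
- move=> m n /set_mem /= + /set_mem /=; rewrite /Q /e.
  have := pickle_invK (T := I) m; have := pickle_invK (T := I) n.
  case: (pickle_inv n) => //= i; case: (pickle_inv m) => //= j.
  by move=> <- <- _ _ ->.
Qed.

Lemma ge0_esumZl (R : realType) (I : countType) (a : I -> \bar R) (r : R) :
  (forall i, 0 <= a i)%E -> (0 <= r)%R ->
  (\esum_(i in [set: I]) (r%:E * a i) = r%:E * \esum_(i in [set: I]) a i)%E.
Proof.
move=> a0 r0; rewrite !esum_countType//; last by move=> i; rewrite mule_ge0.
rewrite -nneseriesZl; last by move=> n _; case: pickle_inv.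
congr (limn _); apply/funext => n; apply: eq_bigr => k _.
by case: pickle_inv => //; rewrite mule0.
Qed.

Section esum_measurable.
Local Open Scope ereal_scope.
Context d (T : measurableType d) (R : realType) (I : countType).
Variable F : I -> T -> \bar R.
Hypotheses (mF : forall i, measurable_fun setT (F i))
  (F0 : forall i x, 0 <= F i x).

Let G n x := if pickle_inv n is Some i then F i x else 0.

Let mG n : measurable_fun setT (G n).
Proof. by rewrite /G; case: pickle_inv. Qed.

Let G0 n x : 0 <= G n x.
Proof. by rewrite /G; case: pickle_inv. Qed.

Lemma measurable_fun_esum :
  measurable_fun setT (fun x => \esum_(i in [set: I]) F i x).
Proof.
rewrite (_ : (fun _ => _) = fun x => \sum_(n <oo) G n x).
  by apply: ge0_emeasurable_sum.
by apply/funext => x; rewrite esum_countType.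
Qed.

Lemma ge0_integral_esum (mu : {measure set T -> \bar R}) :
  \int[mu]_x (\esum_(i in [set: I]) F i x) =
  \esum_(i in [set: I]) \int[mu]_x F i x.
Proof.
rewrite esum_countType; last by move=> i; exact: integral_ge0.
under eq_integral do rewrite esum_countType//.
rewrite (@integral_nneseries _ _ _ _ _ _ G)//; congr (limn _).
apply/funext => n; apply: eq_bigr => k _.
by rewrite /G; case: pickle_inv => //; exact: integral0.
Qed.

End esum_measurable.

(** * Haar measure on the torus *)

Section affine.
Local Open Scope ereal_scope.
Variable R : realType.
Local Notation mu := (@lebesgue_measure R).

Lemma measurable_affine (a b : R) :
  measurable_fun setT (fun x : measurableTypeR R => (a * x + b)%R : measurableTypeR R).
Proof.
by apply: measurable_funD => //; exact: measurable_funM.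
Qed.

Let affine_measure (a b : R) : {measure set (measurableTypeR R) -> \bar R}.
Proof.
refine (mscale (NngNum (normr_ge0 a))
  (pushforward mu (fun x : measurableTypeR R => (a * x + b)%R : measurableTypeR R))).
exact: measurable_affine.
Defined.

(** Lebesgue measure is determined by its values on the intervals ]c, d]. For negative [a] the
    preimage is half-open on the other side, with the same length. *)
Let affine_measureE (a b : R) : a != 0%R -> forall A, measurable A ->
  mu A = affine_measure a b A.
Proof.
move=> a0; apply: lebesgue_measure_unique => _ [[c d] /= cd <-].
rewrite /affine_measure /mscale /= /pushforward.
have [a_gt0|a_lt0|a_eq0] := ltrgt0P a; last by rewrite a_eq0 eqxx in a0.
- rewrite (_ : _ @^-1` _ = `]((c - b) / a)%R, ((d - b) / a)%R]%classic); last first.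
    apply/seteqP; split => x /=; rewrite !in_itv/= ltr_pdivrMr// ler_pdivlMr//;
      by rewrite ltrBlDr lerBrDr mulrC.
  rewrite !lebesgue_measure_itv/= !lte_fin ltr_pM2r ?invr_gt0// ltrD2r.
  case: ifPn => _; last by rewrite mule0.
  by rewrite -!EFinD -EFinM; congr EFin; field.
- rewrite (_ : _ @^-1` _ = `[((d - b) / a)%R, ((c - b) / a)%R[%classic); last first.
    apply/seteqP; split => x /=; rewrite !in_itv/= ltr_ndivlMr// ler_ndivrMr//;
      by rewrite ltrBlDr lerBrDr mulrC andbC.
  rewrite !lebesgue_measure_itv/= !lte_fin ltr_nM2r ?invr_lt0// ltrD2r.
  case: ifPn => _; last by rewrite mule0.
  by rewrite -!EFinD -EFinM; congr EFin; field.
Qed.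

Lemma ge0_integral_affine (a b : R) (f : R -> \bar R) : a != 0%R ->
  measurable_fun [set: measurableTypeR R] f -> (forall x, 0 <= f x) ->
  \int[mu]_x f (a * x + b)%R = (`|a|^-1)%:E * \int[mu]_x f x.
Proof.
move=> a0 mf f0.
rewrite [in RHS](eq_measure_integral (affine_measure a b)); last first.
  by move=> A mA _; exact: affine_measureE.
rewrite ge0_integral_mscale//= ge0_integral_pushforward//=; last first.
  exact: measurable_affine.
by rewrite muleA -EFinM mulVf ?normr_eq0// mul1e.
Qed.
End affine.

Section planar.
Local Open Scope ereal_scope.
Variable R : realType.
Local Notation mu := (@lebesgue_measure R).
Local Notation leb2 := (mu \x mu).
Local Notation T2 := (measurableTypeR R * measurableTypeR R)%type.

Lemma measurable_pair_affine (a : R) (b : R * R) :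
  measurable_fun [set: T2] (fun x : T2 => (a *: (x : R * R) + b)%R : T2).
Proof.
apply: (@measurable_fun_pair _ _ _ T2 (measurableTypeR R) (measurableTypeR R)
  (fun x => (a * x.1 + b.1)%R) (fun x => (a * x.2 + b.2)%R)).
- by apply: measurable_funD => //; apply: measurable_funM => //; exact: measurable_fst.
- by apply: measurable_funD => //; apply: measurable_funM => //; exact: measurable_snd.
Qed.

Lemma ge0_integral_pair_affine (a : R) (b : R * R) (f : R * R -> \bar R) :
  a != 0%R -> measurable_fun [set: T2] f -> (forall x, 0 <= f x) ->
  \int[leb2]_x f (a *: x + b)%R = (a ^- 2)%:E * \int[leb2]_x f x.
Proof.
move=> a0 mf f0.
have mfa : measurable_fun [set: T2] (fun x : T2 => f (a *: (x : R * R) + b)%R).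
  exact: (measurableT_comp mf (measurable_pair_affine a b)).
rewrite (fubini_tonelli1 (fun x : T2 => f (a *: (x : R * R) + b)%R))//.
rewrite (fubini_tonelli1 (f : T2 -> \bar R))// /fubini_F.
have m1 : measurable_fun [set: measurableTypeR R] (fun x => \int[mu]_y f (x, y)).
  exact: (measurable_fun_fubini_tonelli_F (f : T2 -> \bar R)).
transitivity (\int[mu]_x ((`|a|^-1)%:E * \int[mu]_y f ((a * x + b.1)%R, y))).
  apply: eq_integral => x _.
  rewrite -(ge0_integral_affine b.2 (f := fun y => f ((a * x + b.1)%R, y)))//.
  exact: (measurableT_comp mf (pair1_measurable _)).
rewrite ge0_integralZl//=; last 2 first.
  - exact: (measurableT_comp m1 (measurable_affine _ _)).
  - by move=> x _; exact: integral_ge0.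
rewrite (ge0_integral_affine b.1 (f := fun x => \int[mu]_y f (x, y)))//; last first.
  by move=> x; exact: integral_ge0.
rewrite muleA; congr (_ * _); rewrite -EFinM; congr EFin.
by rewrite -invfM -expr2 real_normK// num_real.
Qed.

End planar.

Section unfolding.
Local Open Scope ereal_scope.
Variable R : realType.
Local Notation mu := (@lebesgue_measure R).
Local Notation leb2 := (mu \x mu).
Local Notation T2 := (measurableTypeR R * measurableTypeR R)%type.
Local Notation per m := ((2 * pi) *: intpt R m)%R.

(** The interval is half-open so that its translates by multiples of 2 pi tile the line without
    overlap. *)
Definition cell1 (t : R) : R := (0 <= t < 2 * pi)%R%:R.

Definition cell (x : R * R) : R := (cell1 x.1 * cell1 x.2)%R.

Lemma cell1_ge0 t : (0 <= cell1 t)%R.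
Proof. exact: ler0n. Qed.

Lemma cell_ge0 x : (0 <= cell x)%R.
Proof. by rewrite mulr_ge0. Qed.

Lemma cell1_indic : cell1 = \1_(`[0%R, (2 * pi)%R[%classic : set R).
Proof.
apply/funext => t; rewrite /cell1 indicE; congr (_%:R); congr nat_of_bool.
by apply/idP/idP => [h|/set_mem]; [apply/mem_set; rewrite /= in_itv|rewrite /= in_itv].
Qed.

Lemma measurable_cell1 : measurable_fun [set: measurableTypeR R] cell1.
Proof. by rewrite cell1_indic; exact: measurable_indic. Qed.

Lemma measurable_cell : measurable_fun [set: T2] cell.
Proof.
apply: measurable_funM; apply: (measurableT_comp measurable_cell1).
- exact: measurable_fst.
- exact: measurable_snd.
Qed.

Lemma ge0_integral_uniform (f : R -> \bar R) :
  measurable_fun [set: measurableTypeR R] f -> (forall x, 0 <= f x) ->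
  \int[uniform_prob (two_pi_gt0 R)]_x f x =
  ((2 * pi)^-1)%:E * \int[mu]_x (f x * (cell1 x)%:E).
Proof.
move=> mf f0; rewrite integral_uniform// subr0; congr (_ * _).
(* The uniform law lives on the closed interval; its right endpoint is negligible. *)
rewrite -integral_itv_bndo_bndc//; last exact: measurable_funTS.
rewrite integral_mkcond; apply: eq_integral => x _.
rewrite patchE cell1_indic indicE; case: ifPn => _; first by rewrite mule1.
by rewrite mule0.
Qed.

Lemma ge0_integral_haar (f : R * R -> \bar R) :
  measurable_fun [set: T2] f -> (forall x, 0 <= f x) ->
  \int[haar R]_x f x = ((2 * pi) ^- 2)%:E * \int[leb2]_x (f x * (cell x)%:E).
Proof.
move=> mf f0; rewrite /haar.
have mfc : measurable_fun [set: T2] (fun x : T2 => f x * (cell x)%:E).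
  by apply: emeasurable_funM => //; apply/measurable_EFinP; exact: measurable_cell.
have fc0 x : 0 <= f x * (cell x)%:E by rewrite mule_ge0// lee_fin cell_ge0.
rewrite (fubini_tonelli1 (f : T2 -> \bar R))// (fubini_tonelli1 (fun x : T2 => _ x * _))//.
rewrite /fubini_F.
have m1 : measurable_fun [set: measurableTypeR R]
    (fun x => \int[uniform_prob (two_pi_gt0 R)]_y f (x, y)).
  exact: (measurable_fun_fubini_tonelli_F (f : T2 -> \bar R)).
have m2 : measurable_fun [set: measurableTypeR R]
    (fun x => \int[mu]_y (f (x, y) * (cell (x, y))%:E)).
  exact: (measurable_fun_fubini_tonelli_F (fun x : T2 => f x * (cell x)%:E)).
rewrite ge0_integral_uniform//; last by move=> x; exact: integral_ge0.
rewrite (_ : (2 * pi) ^- 2 = (2 * pi)^-1 * (2 * pi)^-1)%R; last first.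
  by rewrite expr2 invfM.
rewrite EFinM -muleA; congr (_ * _).
rewrite -ge0_integralZl//; last 2 first.
- by move=> x _; exact: integral_ge0.
- by rewrite lee_fin invr_ge0 ltW// two_pi_gt0.
apply: eq_integral => x _.
rewrite ge0_integral_uniform//; last first.
  exact: (measurableT_comp mf (pair1_measurable _)).
rewrite -muleA; congr (_ * _).
rewrite -ge0_integralZr//.
- by apply: eq_integral => y _; rewrite /cell EFinM /= -muleA; congr (_ * _); rewrite muleC.
- apply: emeasurable_funM; first exact: (measurableT_comp mf (pair1_measurable _)).
  by apply/measurable_EFinP; exact: measurable_cell1.
- by move=> y _; rewrite mule_ge0// lee_fin cell1_ge0.
- by rewrite lee_fin cell1_ge0.
Qed.

(** The integer [s] is a sign: unfolding needs translations in the negative direction, and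
    reflections of the torus need them in both. *)
Lemma cell1_translate (s : int) (t : R) : (s * s = 1)%R ->
  exists n0 : int, forall n : int,
    cell1 (t + 2 * pi * s%:~R * n%:~R)%R = (n == n0)%:R%R.
Proof.
move=> s1; have p0 := two_pi_gt0 R.
exists (- s * Num.floor (t / (2 * pi)))%R => n.
rewrite /cell1; congr (_%:R); congr nat_of_bool.
have -> : (n == - s * Num.floor (t / (2 * pi)))%R = (Num.floor (t / (2 * pi)) == - s * n)%R.
  apply/eqP/eqP => ->; by rewrite mulrA mulrNN s1 mul1r.
have -> : (t + 2 * pi * s%:~R * n%:~R = (2 * pi) * (t / (2 * pi) - (- s * n)%:~R))%R.
  rewrite intrM mulrNz; move: p0; generalize (2 * pi : R)%R => p p0.
  by field; rewrite gt_eqF.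
rewrite pmulr_rge0// -[X in (_ < X)%R]mulr1 ltr_pM2l// subr_ge0 ltrBlDr.
apply/idP/eqP => [/andP[h1 h2]|<-].
  by apply/eqP; rewrite floor_eq; apply/andP; split => //; rewrite intrD addrC.
by rewrite ge_floor -[X in (_ < X)%R]addrC -[1%R]/(1%:~R) -intrD floorD1_gt.
Qed.

Lemma esum_cell_translate (s : int) (x : R * R) (c : \bar R) :
  (s * s = 1)%R -> 0 <= c ->
  \esum_(m in [set: int * int])
    (c * (cell (x + (2 * pi * s%:~R) *: intpt R m)%R)%:E) = c.
Proof.
move=> s1 c0; have [n1 h1] := cell1_translate x.1 s1.
have [n2 h2] := cell1_translate x.2 s1.
transitivity (\esum_(m in [set: int * int] `&` [set (n1, n2)]) c).
  rewrite esum_mkcondr; apply: eq_esum => -[m1 m2] _.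
  rewrite /cell/= h1 h2 -natrM mulnb -xpair_eqE.
  have [->|ne] := eqVneq (m1, m2) (n1, n2); first by rewrite mule1 mem_set.
  by rewrite mule0 ifN//; apply/negP => /set_mem /= e; rewrite e eqxx in ne.
by rewrite setTI esum_set1.
Qed.

End unfolding.

Section haar_invariance.
Local Open Scope ereal_scope.
Variable R : realType.
Local Notation mu := (@lebesgue_measure R).
Local Notation leb2 := (mu \x mu).
Local Notation T2 := (measurableTypeR R * measurableTypeR R)%type.

Lemma measurable_pair_translate (a : R * R) :
  measurable_fun [set: T2] (fun x : T2 => ((x : R * R) + a)%R : T2).
Proof.
rewrite (_ : (fun _ => _) = (fun x : T2 => (1 *: (x : R * R) + a)%R : T2)).
  exact: measurable_pair_affine.
by apply/funext => x; rewrite scale1r.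
Qed.

Lemma ge0_integral_pair_translate (b : R * R) (f : R * R -> \bar R) :
  measurable_fun [set: T2] f -> (forall x, 0 <= f x) ->
  \int[leb2]_x f (x + b)%R = \int[leb2]_x f x.
Proof.
move=> mf f0; have := ge0_integral_pair_affine b (oner_neq0 R) mf f0.
rewrite expr1n invr1 mul1e => <-.
by apply: eq_integral => x _; rewrite scale1r.
Qed.

(** The translates of the cell tile the plane, so [f] is the sum over m of its restrictions to them,
    and each restriction is moved back to the cell. *)
Lemma ge0_integral_unfold (f : R * R -> \bar R) :
  measurable_fun [set: T2] f -> (forall x, 0 <= f x) ->
  \int[leb2]_x f x = ((2 * pi) ^+ 2)%:E *
    \int[haar R]_x \esum_(m in [set: int * int]) f (x + (2 * pi) *: intpt R m)%R.
Proof.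
move=> mf f0.
have mft m : measurable_fun [set: T2] (fun x : T2 => f ((x : R * R) + (2 * pi) *: intpt R m)%R).
  exact: (measurableT_comp mf (measurable_pair_translate _)).
have mcell : measurable_fun [set: T2] (fun x : T2 => (cell x)%:E).
  by apply/measurable_EFinP; exact: measurable_cell.
have p0 := two_pi_gt0 R.
rewrite ge0_integral_haar; first last.
- by move=> x; exact: esum_ge0.
- exact: (measurable_fun_esum (F := fun (m : int * int) (x : T2) =>
    f ((x : R * R) + (2 * pi) *: intpt R m)%R)).
rewrite muleA -EFinM divff ?expf_neq0 ?gt_eqF// mul1e.
under [RHS]eq_integral => x _.
  rewrite muleC -ge0_esumZl ?cell_ge0//.
  over.
rewrite (ge0_integral_esum (F := fun (m : int * int) (x : T2) =>
  (cell x)%:E * f ((x : R * R) + (2 * pi) *: intpt R m)%R)); last 2 first.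
- by move=> m; exact: emeasurable_funM.
- by move=> m x; rewrite mule_ge0// lee_fin cell_ge0.
(* The change of variables takes the translation off [f] and puts its opposite on the cell, hence
   the sign [- 1]. *)
transitivity (\esum_(m in [set: int * int]) \int[leb2]_x
   (f x * (cell (x + (2 * pi * (- 1)%:~R) *: intpt R m)%R)%:E)); last first.
  apply: eq_esum => m _.
  rewrite -(ge0_integral_pair_translate ((2 * pi) *: intpt R m)
    (f := fun x => f x * (cell (x + (2 * pi * (- 1)%:~R) *: intpt R m)%R)%:E)).
  - apply: eq_integral => x _; rewrite [RHS]muleC; congr (_ * (cell _)%:E).
    by rewrite mulrN1z mulrN1 scaleNr addrK.
  - apply: emeasurable_funM => //.
    exact: (measurableT_comp mcell (measurable_pair_translate _)).
  - by move=> x; rewrite mule_ge0// lee_fin cell_ge0.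
rewrite -(ge0_integral_esum (F := fun (m : int * int) (x : T2) =>
  f x * (cell ((x : R * R) + (2 * pi * (- 1)%:~R) *: intpt R m)%R)%:E)); last 2 first.
- move=> m; apply: emeasurable_funM => //.
  exact: (measurableT_comp mcell (measurable_pair_translate _)).
- by move=> m x; rewrite mule_ge0// lee_fin cell_ge0.
apply: eq_integral => x _; by rewrite esum_cell_translate.
Qed.

(** Translations and reflections are treated together. The affine map carries the cell to another
    fundamental domain, and unfolding the integral over that domain recovers the integral of the
    periodic [h]. *)
Lemma ge0_integral_haar_affine (s : int) (a : R * R) (h : R * R -> \bar R) :
  (s * s = 1)%R -> measurable_fun [set: T2] h -> (forall x, 0 <= h x) ->
  torus_periodic h ->
  \int[haar R]_x h (s%:~R *: x + a)%R = \int[haar R]_x h x.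
Proof.
move=> s1 mh h0 ph; have p0 := two_pi_gt0 R.
have ss : (s%:~R * s%:~R = 1 :> R)%R by rewrite -intrM s1.
have s0 : (s%:~R != 0 :> R)%R.
  by apply/eqP => s0; move/eqP: ss; rewrite s0 mul0r eq_sym oner_eq0.
have mcell : measurable_fun [set: T2] (fun x : T2 => (cell x)%:E).
  by apply/measurable_EFinP; exact: measurable_cell.
pose g x := h x * (cell (s%:~R *: x + - (s%:~R *: a))%R)%:E.
have mg : measurable_fun [set: T2] g.
  apply: emeasurable_funM => //.
  exact: (measurableT_comp mcell (measurable_pair_affine _ _)).
have g0 x : 0 <= g x by rewrite mule_ge0// lee_fin cell_ge0.
rewrite ge0_integral_haar//; last exact: (measurableT_comp mh (measurable_pair_affine _ _)).
transitivity (((2 * pi) ^- 2)%:E * \int[leb2]_x g (s%:~R *: x + a)%R).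
  congr (_ * _); apply: eq_integral => x _; rewrite /g; congr (_ * (cell _)%:E).
  by rewrite scalerDr scalerA ss scale1r addrK.
rewrite ge0_integral_pair_affine// -[(s%:~R ^+ 2)%R]/(s%:~R * s%:~R)%R ss invr1 mul1e.
rewrite ge0_integral_unfold//.
rewrite muleA -EFinM mulVf ?expf_neq0 ?gt_eqF// mul1e.
apply: eq_integral => x _; rewrite /g.
transitivity (\esum_(m in [set: int * int]) (h x *
   (cell ((s%:~R *: x - s%:~R *: a) + (2 * pi * s%:~R) *: intpt R m)%R)%:E)).
  apply: eq_esum => m _; rewrite ph; congr (_ * (cell _)%:E).
  by rewrite scalerDr scalerA [(s%:~R * _)%R]mulrC addrAC.
by rewrite esum_cell_translate.
Qed.

(** The equality is between extended-valued integrals, part by part, so it can be applied at points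
    where a convolution diverges. *)
Lemma integral_haar_affine (s : int) (a : R * R) (h : R * R -> \bar R) :
  (s * s = 1)%R -> measurable_fun [set: T2] h -> torus_periodic h ->
  \int[haar R]_x h (s%:~R *: x + a)%R = \int[haar R]_x h x.
Proof.
move=> s1 mh ph; rewrite integralE [RHS]integralE.
have pp : torus_periodic h^\+ by move=> x m; rewrite !funeposE ph.
have pn : torus_periodic h^\- by move=> x m; rewrite !funenegE ph.
rewrite -(ge0_integral_haar_affine a (h := h^\+) s1)//; last first.
  exact: measurable_funepos.
rewrite -(ge0_integral_haar_affine a (h := h^\-) s1)//; last first.
  exact: measurable_funeneg.
by congr (_ - _); apply: eq_integral => x _; rewrite ?funeposE ?funenegE.
Qed.

Lemma integral_haar_translate (h : R * R -> \bar R) (a : R * R) :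
  measurable_fun [set: T2] h -> torus_periodic h ->
  \int[haar R]_x h (x - a)%R = \int[haar R]_x h x.
Proof.
move=> mh ph; rewrite -(integral_haar_affine (s := 1) (- a)%R erefl mh ph).
by apply: eq_integral => x _; rewrite scale1r.
Qed.

End haar_invariance.

(** * Independence *)

Section independence.
Local Open Scope ereal_scope.
Context d d1 d2 (Omega : measurableType d) (T1 : measurableType d1)
  (T2 : measurableType d2) (R : realType) (P : probability Omega R)
  (m : probability T2 R).
Variables (X : {RV P >-> T1}) (Y : {RV P >-> T2}).
Hypotheses (Ym : forall A, measurable A -> distribution P Y A = m A)
  (YX : independent P Y X).

Let measurable_XY : measurable_fun setT (fun w => (X w, Y w)).
Proof. exact: measurable_fun_pair. Qed.

Let joint : {measure set (T1 * T2) -> \bar R}.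
Proof.
refine (pushforward P (fun w => (X w, Y w))); exact: measurable_XY.
Defined.

Let jointE A : measurable A -> (distribution P X \x m) A = joint A.
Proof.
apply: product_measure_unique => B C mB mC.
transitivity (P (Y @^-1` C) * P (X @^-1` B)).
  by rewrite -YX// setIC.
by rewrite muleC; congr (_ * _); exact: Ym.
Qed.

(** By independence the joint law is the product of the law of [X] and [m]; what remains is
    Tonelli. *)
Lemma ge0_expectation_independent (h : T1 * T2 -> \bar R) :
  measurable_fun setT h -> (forall z, 0 <= h z) ->
  \int[P]_w h (X w, Y w) = \int[P]_w \int[m]_y h (X w, y).
Proof.
move=> mh h0.
transitivity (\int[joint]_z h z).
  by rewrite [RHS]ge0_integral_pushforward.
rewrite -(eq_measure_integral joint (fun A mA _ => jointE mA)).
rewrite fubini_tonelli1// /fubini_F.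
rewrite ge0_integral_distribution//; last by move=> x; exact: integral_ge0.
exact: (measurable_fun_fubini_tonelli_F h).
Qed.

Lemma integrable_independent (h : T1 * T2 -> \bar R) :
  measurable_fun setT h ->
  \int[P]_w \int[m]_y `|h (X w, y)| < +oo ->
  P.-integrable setT (fun w => h (X w, Y w)).
Proof.
move=> mh hoo; apply/integrableP; split; first exact: (measurableT_comp mh).
rewrite (ge0_expectation_independent (h := fun z => `|h z|))//.
exact: measurableT_comp.
Qed.

Lemma expectation_independent (h : T1 * T2 -> \bar R) :
  measurable_fun setT h ->
  P.-integrable setT (fun w => h (X w, Y w)) ->
  \int[P]_w h (X w, Y w) = \int[P]_w \int[m]_y h (X w, y).
Proof.
move=> mh ih.
have ih' : (distribution P X \x m).-integrable setT h.
  apply/integrableP; split => //.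
  rewrite (eq_measure_integral joint (fun A mA _ => jointE mA)).
  rewrite ge0_integral_pushforward//=; last exact: measurableT_comp.
  by case/integrableP : ih.
transitivity (\int[joint]_z h z).
  by rewrite [RHS]integral_pushforward.
rewrite -(eq_measure_integral joint (fun A mA _ => jointE mA)).
rewrite -integral12_prod_meas1//.
have mF := measurable_fubini_F ih'.
rewrite integral_distribution//.
have /integrableP[_ Foo] := integrable_fubini_F ih'.
apply/integrableP; split; first exact: (measurableT_comp mF).
by move: Foo; rewrite ge0_integral_distribution//; exact: measurableT_comp.
Qed.

End independence.

(** * Uniqueness of Fourier coefficients *)

Section threshold_polynomials.
Variable R : realType.

Lemma bernoulli_ge (y : R) n : -1 <= y -> 1 + n%:R * y <= (1 + y) ^+ n.
Proof.
move=> y1; elim: n => [|n IHn]; first by rewrite mul0r addr0 expr0.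
rewrite exprS -natr1; apply: (@le_trans _ _ ((1 + y) * (1 + n%:R * y))).
  have n0 : 0 <= n%:R :> R by [].
  nra.
by rewrite ler_wpM2l//; lra.
Qed.

(* [4 ^ n * u ^+ n.*2 = (2 * u) ^+ n.*2] tends to 0 if [u < 1/2] and is at
   least 1 otherwise; Bernoulli's inequality does the rest. *)
Lemma threshold_cvg (u : R) : 0 <= u <= 1 ->
  (1 - u ^+ n.*2) ^+ (n * 4 ^ n) @[n --> \oo] --> ((u < 2^-1)%R%:R : R).
Proof.
move=> /andP[u0 u1].
have y01 n : 0 <= u ^+ n.*2 <= 1 by rewrite exprn_ge0// exprn_ile1.
have [uh|uh] /= := ltP u 2^-1.
- pose q := 2 * u; have q0 : 0 <= q by rewrite mulr_ge0.
  have q1 : q < 1 by rewrite /q; lra.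
  (* Bernoulli bounds the power below by 1 - n q^(2n). Bounding n q^n by a constant leaves one
     factor q^n, which tends to 0. *)
  have nq n : n%:R * q ^+ n <= (1 - q)^-1.
    rewrite -[leRHS]mul1r ler_pdivlMr ?subr_gt0//.
    suff : q ^+ n * (1 + n%:R * (1 - q)) <= 1.
      by apply: le_trans; rewrite [leRHS]mulrDr mulr1 [in leRHS]mulrCA mulrA lerDr exprn_ge0.
    elim: n => [|n]; first by rewrite mul0r addr0 expr0 mulr1.
    apply: le_trans; rewrite exprSr -mulrA ler_wpM2l ?exprn_ge0// -natr1.
    rewrite -subr_ge0 (_ : _ - _ = (1 - q) ^+ 2 * (1 + n%:R)); last by ring.
    by rewrite mulr_ge0 ?sqr_ge0// addr_ge0.
  apply: (@squeeze_cvgr _ _ _ _ (fun n => 1 - (1 - q)^-1 * q ^+ n) (cst 1)).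
  + near=> n; apply/andP; split; last first.
      by have /andP[h0 h1] := y01 n; rewrite exprn_ile1 ?subr_ge0// gerBl.
    apply: (@le_trans _ _ (1 + (n * 4 ^ n)%:R * (- u ^+ n.*2))); last first.
      by apply: bernoulli_ge; have /andP[h0 h1] := y01 n; rewrite lerN2.
    rewrite mulrN lerD2l lerN2 natrM natrX -mulrA.
    have -> : 4%:R ^+ n * u ^+ n.*2 = q ^+ n * q ^+ n.
      by rewrite -exprD addnn -!muln2 ![(n * 2)%N]mulnC !exprM -exprMn /q; congr (_ ^+ _); ring.
    by rewrite mulrA ler_wpM2r ?exprn_ge0.
  + rewrite -[X in _ --> X]subr0; apply: cvgB; first exact: cvg_cst.
    rewrite -(mulr0 (1 - q)^-1); apply: cvgMl_tmp.
    by apply: cvg_expr; rewrite ger0_norm.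
  + exact: cvg_cst.
- apply: (@squeeze_cvgr _ _ _ _ (cst 0) (@harmonic R)).
  + near=> n; have /andP[h0 h1] := y01 n; apply/andP; split.
      by rewrite exprn_ge0// subr_ge0.
    rewrite /harmonic /= -[leRHS]mul1r ler_pdivlMr//.
    set m := (n * 4 ^ n)%N; set y := u ^+ n.*2.
    (* Here (1 + y)^m >= 1 + m y >= n + 1, because 4^n y = (2 u)^(2n) >= 1, while (1 - y)^m (1 +
       y)^m = (1 - y^2)^m <= 1. *)
    apply: (@le_trans _ _ ((1 - y) ^+ m * (1 + y) ^+ m)).
      rewrite ler_wpM2l ?exprn_ge0 ?subr_ge0//.
      apply: le_trans (bernoulli_ge _ _); last by rewrite (le_trans _ h0)// lerN10.
      rewrite -natr1 addrC lerD2l /m natrM natrX -mulrA ler_peMr//.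
      rewrite /y -muln2 mulnC exprM -exprMn exprn_ege1//; nra.
    rewrite -exprMn exprn_ile1//; last by nra.
    by rewrite mulr_ge0 ?subr_ge0// addr_ge0.
  + exact: cvg_cst.
  + exact: cvg_harmonic.
Unshelve. all: by end_near. Qed.

End threshold_polynomials.

(** * The sigma-algebra of multiplier sets *)

Section multipliers.
Context d (T : measurableType d) (R : realType) (mu : {measure set T -> \bar R}).
Context (K : Type) (E : K -> T -> R) (f : T -> R).
Hypotheses (intf : mu.-integrable setT (EFin \o f))
  (mE : forall k, measurable_fun setT (E k))
  (E1 : forall k x, `|E k x| <= 1)
  (EM : forall k l, exists a b p q, forall x, E k x * E l x = a * E p x + b * E q x)
  (fE0 : forall k, \int[mu]_x (f x * E k x) = 0)
  (e : K) (Ee : forall x, E e x = 1).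

Definition bounded_measurable (g : T -> R) :=
  measurable_fun setT g /\ exists M, forall x, `|g x| <= M.

Lemma bounded_measurableM g h : bounded_measurable g -> bounded_measurable h ->
  bounded_measurable (fun x => g x * h x).
Proof.
move=> [mg [M gM]] [mh [N hN]]; split; first exact: measurable_funM.
by exists (M * N) => x; rewrite normrM ler_pM.
Qed.

Lemma bounded_measurable_lin a b g h : bounded_measurable g ->
  bounded_measurable h -> bounded_measurable (fun x => a * g x + b * h x).
Proof.
move=> [mg [M gM]] [mh [N hN]]; split.
  by apply: measurable_funD; apply: measurable_funM.
exists (`|a| * M + `|b| * N) => x; rewrite (le_trans (ler_normD _ _))//.
by rewrite !normrM lerD// ler_wpM2l.
Qed.

Lemma bounded_measurable_cst a : bounded_measurable (cst a).
Proof. by split => //; exists `|a|. Qed.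

Lemma bounded_measurable_E k : bounded_measurable (E k).
Proof. by split => //; exists 1. Qed.

Lemma integrable_bounded_mul g : bounded_measurable g ->
  mu.-integrable setT (EFin \o (fun x => f x * g x)).
Proof.
move=> [mg [M gM]].
have bg : [bounded g x | x in setT].
  exists `|M|; split; first exact: num_real.
  move=> N MN x _ /=; rewrite (le_trans (gM x))// ltW// (le_lt_trans _ MN)//.
  exact: ler_norm.
exact: (integrableMl measurableT intf mg bg).
Qed.

(** All coefficients of the product of [f] and [g] vanish; [fE0] is the case where [g] is the
    constant 1. *)
Let ann g := forall k, \int[mu]_x (f x * (g x * E k x)) = 0.

(* Multipliers form an algebra that contains every [E k] and is closed under
   bounded pointwise limits, so that the sets with a multiplier indicator form
   a sigma-algebra; on it [f] integrates to zero. *)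
Definition multiplier u := bounded_measurable u /\
  forall g, bounded_measurable g -> ann g -> ann (fun x => g x * u x).

Lemma multiplierM u v : multiplier u -> multiplier v ->
  multiplier (fun x => u x * v x).
Proof.
move=> [bu annu] [bv annv]; split; first exact: bounded_measurableM.
move=> g bg ag k; have := annv _ (bounded_measurableM bg bu) (annu _ bg ag) k.
by under [in X in X -> _]eq_Rintegral do rewrite -[g _ * _ * _]mulrA.
Qed.

Lemma multiplier_lin a b u v : multiplier u -> multiplier v ->
  multiplier (fun x => a * u x + b * v x).
Proof.
move=> [bu annu] [bv annv]; split; first exact: bounded_measurable_lin.
move=> g bg ag k; have bE := bounded_measurable_E k.
have bgu := bounded_measurableM (bounded_measurableM bg bu) bE.
have bgv := bounded_measurableM (bounded_measurableM bg bv) bE.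
have iu := integrable_bounded_mul bgu.
have iv := integrable_bounded_mul bgv.
transitivity (\int[mu]_x (a * (f x * (g x * u x * E k x)) +
    b * (f x * (g x * v x * E k x)))).
  by apply: eq_Rintegral => x _; ring.
rewrite RintegralD//; [|exact: (integrableZl _ a iu)|exact: (integrableZl _ b iv)].
by rewrite !RintegralZl// annu// annv// !mulr0 addr0.
Qed.

(** The product formula [EM] keeps [E k] times [E l] in the span of the family, where the
    coefficients already vanish. *)
Lemma multiplier_E k : multiplier (E k).
Proof.
split; first exact: bounded_measurable_E.
move=> g bg ag l; have [a [b [p [q Epq]]]] := EM k l.
have ip := integrable_bounded_mul (bounded_measurableM bg (bounded_measurable_E p)).
have iq := integrable_bounded_mul (bounded_measurableM bg (bounded_measurable_E q)).
transitivity (\int[mu]_x (a * (f x * (g x * E p x)) + b * (f x * (g x * E q x)))).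
  by apply: eq_Rintegral => x _; rewrite -[_ * _ * E l x]mulrA Epq; ring.
rewrite RintegralD//; [|exact: (integrableZl _ a ip)|exact: (integrableZl _ b iq)].
by rewrite !RintegralZl// !ag !mulr0 addr0.
Qed.

Lemma multiplier_cst a : multiplier (cst a).
Proof.
rewrite (_ : cst a = fun x => a * E e x + 0 * E e x).
  by apply: multiplier_lin; exact: multiplier_E.
by apply/funext => x; rewrite Ee mulr1 mul0r addr0.
Qed.

Lemma multiplierX u n : multiplier u -> multiplier (fun x => u x ^+ n).
Proof.
move=> mu'; elim: n => [|n IHn]; first exact: (multiplier_cst 1).
by under eq_fun do rewrite exprS; exact: multiplierM.
Qed.

Lemma multiplier_cvg (u : (T -> R)^nat) (v : T -> R) M :
  (forall n, multiplier (u n)) -> (forall n x, `|u n x| <= M) ->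
  (forall x, u n x @[n --> \oo] --> v x) -> multiplier v.
Proof.
move=> mu' uM uv.
have mv : measurable_fun setT v.
  apply: (@measurable_fun_cvg _ _ _ setT u) => [n|x _]; last exact: uv.
  by have [[]] := mu' n.
have vM x : `|v x| <= M.
  have nv : `|u n x| @[n --> \oo] --> `|v x| by apply: cvg_norm; exact: uv.
  rewrite -(cvg_lim _ nv)//; apply: limr_le; first by apply/cvg_ex; exists `|v x|.
  by near=> n; exact: uM.
split; first by split => //; exists M.
move=> g bg ag k; have bE := bounded_measurable_E k.
have bn n := bounded_measurableM (bounded_measurableM bg (mu' n).1) bE.
have bv : bounded_measurable v by split => //; exists M.
have bgv := bounded_measurableM (bounded_measurableM bg bv) bE.
have [mg [N gN]] := bg.
have := @dominated_cvg _ _ _ mu setT measurableT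
  (fun n x => (f x * (g x * u n x * E k x))%:E) (fun x => (f x * (g x * v x * E k x))%:E)
  (fun x => (`|f x| * (`|N| * `|M|))%:E).
have h0 n : (\int[mu]_x (f x * (g x * u n x * E k x))%:E = 0)%E.
  have := (mu' n).2 g bg ag k; rewrite /Rintegral => h.
  by rewrite -[LHS]fineK ?h//; apply: integrable_fin_num => //; exact: integrable_bounded_mul.
move=> H; rewrite /Rintegral; suff -> : (\int[mu]_x (f x * (g x * v x * E k x))%:E = 0)%E by [].
apply: (@cvg_unique _ _
  ((fun n => \int[mu]_x (f x * (g x * u n x * E k x))%:E)%E @ \oo)) => //; last first.
  rewrite (_ : (fun n : nat => _) = cst 0%E); first exact: cvg_cst.
  by apply/funext => n; exact: h0.
apply: H.
- by move=> n; apply: (measurable_int mu); exact: integrable_bounded_mul.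
- move=> x _; apply: cvg_EFin; first by near=> n.
  apply: cvgMl_tmp; apply: cvgMr_tmp; apply: cvgMl_tmp; exact: uv.
- by [].
- have : mu.-integrable setT (fun x => (`|N| * `|M|)%:E * `|(f x)%:E|)%E.
    by apply: integrableZl => //; exact: integrable_abse.
  by apply: eq_integrable => // x _ /=; rewrite -EFinM mulrC.
- move=> n x _ /=; rewrite lee_fin !normrM ler_wpM2l// -[leRHS]mulr1.
  rewrite !ler_pM// ?mulr_ge0//.
  + by rewrite (le_trans (gN x))// ler_norm.
  + by rewrite (le_trans (uM n x))// ler_norm.
Unshelve. all: by end_near. Qed.

Lemma multiplier_ae u v : multiplier u -> bounded_measurable v ->
  {ae mu, forall x, u x = v x} -> multiplier v.
Proof.
move=> [bu annu] bv uv; split => // g bg ag k; have bE := bounded_measurable_E k.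
rewrite -(annu g bg ag k); congr fine; apply: ae_eq_integral => //.
- apply: (measurable_int mu); apply: integrable_bounded_mul.
  by do 2 apply: bounded_measurableM => //.
- apply: (measurable_int mu); apply: integrable_bounded_mul.
  by do 2 apply: bounded_measurableM => //.
- by apply: filterS uv => x /= -> _.
Qed.

(** This is the passage from the algebra to indicators: the polynomials of [threshold_cvg] evaluated
    at [u] are multipliers bounded by 1. *)
Lemma multiplier_threshold u : multiplier u -> (forall x, 0 <= u x <= 1) ->
  multiplier (fun x => (u x < 2^-1)%R%:R).
Proof.
move=> mu' u01.
apply: (@multiplier_cvg (fun n x => (1 - u x ^+ n.*2) ^+ (n * 4 ^ n)) _ 1).
- move=> n; apply: multiplierX.
  rewrite (_ : (fun _ => _) = fun x => 1 * cst 1 x + (-1) * u x ^+ n.*2).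
    by apply: multiplier_lin; [exact: multiplier_cst|exact: multiplierX].
  by apply/funext => x; rewrite /cst mul1r mulN1r.
- move=> n x; have /andP[u0 u1] := u01 x.
  have y0 : 0 <= u x ^+ n.*2 by rewrite exprn_ge0.
  have y1 : u x ^+ n.*2 <= 1 by rewrite exprn_ile1.
  by rewrite ger0_norm ?exprn_ge0 ?subr_ge0// exprn_ile1 ?subr_ge0// gerBl.
- by move=> x; exact: threshold_cvg.
Qed.

Definition multiplier_set (A : set T) := multiplier (\1_A : T -> R).

Lemma multiplier_set_lt w c : multiplier w -> (forall x, `|w x| <= 1) ->
  multiplier_set [set x | w x < c].
Proof.
(* Since |w - c| <= 1 + |c| = D / 2, the function 1/2 + (w - c) / D takes values in [0, 1] and is
   below 1/2 exactly where w < c. *)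
move=> mw w1; pose D := 2 * (1 + `|c|); have D0 : 0 < D by rewrite mulr_gt0// ltr_pwDl.
have c1 : - `|c| <= c <= `|c| by rewrite -ler_norml.
pose u x := 2^-1 + D^-1 * (w x - c).
have mu' : multiplier u.
  rewrite (_ : u = fun x => (2^-1 - D^-1 * c) * cst 1 x + D^-1 * w x).
    by apply: multiplier_lin; [exact: multiplier_cst|].
  by apply/funext => x; rewrite /u /cst; ring.
have u01 x : 0 <= u x <= 1.
  have /andP[e1 e2] : -1 <= w x <= 1 by rewrite -ler_norml.
  have /andP[c2 c3] := c1.
  have : - 2^-1 <= D^-1 * (w x - c) <= 2^-1.
    by rewrite mulrC ler_pdivlMr// ler_pdivrMr// /D; apply/andP; split; lra.
  by rewrite /u => /andP[]; lra.
rewrite /multiplier_set (_ : \1__ = fun x => (u x < 2^-1)%R%:R).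
  exact: multiplier_threshold.
apply/funext => x; rewrite indicE; congr (_%:R); congr nat_of_bool.
have -> : (u x < 2^-1) = (w x < c).
  by rewrite /u -[ltRHS]addr0 ltrD2l pmulr_rlt0 ?invr_gt0// subr_lt0.
by apply/idP/idP => [/set_mem//|h]; exact/mem_set.
Qed.

Lemma multiplier_set_gt w c : multiplier w -> (forall x, `|w x| <= 1) ->
  multiplier_set [set x | c < w x].
Proof.
move=> mw w1; rewrite (_ : [set x | _] = [set x | 0 * cst 1 x + (-1) * w x < - c]).
  apply: multiplier_set_lt.
    by apply: multiplier_lin => //; exact: multiplier_cst.
  by move=> x; rewrite mul0r add0r mulN1r normrN.
by apply/seteqP; split => x /=; rewrite mul0r add0r mulN1r ltrN2.
Qed.

Lemma multiplier_setC A : multiplier_set A -> multiplier_set (~` A).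
Proof.
move=> mA; rewrite /multiplier_set (_ : \1__ = fun x => 1 * cst 1 x + (-1) * \1_A x).
  by apply: multiplier_lin => //; exact: multiplier_cst.
by apply/funext => x; rewrite /= !indicE in_setC /cst; case: (x \in A) => /=; ring.
Qed.

Lemma multiplier_setI A B : multiplier_set A -> multiplier_set B ->
  multiplier_set (A `&` B).
Proof. by move=> mA mB; rewrite /multiplier_set indicI; exact: multiplierM. Qed.

Lemma multiplier_setU A B : multiplier_set A -> multiplier_set B ->
  multiplier_set (A `|` B).
Proof.
move=> mA mB; rewrite -[A]setCK -[B]setCK -setCI.
by apply: multiplier_setC; apply: multiplier_setI; exact: multiplier_setC.
Qed.

Lemma multiplier_set_sigma_algebra : sigma_algebra setT multiplier_set.
Proof.
split.
- rewrite /multiplier_set indic0; exact: multiplier_cst.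
- by move=> A mA; rewrite setTD; exact: multiplier_setC.
- move=> F mF; rewrite -[\bigcup_i _]setCK setC_bigcup.
  apply: multiplier_setC; rewrite /multiplier_set.
  (* Finite products of indicators converge pointwise to the indicator of the countable
     intersection, and stay bounded by 1. *)
  pose v n x : R := \prod_(i < n) \1_(~` F i) x.
  apply: (@multiplier_cvg v _ 1) => [n|n x|x].
  + elim: n => [|n IHn].
      rewrite (_ : v 0 = cst 1); first exact: multiplier_cst.
      by apply/funext => x; rewrite /v big_ord0.
    rewrite (_ : v n.+1 = fun x => v n x * \1_(~` F n) x).
      by apply: multiplierM => //; exact: multiplier_setC.
    by apply/funext => x; rewrite /v big_ord_recr.
  + rewrite normr_prod prodr_ile1// => i _; rewrite indicE.
    by case: (x \in _); rewrite ?normr1 ?normr0 lexx ler01.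
  + have [h|h] := pselect ((\bigcap_i ~` F i) x).
      rewrite indicE mem_set// (_ : v ^~ x = cst 1); first exact: cvg_cst.
      apply/funext => n; rewrite /v big1// => i _.
      by rewrite indicE mem_set//; exact: h.
    rewrite indicE memNset//.
    have [i Fi] : exists i, F i x.
      by apply: contrapT => /forallNP nF; apply: h => i _; exact: nF.
    apply: cvg_near_cst; exists i.+1 => // n /= ni.
    rewrite /v (bigD1 (Ordinal ni))//= indicE memNset ?mul0r//.
Qed.

(** The indicator of [A], applied to the constant 1 and tested against [E e], which is 1, shows that
    [f] integrates to zero over every measurable [A]. *)
Lemma ae_eq0_multiplier_set :
  (forall A, measurable A -> multiplier_set A) -> {ae mu, forall x, f x = 0}.
Proof.
move=> all_mult.
have : ae_eq mu setT (EFin \o f) (cst 0%E).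
  apply: integral_ae_eq => // A _ mA; rewrite integral0.
  have [_ /(_ (cst 1) (bounded_measurable_cst 1)) h] := all_mult A mA.
  have ann1 : ann (cst 1).
    by move=> k; rewrite -[RHS](fE0 k); apply: eq_Rintegral => x _; rewrite mul1r.
  have := h ann1 e; rewrite /Rintegral => h0.
  rewrite integral_mkcond -[LHS]fineK; last first.
    apply: integrable_fin_num => //.
    by apply/(integrable_mkcond (EFin \o f) mA); exact: integrableS intf.
  apply: (@eq_trans _ _ 0%:E) => //; congr EFin; rewrite -[RHS]h0; congr fine.
  apply: eq_integral => x _.
  rewrite patchE indicE Ee /= mul1r mulr1.
  by case: (x \in A); rewrite ?mulr1 ?mulr0.
by apply: filterS => x /= h; have := h Logic.I => -[].
Qed.

End multipliers.

(** * Trigonometric functions generate the measurable sets of the torus *)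

Section fourier_uniqueness.
Variable R : realType.
Local Notation T2 := (measurableTypeR R * measurableTypeR R)%type.

(** The real and imaginary parts of exp (i k.x), indexed together so that a product of two of them
    is again a combination of two of them. *)
Definition trig (kb : (int * int) * bool) (x : R * R) : R :=
  if kb.2 then cos (dot (intpt R kb.1) x) else sin (dot (intpt R kb.1) x).

Lemma dot_intptD k l x : dot (intpt R (k + l)) x = dot (intpt R k) x + dot (intpt R l) x.
Proof. by rewrite /dot /= !intrD; ring. Qed.

Lemma dot_intptN k x : dot (intpt R (- k)) x = - dot (intpt R k) x.
Proof. by rewrite /dot /= !mulrNz; ring. Qed.

Lemma trig_le1 kb x : `|trig kb x| <= 1.
Proof.
by case: kb => k [] /=; rewrite ler_norml ?cos_geN1 ?cos_le1 ?sin_geN1 ?sin_le1.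
Qed.

Lemma measurable_dot k : measurable_fun [set: T2] (dot (intpt R k)).
Proof.
by apply: measurable_funD; apply: measurable_funM.
Qed.

Lemma measurable_trig kb : measurable_fun [set: T2] (trig kb).
Proof.
case: kb => k [] /=; apply: (measurableT_comp _ (measurable_dot k)).
- by apply: continuous_measurable_fun; exact: continuous_cos.
- by apply: continuous_measurable_fun; exact: continuous_sin.
Qed.

Lemma trigM kb lb : exists a b p q, forall x,
  trig kb x * trig lb x = a * trig p x + b * trig q x.
Proof.
case: kb lb => k [] [l []]; exists 2^-1.
- exists 2^-1, (k + l, true), (k - l, true) => x.
  by rewrite /trig /= !dot_intptD dot_intptN cosB cosD; field.
- exists (- 2^-1), (k + l, false), (k - l, false) => x.
  by rewrite /trig /= !dot_intptD dot_intptN sinB sinD; field.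
- exists 2^-1, (k + l, false), (k - l, false) => x.
  by rewrite /trig /= !dot_intptD dot_intptN sinB sinD; field.
- exists (- 2^-1), (k - l, true), (k + l, true) => x.
  by rewrite /trig /= !dot_intptD dot_intptN cosB cosD; field.
Qed.

Lemma trig0 x : trig (0, true) x = 1.
Proof. by rewrite /trig /= /dot /= !mul0r addr0 cos0. Qed.

(** The endpoints 0 and 2 pi are one point of the torus, which periodic functions cannot separate;
    they are discarded as a null set. *)
Lemma uniform_ae_open :
  {ae uniform_prob (two_pi_gt0 R), forall t, 0 < t < 2 * pi}.
Proof.
have m0 : measurable (~` `]0%R, (2 * pi)%R[%classic : set (measurableTypeR R)).
  exact: measurableC.
exists (~` `]0%R, (2 * pi)%R[%classic); split => //.
rewrite -(setIT (~` _)) -integral_indic// ge0_integral_uniform//; last first.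
  by apply/measurable_EFinP; exact: measurable_indic.
transitivity (((2 * pi)^-1)%:E * \int[lebesgue_measure]_x (\1_[set 0 : R] x)%:E)%E; last first.
  by rewrite integral_indic// setIT /= lebesgue_measure_set1 mule0.
congr (_ * _)%E; apply: eq_integral => x _.
rewrite -EFinM; congr EFin; rewrite /cell1 !indicE in_setC.
have -> : (x \in (`]0%R, (2 * pi)%R[%classic : set R)) = (0 < x < 2 * pi).
  by apply/idP/idP => [/set_mem|h]; [|apply/mem_set]; rewrite /= in_itv.
have -> : (x \in [set 0 : R]) = (x == 0).
  by apply/idP/eqP => [/set_mem//|->]; exact/mem_set.
rewrite lt_neqAle le_eqVlt eq_sym.
have [->|x0] := eqVneq x 0; first by rewrite two_pi_gt0 !mulr1.
by case: (0 < x) => /=; case: (x < _) => /=; rewrite ?mul0r ?mulr0.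
Qed.

Lemma haarX (A B : set (measurableTypeR R)) : measurable A -> measurable B ->
  haar R (A `*` B) =
  (uniform_prob (two_pi_gt0 R) A * uniform_prob (two_pi_gt0 R) B)%E.
Proof. exact: product_measure1E. Qed.

Lemma haar_ae_open : {ae haar R, forall x : T2, 0 < x.1 < 2 * pi /\ 0 < x.2 < 2 * pi}.
Proof.
have [A [mA A0 hA]] := uniform_ae_open.
exists ((A `*` setT) `|` (setT `*` A)); split.
- by apply: measurableU; exact: measurableX.
- apply/eqP; rewrite eq_le measure_ge0 andbT.
  have mA1 : measurable (A `*` [set: measurableTypeR R]) by exact: measurableX.
  have mA2 : measurable ([set: measurableTypeR R] `*` A) by exact: measurableX.
  have h1 : haar R (A `*` setT) = 0%E by rewrite haarX// A0 mul0e.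
  have h2 : haar R (setT `*` A) = 0%E by rewrite haarX// A0 mule0.
  apply: (le_trans (measureU2 (haar R) mA1 mA2)).
  by rewrite -[leRHS]adde0; apply: leeD; [rewrite -[leRHS]h1|rewrite -[leRHS]h2].
- move=> [x y] /= /not_andP[] h; [left|right]; split => //=; exact: hA.
Qed.

Variable f : R * R -> R.
Hypotheses (intf : (haar R).-integrable setT (EFin \o f))
  (f0 : forall kb, \int[haar R]_x (f x * trig kb x) = 0).

Let mset := multiplier_set (haar R : {measure set T2 -> \bar R}) trig f.

Let msetE : sigma_algebra setT mset.
Proof.
apply: (multiplier_set_sigma_algebra intf measurable_trig trig_le1 trigM).
exact: trig0.
Qed.

(* On ]0, 2 pi[, [cos t] determines [t] up to the reflection [2 pi - t], and
   the sign of [sin t] tells the two apart. *)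
Let mset_ray (p : T2 -> measurableTypeR R) (k : int * int) (a : R) :
  measurable_fun setT p -> (forall x, dot (intpt R k) x = p x) ->
  {ae haar R, forall x, 0 < p x < 2 * pi} -> mset (p @^-1` `]-oo, a[%classic).
Proof.
move=> mp kp aep.
have mcos : multiplier (haar R) trig f (fun x : T2 => cos (p x)).
  rewrite (_ : (fun _ => _) = trig (k, true)).
    exact: (multiplier_E intf measurable_trig trig_le1 trigM).
  by apply/funext => x; rewrite /trig /= kp.
have cos1 (x : T2) : `|cos (p x)| <= 1 by rewrite ler_norml cos_geN1 cos_le1.
have mC c : mset [set x | cos (p x) < c].
  exact: (multiplier_set_lt intf measurable_trig trig_le1 trigM trig0 _ mcos).
have mC' c : mset [set x | c < cos (p x)].
  exact: (multiplier_set_gt intf measurable_trig trig_le1 trigM trig0 _ mcos).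
pose S := [set x : T2 | sin (p x) < 0].
have mS : mset S.
  rewrite (_ : S = [set x | trig (k, false) x < 0]).
    apply: (multiplier_set_lt intf measurable_trig trig_le1 trigM trig0).
      exact: (multiplier_E intf measurable_trig trig_le1 trigM).
    exact: trig_le1.
  by apply/seteqP; split => x; rewrite /S /trig /= kp.
have msC A : mset A -> mset (~` A).
  exact: (multiplier_setC intf measurable_trig trig_le1 trigM trig0).
have sinN (t : R) : pi < t < 2 * pi -> sin t < 0.
  move=> /andP[t1 t2]; have := @sin_gt0_pi R (t - pi).
  rewrite sinB cospi sinpi mulr0 subr0 mulrN1 oppr_gt0 subr_gt0 t1 ltrBlDr.
  by rewrite -mulr2n -mulr_natl; apply.
have sinP (t : R) : 0 <= t <= pi -> 0 <= sin t by move=> h; exact: sin_ge0_pi.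
(* It suffices to describe the half-plane on ]0, 2 pi[, since multipliers are stable under almost
   everywhere equality. *)
have ae_mset B : mset B -> {ae haar R, forall x, 0 < p x < 2 * pi -> (B x <-> p x < a)} ->
    mset (p @^-1` `]-oo, a[%classic).
  move=> mB hB; apply: (multiplier_ae (u := \1_B) intf measurable_trig trig_le1 mB).
    split; last first.
      by exists 1 => x; rewrite indicE; case: (_ \in _); rewrite ?normr1 ?normr0.
    by apply: measurable_indic; rewrite -[_ @^-1` _]setTI; exact: mp.
  apply: filterS2 aep hB => x x02 /(_ x02) [h1 h2].
  rewrite !indicE; congr (_%:R); congr nat_of_bool.
  by apply/idP/idP => /set_mem h; apply/mem_set; move: h; rewrite /= in_itv /=.
have [a0|a0] := leP a 0.
  apply: (ae_mset set0); first by have [] := msetE.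
  by apply: aeW => x /andP[x0 _]; split => // /lt_le_trans/(_ a0)/(lt_trans x0); rewrite ltxx.
have [a2|a2] := leP (2 * pi) a.
  apply: (ae_mset setT); first by rewrite -setC0; apply: msC; have [] := msetE.
  by apply: aeW => x /andP[_ x0]; split => // _; exact: lt_le_trans a2.
(* For 0 < a <= pi, the condition p < a means that sin p >= 0 and cos p > cos a, cosine being
   decreasing on [0, pi]. *)
have [api|api] := leP a pi.
  apply: (ae_mset (~` S `&` [set x | cos a < cos (p x)])).
    exact: (multiplier_setI (msC _ mS) (mC' _)).
  apply: aeW => x /andP[x0 x2]; split => [[/= /negP]|xa].
    rewrite -leNgt => sx; have xpi : p x <= pi.
      by rewrite leNgt; apply/negP => xpi; have := sinN (p x); rewrite xpi x2 ltNge sx => /(_ isT).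
    by rewrite ltr_cos// in_itv/= ?(ltW x0) ?(ltW a0).
  have xpi := le_trans (ltW xa) api.
  split => /=; first by apply/negP; rewrite -leNgt sinP// (ltW x0).
  by rewrite ltr_cos// in_itv/= ?(ltW x0) ?(ltW a0).
(* For a > pi the whole first half is included, and on ]pi, 2 pi[ cosine is increasing. *)
apply: (ae_mset (~` S `|` [set x | cos (p x) < cos a])).
  exact: (multiplier_setU intf measurable_trig trig_le1 trigM trig0 (msC _ mS) (mC _)).
apply: aeW => x /andP[x0 x2].
have cosNE (t : R) : cos t = - cos (t - pi) by rewrite cosB cospi sinpi mulr0 addr0 mulrN1 opprK.
have [xpi|xpi] := leP (p x) pi.
  split=> [_|_]; first exact: le_lt_trans api.
  by left; apply/negP; rewrite -leNgt sinP// (ltW x0).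
have itv (t : R) : pi < t < 2 * pi -> t - pi \in `[0, pi].
  move=> /andP[t1 t2]; rewrite in_itv /= subr_ge0 (ltW t1)/= lerBlDr.
  by rewrite -mulr2n -mulr_natl ltW.
have -> : (p x < a) = (cos (p x) < cos a).
  by rewrite (cosNE (p x)) (cosNE a) ltrN2 ltr_cos ?itv ?xpi ?api// ltrD2r.
split => [[|]//|h]; last by right.
by case; apply: sinN; rewrite xpi.
Qed.

Let mset_measurable (p : T2 -> measurableTypeR R) (k : int * int) B :
  measurable_fun setT p -> (forall x, dot (intpt R k) x = p x) ->
  {ae haar R, forall x, 0 < p x < 2 * pi} -> measurable B -> mset (p @^-1` B).
Proof.
move=> mp kp aep; move: B.
pose G := [set B : set (measurableTypeR R) | mset (p @^-1` B)].
have [s0 sC sU] := msetE.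
have sG : sigma_algebra setT G.
  split.
  - by rewrite /G /= preimage_set0.
  - by move=> A GA; rewrite /G /= setTD preimage_setC -setTD; exact: sC.
  - by move=> F GF; rewrite /G /= preimage_bigcup; exact: sU.
have subG : (RGenInftyO.G (R := R)).-sigma.-measurable `<=` G.
  by apply: smallest_sub => // _ [a ->]; exact: (mset_ray a mp kp aep).
move=> B mB; apply: subG; rewrite -RGenInftyO.measurableE; exact: mB.
Qed.

(** The frequencies (1, 0) and (0, 1) give the two coordinates, whose preimages of Borel sets
    generate the product sigma-algebra. *)
Lemma fourier_unique : {ae haar R, forall x : T2, f x = 0}.
Proof.
apply: (ae_eq0_multiplier_set intf f0 trig0).
apply: smallest_sub; first exact: msetE.
rewrite subUset; split => _ [B mB <-]; rewrite setTI.
- apply: (@mset_measurable _ (1, 0)) => //.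
  + by move=> x; rewrite /dot /= mul1r mul0r addr0.
  + by apply: filterS haar_ae_open => x [].
- apply: (@mset_measurable _ (0, 1)) => //.
  + by move=> x; rewrite /dot /= mul1r mul0r add0r.
  + by apply: filterS haar_ae_open => x [].
Qed.

End fourier_uniqueness.

(** * Convergence of Fourier series *)

Section rapid_convergence.
Context d (T : measurableType d) (R : realType) (mu : {measure set T -> \bar R}).

Lemma limn_einf_le (u : (\bar R)^nat) B : (forall n, u n <= B)%E -> (limn_einf u <= B)%E.
Proof.
move=> uB; rewrite limn_einf_lim; apply: lime_le; first exact: is_cvg_einfs.
apply: nearW => n; apply: le_trans (uB n).
by apply: ereal_inf_lbound; exists n => //=.
Qed.

Lemma fatou_bound (u : (T -> R)^nat) (v : T -> R) (B : \bar R) :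
  (forall n, measurable_fun setT (u n)) -> (forall n x, 0 <= u n x) ->
  measurable_fun setT v -> {ae mu, forall x, u n x @[n --> \oo] --> v x} ->
  (forall n, \int[mu]_x (u n x)%:E <= B)%E -> (\int[mu]_x (v x)%:E <= B)%E.
Proof.
move=> mun u0 mv uv uB.
have mE n : measurable_fun setT (fun x => (u n x)%:E) by exact/measurable_EFinP.
rewrite (@ae_eq_integral _ _ _ mu setT (fun x => limn_einf (fun n => (u n x)%:E)))//.
- by apply: le_trans (fatou mu measurableT mE _) (limn_einf_le uB) => n x _; rewrite lee_fin.
- exact/measurable_EFinP.
- rewrite (_ : (fun x => _) = fun x => (- limn_esup (fun n => - (u n x)%:E))%E).
    apply: measurableT_comp => //; apply: measurable_fun_limn_esup => n.
    exact: measurableT_comp.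
  by apply/funext => x; rewrite -limn_einfN; congr limn_einf; apply/funext => n; rewrite /= opprK.
- apply: filterS uv => x uvx _; apply/esym; apply: (cvg_limn_einf_sup _).1.
  by apply: cvg_EFin => //; near=> n.
Unshelve. all: by end_near. Qed.

Variable u : (T -> R)^nat.
Hypotheses (intu : forall n, mu.-integrable setT (EFin \o u n))
  (udiff : (\sum_(n <oo) \int[mu]_x `|(u n.+1 x - u n x)%:E| < +oo)%E).

Let mu_ n : measurable_fun setT (u n).
Proof. by apply/measurable_EFinP; exact: (measurable_int mu (intu n)). Qed.

(** The usual majorant of a rapidly Cauchy sequence in L^1: it is integrable, dominates every [u n],
    and where it is finite the telescoping series converges absolutely. *)
Let G x := (`|(u 0%N x)%:E| + \sum_(n <oo) `|(u n.+1 x - u n x)%:E|)%E.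

Let md n : measurable_fun setT (fun x => `|(u n.+1 x - u n x)%:E|%E).
Proof.
apply: measurableT_comp => //; apply/measurable_EFinP; exact: measurable_funB.
Qed.

Let intG : mu.-integrable setT G.
Proof.
have mG : measurable_fun setT G.
  apply: emeasurable_funD.
    by apply: measurableT_comp => //; exact/measurable_EFinP.
  by apply: ge0_emeasurable_sum => // n x _ _; exact: abse_ge0.
apply/integrableP; split => //.
under eq_integral do rewrite gee0_abs ?adde_ge0 ?abse_ge0 ?nneseries_ge0//.
rewrite ge0_integralD//; last 3 first.
- by apply: measurableT_comp => //; exact/measurable_EFinP.
- by move=> x _; exact: nneseries_ge0.
- by apply: ge0_emeasurable_sum => // n x _ _; exact: abse_ge0.
rewrite integral_nneseries//; apply: lte_add_pinfty => //.
by have /integrableP[] := intu 0%N.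
Qed.

Let uG n x : (`|(u n x)%:E| <= G x)%E.
Proof.
apply: (@le_trans _ _ (`|(u 0%N x)%:E| + \sum_(0 <= i < n) `|(u i.+1 x - u i x)%:E|)%E).
  elim: n => [|n IHn]; first by rewrite big_geq// adde0.
  rewrite big_nat_recr//= addeA; apply: (le_trans _ (leeD IHn (lexx _))).
  by rewrite -EFinD lee_fin -[in leLHS](subrKC (u n x) (u n.+1 x)) ler_normD.
by apply: leeD => //; apply: nneseries_lim_ge.
Qed.

Let cvgu x : G x \is a fin_num -> cvgn (fun n => u n x).
Proof.
move=> Gfin; pose w n := u n.+1 x - u n x.
have w_cvg : cvgn [normed series w].
  apply: nondecreasing_is_cvgn.
    by apply: nondecreasing_series => n _ _; exact: normr_ge0.
  exists (fine (G x)) => _ [n _ <-] /=; rewrite -lee_fin fineK// /series /= -sumEFin.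
  rewrite /G; apply: (le_trans (nneseries_lim_ge n _)); last by rewrite leeDr.
  by move=> i _.
have := normed_cvg w_cvg.
have -> : series w = (fun n => u n x - u 0%N x).
  apply/funext => n; rewrite /series /= /w; elim: n => [|n IHn].
    by rewrite big_geq// subrr.
  by rewrite big_nat_recr//= IHn addrC addrA subrK.
move=> /cvg_ex[l ul]; apply/cvg_ex; exists (l + u 0%N x).
rewrite (_ : (fun n => u n x) = fun n => (u n x - u 0%N x) + u 0%N x).
  by apply: cvgD => //; exact: cvg_cst.
by apply/funext => n; rewrite subrK.
Qed.

Lemma rapid_cvg : exists g : T -> R,
  [/\ mu.-integrable setT (EFin \o g),
      {ae mu, forall x, u n x @[n --> \oo] --> g x} &
      forall t, bounded_measurable t ->
        \int[mu]_x (u n x * t x) @[n --> \oo] --> \int[mu]_x (g x * t x)].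
Proof.
(* An upper limit is measurable everywhere, also on the null set where the sequence diverges. *)
pose g x := fine (limn_esup (fun n => (u n x)%:E)).
have mg : measurable_fun setT g.
  apply: measurableT_comp => //.
  by apply: measurable_fun_limn_esup => n; exact/measurable_EFinP.
have ug : {ae mu, forall x, u n x @[n --> \oo] --> g x}.
  apply: filterS (integrable_ae measurableT intG) => x /(_ Logic.I) Gx.
  have := cvgu Gx => /cvg_ex[l ul]; rewrite (_ : g x = l)// /g.
  rewrite (_ : l = fine l%:E)//; congr fine; apply: (cvg_limn_einf_sup _).2.
  by apply: cvg_EFin => //; near=> n.
have dom t : bounded_measurable t -> mu.-integrable setT (fun x => (g x * t x)%:E) /\
    (\int[mu]_x (u n x * t x) @[n --> \oo] --> \int[mu]_x (g x * t x)).
  move=> [mt [M tM]].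
  have h1 n : measurable_fun setT (fun x => (u n x * t x)%:E).
    by apply/measurable_EFinP; exact: measurable_funM.
  have h2 : measurable_fun setT (fun x => (g x * t x)%:E).
    by apply/measurable_EFinP; exact: measurable_funM.
  have h3 : {ae mu, forall x, setT x -> (u n x * t x)%:E @[n --> \oo] --> (g x * t x)%:E}.
    apply: filterS ug => x ux _; apply: cvg_EFin; first by near=> n.
    exact: cvgMr_tmp.
  have h4 : mu.-integrable setT (fun x => `|M|%:E * G x)%E by exact: integrableZl.
  have h5 : {ae mu, forall x n, setT x -> (`|(u n x * t x)%:E| <= `|M|%:E * G x)%E}.
    apply: aeW => x n _; rewrite EFinM abseM muleC; apply: lee_pmul => //.
    by rewrite lee_fin (le_trans (tM x))// ler_norm.
  have [ig _ h] := dominated_convergence measurableT h1 h2 h3 h4 h5.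
  by split => //; apply: fine_cvg; rewrite fineK//; exact: integrable_fin_num.
exists g; split => //; last by move=> t /dom[].
have [+ _] := dom _ (bounded_measurable_cst T 1).
by under eq_fun do rewrite mulr1.
Unshelve. all: by end_near. Qed.

End rapid_convergence.

(** * Orthogonality and Parseval for trigonometric sums *)

Section trigonometric_sums.
Variable R : realType.
Local Notation T2 := (measurableTypeR R * measurableTypeR R)%type.
Local Notation trig := (@trig R).

Lemma cos_2pi_int (n : int) : cos (2 * pi * n%:~R) = 1 :> R.
Proof.
have cosn (m : nat) : cos (2 * pi * m%:R) = 1 :> R.
  elim: m => [|m IHm]; first by rewrite mulr0 cos0.
  rewrite -[m.+1%:R]natr1 mulrDr mulr1.
  by rewrite [X in _ + X](mulr_natl pi 2) cosD2pi.
case: n => n; first exact: cosn.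
by rewrite NegzE mulrNz mulrN cosN cosn.
Qed.

Lemma sin_2pi_int (n : int) : sin (2 * pi * n%:~R) = 0 :> R.
Proof.
have := cos2Dsin2 (2 * pi * n%:~R : R); rewrite cos_2pi_int expr1n => h.
by apply/eqP; rewrite -sqrf_eq0; apply/eqP; lra.
Qed.

Lemma dotDr (x y z : R * R) : dot x (y + z) = dot x y + dot x z.
Proof. by rewrite /dot /=; ring. Qed.

Lemma dotNr (x y : R * R) : dot x (- y) = - dot x y.
Proof. by rewrite /dot /=; ring. Qed.

Lemma dotZr (a : R) (x y : R * R) : dot x (a *: y) = a * dot x y.
Proof. by rewrite /dot /= /GRing.scale /=; ring. Qed.

Lemma dotC (x y : R * R) : dot x y = dot y x.
Proof. by rewrite /dot; ring. Qed.

Lemma torus_periodic_trig kb : torus_periodic (trig kb).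
Proof.
move=> x m; case: kb => k b; rewrite /trig /= dotDr.
have -> : dot (intpt R k) ((2 * pi) *: intpt R m) = 2 * pi * (k.1 * m.1 + k.2 * m.2)%:~R.
  by rewrite dotZr /dot /= intrD !intrM.
by rewrite cosD sinD cos_2pi_int sin_2pi_int !mulr1 !mulr0 subr0 addr0.
Qed.

Lemma sqnorm_gt0 k : k != 0 -> 0 < sqnorm R k.
Proof.
case: k => k1 k2; rewrite /sqnorm /dot /= -!expr2 => k0.
rewrite lt_neqAle addr_ge0 ?sqr_ge0// andbT eq_sym paddr_eq0 ?sqr_ge0//.
by rewrite !sqrf_eq0 !intr_eq0 -xpair_eqE.
Qed.

Lemma bounded_trig kb : bounded_measurable (trig kb : T2 -> R).
Proof. by split; [exact: measurable_trig|exists 1 => x; exact: trig_le1]. Qed.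

Lemma integrable_bounded_measurable d (T : measurableType d) (P : probability T R)
  (g : T -> R) : bounded_measurable g -> P.-integrable setT (EFin \o g).
Proof.
move=> bg; have := integrable_bounded_mul (finite_measure_integrable_cst P 1 measurableT) bg.
by apply: eq_integrable => // x _ /=; rewrite mul1r.
Qed.

Lemma Rintegral_cst1 (a : R) : \int[haar R]_x a = a.
Proof.
rewrite Rintegral_cst// -[RHS]mulr1; congr (_ * _).
by rewrite -[RHS]/(fine 1%:E); congr fine; exact: probability_setT.
Qed.

Lemma Rintegral_sum d (T : measurableType d) (mu : {measure set T -> \bar R})
    (I : Type) (s : seq I) (f : I -> T -> R) :
  (forall i, mu.-integrable setT (EFin \o f i)) ->
  \int[mu]_x (\sum_(i <- s) f i x) = \sum_(i <- s) \int[mu]_x f i x.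
Proof.
move=> intf.
have ints : forall s, mu.-integrable setT (EFin \o (fun x => \sum_(i <- s) f i x)).
  move=> s'; rewrite (_ : _ \o _ = fun x => (\sum_(i <- s') (f i x)%:E)%E).
    by apply: integrable_sum => // i _; exact: intf.
  by apply/funext => x /=; rewrite sumEFin.
elim: s => [|i s IHs].
  by under eq_Rintegral do rewrite big_nil; rewrite big_nil /Rintegral integral0.
under eq_Rintegral do rewrite big_cons.
by rewrite big_cons RintegralD// IHs.
Qed.

Lemma integral_trig kb : \int[haar R]_x trig kb x = (kb == (0, true))%:R.
Proof.
case: kb => k b; have [->|k0] := eqVneq k 0.
  case: b; rewrite /trig /=.
    under eq_Rintegral do rewrite /dot /= !mul0r addr0 cos0.
    by rewrite Rintegral_cst1.
  under eq_Rintegral do rewrite /dot /= !mul0r addr0 sin0.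
  by rewrite Rintegral_cst1.
rewrite xpair_eqE (negbTE k0) /=.
have n0 := sqnorm_gt0 k0.
(* Translation by [a] adds pi to the phase k.x and flips the sign of the integrand, while the Haar
   integral does not change. *)
pose a := (pi / sqnorm R k) *: intpt R k.
have trigNa x : trig (k, b) (x + a) = - trig (k, b) x.
  rewrite /trig /= dotDr.
  have -> : dot (intpt R k) a = pi.
    by rewrite dotZr -/(sqnorm R k) divfK// gt_eqF.
  by rewrite cosDpi sinDpi; case: ifP.
have mt : measurable_fun [set: T2] (fun x => (trig (k, b) x)%:E).
  by apply/measurable_EFinP; exact: measurable_trig.
have pt : torus_periodic (fun x => (trig (k, b) x)%:E).
  by move=> x m; rewrite torus_periodic_trig.
have := integral_haar_affine (s := 1) a erefl mt pt.
under eq_integral do rewrite scale1r trigNa -mulN1r.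
move=> /(congr1 fine); rewrite -!/(Rintegral _ _ _).
rewrite RintegralZl//; last exact: (integrable_bounded_measurable _ (bounded_trig _)).
by lra.
Qed.

End trigonometric_sums.

Section parseval.
Variable R : realType.
Local Notation T2 := (measurableTypeR R * measurableTypeR R)%type.
Implicit Types (a : int * int -> R) (H : seq (int * int)).

(** The real part ([true]) and the imaginary part ([false]) of the sum over [H] of a k exp (i
    k.x). *)
Definition trig_sum H a b (x : R * R) : R := \sum_(k <- H) a k * trig (k, b) x.

Lemma bounded_trig_sum H a b : bounded_measurable (trig_sum H a b : T2 -> R).
Proof.
elim: H => [|k H IHH].
  rewrite (_ : trig_sum _ _ _ = cst 0); first exact: bounded_measurable_cst.
  by apply/funext => x; rewrite /trig_sum big_nil.
rewrite (_ : trig_sum _ _ _ = fun x => a k * trig (k, b) x + 1 * trig_sum H a b x).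
  by apply: bounded_measurable_lin => //; exact: bounded_trig.
by apply/funext => x; rewrite /trig_sum big_cons mul1r.
Qed.

Lemma integrable_haar_bounded (g : R * R -> R) : bounded_measurable (g : T2 -> R) ->
  (haar R).-integrable setT (EFin \o g).
Proof. exact: integrable_bounded_measurable. Qed.

Lemma RintegralZ_bounded (c : R) (g : R * R -> R) : bounded_measurable (g : T2 -> R) ->
  \int[haar R]_x (c * g x) = c * \int[haar R]_x g x.
Proof. by move=> bg; rewrite RintegralZl//; exact: integrable_haar_bounded. Qed.

Lemma Rintegral_lin_bounded (c c' : R) (g g' : R * R -> R) :
  bounded_measurable (g : T2 -> R) -> bounded_measurable (g' : T2 -> R) ->
  \int[haar R]_x (c * g x + c' * g' x) =
  c * \int[haar R]_x g x + c' * \int[haar R]_x g' x.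
Proof.
move=> bg bg'; have ig := integrable_haar_bounded bg; have ig' := integrable_haar_bounded bg'.
rewrite RintegralD//; [|exact: (integrableZl _ c ig)|exact: (integrableZl _ c' ig')].
by rewrite !RintegralZ_bounded.
Qed.

(** Frequencies k and - k have the same cosine and opposite sines, hence the second delta with sign
    + for cosines and - for sines. *)
Lemma integral_trigM k l b b' : \int[haar R]_x (trig (k, b) x * trig (l, b') x) =
  if b == b' then 2^-1 * ((k == l)%:R + (-1) ^+ (~~ b) * (k == - l)%:R) else 0.
Proof.
have pE (m : int * int) c : ((m, c) == (0, true)) = (m == 0) && c.
  by rewrite xpair_eqE eqb_id.
have dK : (k - l == 0) = (k == l) by rewrite subr_eq0.
have dN : (k + l == 0) = (k == - l) by rewrite addr_eq0.
case: b b' => [] [] /=.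
- transitivity (\int[haar R]_x (2^-1 * trig (k - l, true) x + 2^-1 * trig (k + l, true) x)).
    apply: eq_Rintegral => x _.
    by rewrite /trig /= !dot_intptD dot_intptN cosB cosD; field.
  rewrite Rintegral_lin_bounded ?integral_trig; try exact: bounded_trig.
  by rewrite !pE dK dN !andbT expr0; ring.
- transitivity (\int[haar R]_x (2^-1 * trig (k + l, false) x + (- 2^-1) * trig (k - l, false) x)).
    apply: eq_Rintegral => x _.
    by rewrite /trig /= !dot_intptD dot_intptN sinB sinD; field.
  rewrite Rintegral_lin_bounded ?integral_trig; try exact: bounded_trig.
  by rewrite !pE !andbF !mulr0 addr0.
- transitivity (\int[haar R]_x (2^-1 * trig (k + l, false) x + 2^-1 * trig (k - l, false) x)).
    apply: eq_Rintegral => x _.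
    by rewrite /trig /= !dot_intptD dot_intptN sinB sinD; field.
  rewrite Rintegral_lin_bounded ?integral_trig; try exact: bounded_trig.
  by rewrite !pE !andbF !mulr0 addr0.
- transitivity (\int[haar R]_x (2^-1 * trig (k - l, true) x + (- 2^-1) * trig (k + l, true) x)).
    apply: eq_Rintegral => x _.
    by rewrite /trig /= !dot_intptD dot_intptN cosB cosD; field.
  rewrite Rintegral_lin_bounded ?integral_trig; try exact: bounded_trig.
  by rewrite !pE dK dN !andbT expr1; ring.
Qed.

Lemma sum_delta H a l : uniq H ->
  \sum_(k <- H) a k * (k == l)%:R = (l \in H)%:R * a l.
Proof.
move=> uH; have [lH|lH] := boolP (l \in H).
  rewrite (bigD1_seq l)//= eqxx mulr1 mul1r big1 ?addr0// => k /negbTE ->.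
  by rewrite mulr0.
rewrite mul0r big_seq big1// => k kH; rewrite (_ : (k == l) = false) ?mulr0//.
by apply: contraNF lH => /eqP <-.
Qed.

Lemma integral_trig_sum H a l b b' : uniq H ->
  \int[haar R]_x (trig_sum H a b x * trig (l, b') x) =
  if b == b' then 2^-1 * ((l \in H)%:R * a l + (-1) ^+ (~~ b) * ((- l \in H)%:R * a (- l)))
  else 0.
Proof.
move=> uH.
have btt k : bounded_measurable ((fun x => trig (k, b) x * trig (l, b') x) : T2 -> R).
  by apply: bounded_measurableM; exact: bounded_trig.
transitivity (\int[haar R]_x \sum_(k <- H) (a k * (trig (k, b) x * trig (l, b') x))).
  apply: eq_Rintegral => x _; rewrite /trig_sum mulr_suml.
  by apply: eq_bigr => k _; rewrite mulrA.
rewrite Rintegral_sum; last first.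
  by move=> k; exact: (integrableZl _ (a k) (integrable_haar_bounded (btt k))).
under eq_bigr do rewrite RintegralZ_bounded// integral_trigM.
case: ifP => _; last by rewrite big1// => k _; rewrite mulr0.
rewrite -!sum_delta// [in RHS]mulr_sumr -big_split/= mulr_sumr.
by apply: eq_bigr => k _; ring.
Qed.

(** The integrand is the squared modulus of the exponential sum. Since cos k cos l + sin k sin l is
    the cosine at frequency k - l, only the diagonal survives, for arbitrary, not necessarily even,
    real coefficients. *)
Lemma parseval_trig_sum H a : uniq H ->
  \int[haar R]_x (trig_sum H a true x ^+ 2 + trig_sum H a false x ^+ 2) =
  \sum_(k <- H) a k ^+ 2.
Proof.
move=> uH.
have bt k l : bounded_measurable ((fun x => trig (k - l, true) x) : T2 -> R).
  exact: bounded_trig.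
transitivity (\int[haar R]_x
    \sum_(k <- H) \sum_(l <- H) (a k * a l * trig (k - l, true) x)).
  apply: eq_Rintegral => x _; rewrite /trig_sum !expr2 !mulr_suml -big_split /=.
  apply: eq_bigr => k _; rewrite !mulr_sumr -big_split /=.
  apply: eq_bigr => l _; rewrite /trig /= dot_intptD dot_intptN cosB; ring.
have ikl k l : (haar R).-integrable setT (EFin \o (fun x => a k * a l * trig (k - l, true) x)).
  exact: (integrableZl _ (a k * a l) (integrable_haar_bounded (bt k l))).
rewrite Rintegral_sum => [|k]; last first.
  rewrite (_ : _ \o _ = fun x => (\sum_(l <- H) (a k * a l * trig (k - l, true) x)%:E)%E).
    by apply: integrable_sum => // l _; exact: ikl.
  by apply/funext => x /=; rewrite sumEFin.
rewrite big_seq [RHS]big_seq; apply: eq_bigr => k kH.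
rewrite Rintegral_sum//.
under eq_bigr do rewrite RintegralZ_bounded// integral_trig xpair_eqE andbT subr_eq0 eq_sym -mulrA.
by rewrite -mulr_sumr sum_delta// kH mul1r expr2.
Qed.

Lemma trig_sum_restrict (F H : seq (int * int)) a b x : uniq F -> uniq H ->
  {subset F <= H} -> trig_sum F a b x = trig_sum H (fun k => a k * (k \in F)%:R) b x.
Proof.
move=> uF uH FH; rewrite /trig_sum.
rewrite [RHS](bigID (mem F))/= [X in _ + X]big1 ?addr0; last first.
  by move=> k /negbTE ->; rewrite mulr0 mul0r.
rewrite -[RHS]big_filter.
rewrite [RHS](_ : _ = \sum_(k <- [seq k <- H | k \in F]) a k * trig (k, b) x); last first.
  by rewrite !big_filter; apply: eq_bigr => k ->; rewrite mulr1.
apply: perm_big; apply: uniq_perm => //; first exact: filter_uniq.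
by move=> k; rewrite mem_filter; case: (boolP (k \in F)) => //= /FH ->.
Qed.

End parseval.

(** * Summability over the lattice *)

Section lattice_sums.
Variable R : realType.
Local Open Scope ereal_scope.

(** A factorizable majorant: for nonzero k, |k|^-4 is at most the product of the weights of the two
    coordinates ([sqnorm_ge]). The truncation at 1 keeps the weight finite at 0. *)
Definition int_weight (n : int) : R := ((maxn 1 `|n|)%:R ^- 2)%R.

Lemma int_weight_ge0 n : (0 <= int_weight n)%R.
Proof. by rewrite invr_ge0 exprn_ge0. Qed.

Lemma sum_nat_weight_lty : \sum_(n <oo) ((maxn 1 n)%:R ^- 2 : R)%:E < +oo.
Proof.
apply: (@le_lt_trans _ _ 6%:E); last exact: ltry.
apply: lime_le.
  by apply: is_cvg_nneseries => n _ _; rewrite lee_fin invr_ge0 exprn_ge0.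
apply: nearW => N; rewrite sumEFin lee_fin.
(* The bound telescopes with increments 6 / ((N + 1) (N + 2)); they dominate the terms for every N,
   with equality at N = 1, whence the 6. *)
apply: (@le_trans _ _ (6 - 6 * N.+1%:R^-1 : R)%R); last by rewrite gerBl mulr_ge0.
elim: N => [|N IHN]; first by rewrite big_geq// invr1 mulr1 subrr.
rewrite big_nat_recr//=; apply: (le_trans (lerD IHN (lexx _))).
pose x : R := N%:R; pose m : R := (maxn 1 N)%:R.
have x0 : (0 <= x)%R by [].
have m1 : (1 <= m)%R by rewrite /m (ler_nat _ 1) leq_maxl.
have xm : (x <= m)%R by rewrite /x /m ler_nat leq_maxr.
suff : (m ^- 2 <= 6 / ((x + 1) * (x + 2)))%R.
  have -> : (6 / ((x + 1) * (x + 2)) = 6 * (x + 1)^-1 - 6 * (x + 2)^-1)%R.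
    by field; rewrite !gt_eqF//; lra.
  have -> : N.+2%:R = (x + 2)%R by rewrite -addn2 natrD.
  have -> : N.+1%:R = (x + 1)%R by rewrite -natr1.
  rewrite -/m; lra.
rewrite ler_pdivlMr ?mulr_gt0//; try lra.
by rewrite mulrC ler_pdivrMr ?exprn_gt0//; nra.
Qed.

Lemma sum_int_weight_lty : \esum_(n in [set: int]) (int_weight n)%:E < +oo.
Proof.
have w0 n : 0 <= (int_weight n)%:E by rewrite lee_fin int_weight_ge0.
rewrite (esumID (range Posz))//= setTI setIC setIT.
rewrite (_ : ~` range Posz = range Negz); last first.
  apply/seteqP; split => [[n|n]|_ [n _ <-]]/=.
  - by move=> h; exfalso; apply: h; exists n.
  - by move=> _; exists n.
  - by case.
rewrite !esum_image; try by move=> m n _ _ [].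
rewrite -!nneseries_esumT//; apply: lte_add_pinfty; first exact: sum_nat_weight_lty.
apply: (le_lt_trans _ sum_nat_weight_lty).
apply: lee_nneseries => // n _; rewrite lee_fin /int_weight /=.
rewrite lef_pV2 ?posrE ?exprn_gt0 ?ltr0n ?leq_max//.
by rewrite ler_pXn2r ?nnegrE// ler_nat geq_max leq_maxl/= leq_max leqnSn orbT.
Qed.

Lemma sum_lattice_weight_lty :
  \esum_(k in [set: int * int]) (int_weight k.1 * int_weight k.2)%:E < +oo.
Proof.
rewrite (_ : [set: int * int] = [set: int] `*`` (fun=> [set: int])); last first.
  by apply/seteqP; split.
rewrite -(esum_esum (a := fun m n => (int_weight m * int_weight n)%:E)); last first.
  by move=> m n _ _; rewrite lee_fin mulr_ge0// int_weight_ge0.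
under eq_esum => m _.
  under eq_esum do rewrite EFinM.
  rewrite ge0_esumZl ?int_weight_ge0//; last by move=> n; rewrite lee_fin int_weight_ge0.
  rewrite muleC -(fineK (x := \esum_(n in [set: int]) (int_weight n)%:E)); last first.
    rewrite ge0_fin_numE ?sum_int_weight_lty//.
    by apply: esum_ge0 => n _; rewrite lee_fin int_weight_ge0.
  over.
rewrite ge0_esumZl.
- apply: lte_mul_pinfty => //; last exact: sum_int_weight_lty.
  by rewrite lee_fin fine_ge0// esum_ge0// => n _; rewrite lee_fin int_weight_ge0.
- by move=> m; rewrite lee_fin int_weight_ge0.
- by rewrite fine_ge0// esum_ge0// => n _; rewrite lee_fin int_weight_ge0.
Qed.

Lemma sqnorm_ge (k : int * int) : (k != 0)%R ->
  ((maxn 1 `|k.1|)%:R * (maxn 1 `|k.2|)%:R <= sqnorm R k)%R.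
Proof.
case: k => k1 k2; rewrite /sqnorm /dot /= => k0.
have sqE (n : int) : (n%:~R * n%:~R = (`|n| * `|n|)%N%:R :> R)%R.
  rewrite -intrM [RHS]pmulrn PoszM !abszE -normrM ger0_norm//.
  by rewrite -expr2 sqr_ge0.
rewrite !sqE -natrM -natrD ler_nat.
have : (0 < `|k1| + `|k2|)%N.
  by rewrite addn_gt0 !absz_gt0 -negb_and -xpair_eqE.
move: `|k1|%N `|k2|%N => p q pq.
case: p q pq => [|p] [|q] //= _; rewrite ?maxn0 ?(maxn_idPr _)// ?mul1n ?muln1 ?muln0;
  rewrite ?addn0 ?add0n ?leq_pmull//.
by case/orP: (leq_total p.+1 q.+1) => h; [rewrite (leq_trans (leq_mul h (leqnn _)))// leq_addl
  |rewrite (leq_trans (leq_mul (leqnn _) h))// leq_addr].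
Qed.

End lattice_sums.

Section summable_tails.
Context (R : realType) (I : choiceType) (b : I -> R).
Hypothesis b0 : forall i, 0 <= b i.

Lemma sum_fset_le_esum (H : {fset I}) :
  ((\sum_(i <- H) b i)%:E <= \esum_(i in [set: I]) (b i)%:E)%E.
Proof.
rewrite -sumEFin; apply: esum_ge; exists [set` H]; first by split.
by rewrite fsbig_finite//= set_fsetK.
Qed.

(** [X] comes within e of the supremum of the finite sums, so a finite set disjoint from [X] can add
    at most e. *)
Lemma summable_tail (e : R) : 0 < e -> (\esum_(i in [set: I]) (b i)%:E < +oo)%E ->
  exists X : {fset I}, forall G : {fset I}, (forall i, i \in G -> i \notin X) ->
    \sum_(i <- G) b i <= e.
Proof.
move=> e0 sb.
have sfin : (\esum_(i in [set: I]) (b i)%:E)%E \is a fin_num.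
  by rewrite ge0_fin_numE// esum_ge0// => i _; rewrite lee_fin.
have [_ [A [finA _] <-]] := ub_ereal_sup_adherent e0 sfin.
rewrite fsbig_finite//= sumEFin => hA; exists (fset_set A) => G GA.
have := sum_fset_le_esum (G `|` fset_set A)%fset.
rewrite (perm_big (enum_fset G ++ enum_fset (fset_set A))) /=; last first.
  apply: uniq_perm => [//||k]; last by rewrite mem_cat inE.
  rewrite cat_uniq !fset_uniq /= andbT; apply/hasPn => k kA; apply/negP => kG.
  by have := GA _ kG; rewrite kA.
rewrite big_cat EFinD /= => hG.
rewrite -lee_fin -(leeD2rE (x := (\sum_(i <- fset_set A) b i)%:E))//.
by apply: (le_trans hG); rewrite addeC -leeBlDr// ltW.
Qed.

End summable_tails.

(** A substitute for Cauchy-Schwarz on a probability space: with t = 2^n, a bound 4^-n on the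
    integral of q yields the bound 2^-n on that of |D|. *)
Lemma ler_amgm (R : realFieldType) (t D q : R) : 0 < t -> D ^+ 2 <= q ->
  `|D| <= 2^-1 * t * q + 2^-1 * t^-1.
Proof.
move=> t0 Dq; have y2 : `|D| ^+ 2 = D ^+ 2 by rewrite real_normK ?num_real.
apply: (@le_trans _ _ (2^-1 * t * `|D| ^+ 2 + 2^-1 * t^-1)).
  rewrite -subr_ge0 (_ : _ - _ = 2^-1 * t^-1 * (t * `|D| - 1) ^+ 2).
    by rewrite mulr_ge0 ?sqr_ge0// mulr_ge0// invr_ge0 ltW.
  by field; rewrite gt_eqF.
by rewrite y2 lerD2r ler_wpM2l// mulr_ge0// ltW.
Qed.

(** * A function with real, even, square summable coefficients is the sum of its series *)

Section fourier_series.
Variable R : realType.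
Local Notation T2 := (measurableTypeR R * measurableTypeR R)%type.
Context (f : R * R -> R) (c : int * int -> R) (C : R).
Hypotheses (intf : (haar R).-integrable [set: T2] (EFin \o f))
  (cC : forall k, k != 0 -> `|c k| <= C / sqnorm R k)
  (cN : forall k, c (- k) = c k)
  (fcos : forall k, \int[haar R]_x (f x * trig (k, true) x) = (k != 0)%:R * c k)
  (fsin : forall k, \int[haar R]_x (f x * trig (k, false) x) = 0).

Let a k := (k != 0)%:R * c k.

Let aN k : a (- k) = a k.
Proof. by rewrite /a cN oppr_eq0. Qed.

Let a2_summable : (\esum_(k in [set: int * int]) (a k ^+ 2)%:E < +oo)%E.
Proof.
apply: (@le_lt_trans _ _ (\esum_(k in [set: int * int])
    ((C ^+ 2)%:E * (int_weight R k.1 * int_weight R k.2)%:E))%E).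
  apply: le_esum => k _; rewrite -EFinM lee_fin /a.
  have [->|k0] := eqVneq k 0.
    rewrite mul0r expr0n mulr_ge0 ?sqr_ge0// mulr_ge0 ?int_weight_ge0//.
  rewrite mul1r /int_weight -invfM -exprMn -expr_div_n -[leLHS]real_normK ?num_real//.
  have h := sqnorm_ge R k0; have n0 := sqnorm_gt0 R k0.
  have m0 : 0 < (maxn 1 `|k.1|)%:R * (maxn 1 `|k.2|)%:R :> R.
    by rewrite mulr_gt0// ltr0n leq_max.
  have C0 : 0 <= C.
    have := le_trans (normr_ge0 _) (cC k0).
    by rewrite pmulr_lge0// invr_gt0.
  rewrite ler_pXn2r ?nnegrE ?divr_ge0 ?(ltW m0)//.
  apply: (le_trans (cC k0)); rewrite ler_wpM2l//.
  by rewrite lef_pV2.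
rewrite ge0_esumZl ?sqr_ge0//; last first.
  by move=> k; rewrite lee_fin mulr_ge0// int_weight_ge0.
by apply: lte_mul_pinfty; rewrite ?lee_fin ?sqr_ge0//; exact: sum_lattice_weight_lty.
Qed.

(* Partial sums over the sets [F n], which miss at most [4 ^- n] of the sum of
   squares, are summably close in L^1, hence converge almost everywhere. *)
Let X_exists n : {X : {fset int * int} | forall G : {fset int * int},
  (forall k, k \in G -> k \notin X) -> \sum_(k <- G) a k ^+ 2 <= 4 ^- n}.
Proof.
apply: cid; apply: summable_tail a2_summable; first by move=> k; exact: sqr_ge0.
by rewrite invr_gt0 exprn_gt0.
Qed.

Let F := fix F n : {fset int * int} :=
  if n is m.+1 then (F m `|` sval (X_exists n))%fset else sval (X_exists 0).

Let XF n k : k \in sval (X_exists n) -> k \in F n.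
Proof. by case: n => [|n] //= h; rewrite inE h orbT. Qed.

Let F_mono m n k : (m <= n)%N -> k \in F m -> k \in F n.
Proof.
move=> /subnKC <-; elim: (n - m)%N => [|i IHi]; first by rewrite addn0.
by rewrite addnS /= => /IHi h; rewrite inE h.
Qed.

Let tail n (G : {fset int * int}) (b : int * int -> R) :
  (forall k, `|b k| <= `|a k|) -> (forall k, k \in F n -> b k = 0) ->
  \sum_(k <- G) b k ^+ 2 <= 4 ^- n.
Proof.
move=> ba bF; apply: le_trans ((svalP (X_exists n)) (G `\` F n)%fset _); last first.
  by move=> k; rewrite inE => /andP[+ _]; apply: contra; exact: XF.
rewrite (bigID (mem (F n)))/= big1 ?add0r; last by move=> k /bF ->; rewrite expr0n.
rewrite (_ : \sum_(_ <- (_ `\` _)%fset) _ = \sum_(k <- G | k \notin F n) a k ^+ 2).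
  apply: ler_sum => k _; rewrite -[leLHS]real_normK ?num_real// -[leRHS]real_normK ?num_real//.
  by rewrite ler_pXn2r ?nnegrE.
rewrite -[RHS]big_filter; apply: perm_big; apply: uniq_perm => //.
  by rewrite filter_uniq.
by move=> k; rewrite mem_filter inE.
Qed.

Let S n := trig_sum (F n) a.

Let bS n b : bounded_measurable (S n b : T2 -> R).
Proof. exact: bounded_trig_sum. Qed.

Let trig_sumB (G H : {fset int * int}) b x :
  trig_sum G a b x - trig_sum H a b x =
  trig_sum (G `|` H)%fset (fun k => a k * ((k \in G)%:R - (k \in H)%:R)) b x.
Proof.
rewrite (trig_sum_restrict a b x (fset_uniq G) (fset_uniq (G `|` H)%fset)); last first.
  by move=> k kG; rewrite inE kG.
rewrite (trig_sum_restrict a b x (fset_uniq H) (fset_uniq (G `|` H)%fset)); last first.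
  by move=> k kH; rewrite inE kH orbT.
rewrite /trig_sum -sumrB; apply: eq_bigr => k _; ring.
Qed.

(** The difference has coefficients [a k] times a difference of indicators, which is 0 on [F m];
    Parseval leaves a tail sum. *)
Let dist2 (G H : {fset int * int}) (m : nat) :
  (forall k, k \in F m -> (k \in G) && (k \in H)) ->
  \int[haar R]_x ((trig_sum G a true x - trig_sum H a true x) ^+ 2 +
    (trig_sum G a false x - trig_sum H a false x) ^+ 2) <= 4 ^- m.
Proof.
move=> FGH; under eq_Rintegral do rewrite !trig_sumB.
rewrite parseval_trig_sum ?fset_uniq//; apply: tail => [k|k /FGH /andP[-> ->]].
  rewrite normrM ler_piMr//.
  by case: (k \in G); case: (k \in H); rewrite ?subrr ?subr0 ?sub0r ?normrN ?normr1 ?normr0.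
by rewrite subrr mulr0.
Qed.

Let S_rapid b : (\sum_(n <oo) \int[haar R]_x `|(S n.+1 b x - S n b x)%:E| < +oo)%E.
Proof.
apply: (@le_lt_trans _ _ (\sum_(n <oo) (2 / (2 ^ n.+1)%:R)%:E)%E); last first.
  by apply: le_lt_trans (epsilon_trick0 _ _) _ => //; exact: ltry.
apply: lee_nneseries => [n _ _|n _]; first exact: integral_ge0.
have bD b' : bounded_measurable ((fun x => S n.+1 b' x - S n b' x) : T2 -> R).
  rewrite (_ : (fun _ => _) = fun x => 1 * S n.+1 b' x + (-1) * S n b' x).
    by apply: bounded_measurable_lin; exact: bS.
  by apply/funext => x; rewrite mul1r mulN1r.
have := @dist2 (F n.+1) (F n) n.
have FF k : k \in F n -> (k \in F n.+1) && (k \in F n).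
  by move=> kF; rewrite kF andbT; apply: F_mono kF.
move=> /(_ FF) d2.
pose q x := (S n.+1 true x - S n true x) ^+ 2 + (S n.+1 false x - S n false x) ^+ 2.
have bq : bounded_measurable (q : T2 -> R).
  rewrite (_ : q = fun x => 1 * ((S n.+1 true x - S n true x) * (S n.+1 true x - S n true x)) +
     1 * ((S n.+1 false x - S n false x) * (S n.+1 false x - S n false x))).
    by apply: bounded_measurable_lin; exact: bounded_measurableM.
  by apply/funext => x; rewrite /q !expr2 !mul1r.
(* The right-hand side of [ler_amgm] at t = 2^n; its integral is at most 2^-n. *)
pose r x := 2^-1 * 2 ^+ n * q x + 2^-1 * 2 ^- n * cst 1 x.
have br : bounded_measurable (r : T2 -> R).
  by apply: bounded_measurable_lin => //; exact: bounded_measurable_cst.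
apply: (@le_trans _ _ (\int[haar R]_x (r x)%:E)%E).
  apply: ge0_le_integral => //.
  - by apply: measurableT_comp => //; apply/measurable_EFinP; have [] := bD b.
  - by apply/measurable_EFinP; have [] := br.
  - move=> x _; rewrite /= lee_fin /r /cst mulr1 ler_amgm ?exprn_gt0//.
    by rewrite /q; case: b => /=; rewrite ?lerDl ?lerDr sqr_ge0.
rewrite -[X in (X <= _)%E]fineK; last first.
  by apply: integrable_fin_num => //; exact: integrable_haar_bounded.
have Er : fine (\int[haar R]_x (r x)%:E)%E =
    2^-1 * 2 ^+ n * \int[haar R]_x q x + 2^-1 * 2 ^- n * \int[haar R]_x (cst 1 x).
  by apply: Rintegral_lin_bounded => //; exact: bounded_measurable_cst.
rewrite lee_fin Er Rintegral_cst1 mulr1.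
have -> : 2 / (2 ^ n.+1)%:R = 2^-1 * 2 ^- n + 2^-1 * 2 ^- n :> R.
  by rewrite natrX exprS; field; rewrite expf_neq0.
rewrite lerD2r -mulrA ler_wpM2l// -ler_pdivlMl ?exprn_gt0//.
by apply: (le_trans d2); rewrite -invfM -exprMn -natrM.
Qed.

(** The sets [F n] need not exhaust the lattice. A frequency missed by all of them is a tail for
    every n, which forces its coefficient to be 0. *)
Let aF_cvg l : (l \in F n)%:R * a l @[n --> \oo] --> a l.
Proof.
have [[m lm]|lF] := pselect (exists m, l \in F m).
  apply: cvg_near_cst; exists m => // n /= mn.
  by rewrite (F_mono mn lm) mul1r.
have -> : a l = 0.
  apply/eqP; rewrite -sqrf_eq0 eq_le sqr_ge0 andbT.
  have h n : a l ^+ 2 <= 4 ^- n.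
    have := @tail n [fset l]%fset (fun k => if k == l then a l else 0).
    rewrite big_seq_fset1 eqxx; apply.
    - by move=> k; case: eqP => [->|]; rewrite ?normr0.
    - by move=> k kF; case: eqP => // kl; exfalso; apply: lF; exists n; rewrite -kl.
  have h0 : (4 ^- n : R) @[n --> \oo] --> (0 : R).
    under eq_fun do rewrite -exprVn; apply: cvg_expr.
    by rewrite ger0_norm// invf_lt1// ltr1n.
  apply: (@ler_cvg_to _ _ _ _ (cst (a l ^+ 2)) _ _ _ _ h0); first exact: cvg_cst.
  exact: nearW.
by under eq_fun do rewrite mulr0; exact: cvg_cst.
Qed.

(** [F n] need not be symmetric, so the sine part of a partial sum may be nonzero; the evenness of
    [a] cancels its coefficients in the limit only. *)
Let S_coef b kb : \int[haar R]_x (S n b x * trig kb x) @[n --> \oo] -->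
  if b then \int[haar R]_x (f x * trig kb x) else 0.
Proof.
case: kb => l b'; rewrite /S.
under eq_fun do rewrite integral_trig_sum ?fset_uniq//.
have al := @aF_cvg l; have aNl := @aF_cvg (- l); rewrite aN in aNl.
have lim e : 2^-1 * ((l \in F n)%:R * a l + e * ((- l \in F n)%:R * a (- l)))
    @[n --> \oo] --> 2^-1 * (a l + e * a l).
  by rewrite aN; apply: cvgMl_tmp; apply: cvgD => //; apply: cvgMl_tmp.
case: b b' => [] [] /=; [|by rewrite fsin; exact: cvg_cst|exact: cvg_cst|].
- rewrite fcos -/(a l); have := lim ((-1) ^+ 0).
  by rewrite [X in _ --> X -> _](_ : _ = a l)// expr0; field.
- have := lim ((-1) ^+ 1).
  by rewrite [X in _ --> X -> _](_ : _ = 0)// expr1; ring.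
Qed.

Let S_cvg b : {ae haar R, forall x : T2, S n b x @[n --> \oo] --> (if b then f x else 0)}.
Proof.
have [g [ig gae gcvg]] := rapid_cvg (fun n => integrable_haar_bounded (bS n b)) (@S_rapid b).
pose phi x := if b then f x else 0.
have iphi : (haar R).-integrable [set: T2] (EFin \o phi).
  by rewrite /phi; case: (b) => //; exact: integrable0.
have ih : (haar R).-integrable [set: T2] (EFin \o (fun x => phi x - g x)).
  by have := integrableB measurableT iphi ig.
have h0 kb : \int[haar R]_x ((phi x - g x) * trig kb x) = 0.
  have bt := bounded_trig R kb.
  transitivity (\int[haar R]_x (phi x * trig kb x - g x * trig kb x)).
    by apply: eq_Rintegral => x _; rewrite mulrBl.
  rewrite RintegralB//; try exact: integrable_bounded_mul.
  have lim : \int[haar R]_x (g x * trig kb x) =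
      if b then \int[haar R]_x (f x * trig kb x) else 0.
    apply: (@cvg_unique _ (@Rhausdorff R) _ _ _ _ (gcvg _ bt)); exact: S_coef.
  rewrite lim /phi; case: (b); first by rewrite subrr.
  under eq_Rintegral do rewrite mul0r.
  by rewrite /Rintegral integral0 subr0.
have := fourier_unique ih h0.
by apply: filterS2 gae => x gx /subr0_eq; rewrite /phi => ->.
Qed.

Let trig_sum_complex (G : seq (int * int)) x :
  \sum_(k <- G | k != 0) (c k)%:C * expi (dot (intpt R k) x) =
  trig_sum G a true x +i* trig_sum G a false x.
Proof.
rewrite /trig_sum; elim: G => [|k G IHG]; first by rewrite !big_nil.
rewrite !big_cons IHG /a /trig /=; case: ifP => k0.
  by apply/eqP; rewrite eq_complex /= !mul1r !mul0r subr0 addr0 !eqxx.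
by rewrite !mul0r !add0r.
Qed.

Let normc_sub (G : seq (int * int)) x :
  Normc.normc ((f x)%:C - \sum_(k <- G | k != 0) (c k)%:C * expi (dot (intpt R k) x)) ^+ 2 =
  (f x - trig_sum G a true x) ^+ 2 + (0 - trig_sum G a false x) ^+ 2.
Proof. by rewrite trig_sum_complex /= sqr_sqrtr// addr_ge0 ?sqr_ge0. Qed.

Let mf : measurable_fun [set: T2] f.
Proof. by apply/measurable_EFinP; exact: (measurable_int _ intf). Qed.

(** Fatou transfers to [f] a bound on the distances to the partial sums. The shift by m restricts to
    those containing [F m]. *)
Let fatou_dist (G : {fset int * int}) m B :
  (forall n, \int[haar R]_x ((S (n + m)%N true x - trig_sum G a true x) ^+ 2 +
    (S (n + m)%N false x - trig_sum G a false x) ^+ 2) <= B) ->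
  (\int[haar R]_x ((f x - trig_sum G a true x) ^+ 2 +
    (0 - trig_sum G a false x) ^+ 2)%:E <= B%:E)%E.
Proof.
move=> hB; pose q n x := (S (n + m)%N true x - trig_sum G a true x) ^+ 2 +
    (S (n + m)%N false x - trig_sum G a false x) ^+ 2.
have bG b := bounded_trig_sum G a b.
have bq n : bounded_measurable (q n : T2 -> R).
  pose D b x := 1 * S (n + m)%N b x + (-1) * trig_sum G a b x.
  have bD b : bounded_measurable (D b : T2 -> R).
    by apply: bounded_measurable_lin => //; exact: bS.
  rewrite (_ : q n = fun x => 1 * (D true x * D true x) + 1 * (D false x * D false x)).
    by apply: bounded_measurable_lin; exact: bounded_measurableM.
  by apply/funext => x; rewrite /q /D; ring.
have mq n : measurable_fun [set: T2] (q n) by have [] := bq n.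
apply: (@fatou_bound _ _ _ (haar R) q) => //.
- by move=> n x; rewrite addr_ge0 ?sqr_ge0.
- have [mG1 _] := bG true; have [mG0 _] := bG false.
  apply: measurable_funD; apply: measurable_funX; apply: measurable_funB => //.
- apply: filterS2 (S_cvg true) (S_cvg false) => x h1 h0.
  have sh b l : S n b x @[n --> \oo] --> l -> S (n + m)%N b x @[n --> \oo] --> l.
    by move=> h; rewrite (cvg_shiftn m (fun n => S n b x)).
  have sq b l : S n b x @[n --> \oo] --> l -> (S (n + m)%N b x - trig_sum G a b x) ^+ 2
      @[n --> \oo] --> (l - trig_sum G a b x) ^+ 2.
    move=> /sh h.
    have hD : S (n + m)%N b x - trig_sum G a b x @[n --> \oo] --> l - trig_sum G a b x.
      by apply: cvgB => //; exact: cvg_cst.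
    exact: (cvgM hD hD).
  by apply: cvgD; exact: sq.
- move=> n; rewrite -[leLHS]fineK ?lee_fin; first exact: hB.
  by apply: integrable_fin_num => //; exact: integrable_haar_bounded.
Qed.

Lemma L2_fourier_sumP : L2_fourier_sum f (fun k => (c k)%:C).
Proof.
split; first exact: mf.
(* With the empty sum in place of [G], the same bound shows that the integrable [f] is square
   integrable. *)
- pose s := fine (\esum_(k in [set: int * int]) (a k ^+ 2)%:E)%E.
  have := @fatou_dist fset0 0%N s.
  have t0 b x : trig_sum (fset0 : {fset int * int}) a b x = 0.
    by rewrite /trig_sum big_seq_fset0.
  under eq_integral do rewrite !t0 subr0 subrr expr0n addr0.
  move=> h; apply: (le_lt_trans (h _)); last exact: ltry.
  move=> n; under eq_Rintegral do rewrite !t0 !subr0.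
  rewrite parseval_trig_sum ?fset_uniq// -lee_fin fineK.
    by apply: (@sum_fset_le_esum R _ (fun k => a k ^+ 2)) => k; exact: sqr_ge0.
  by rewrite ge0_fin_numE// esum_ge0// => k _; rewrite lee_fin sqr_ge0.
pose V (G : {fset int * int}) := (\int[haar R]_x ((f x - trig_sum G a true x) ^+ 2 +
    (0 - trig_sum G a false x) ^+ 2)%:E)%E.
rewrite (_ : (fun _ => _) = V); last first.
  by apply/funext => G; apply: eq_integral => x _; rewrite normc_sub.
have V0 G : (0 <= V G)%E.
  by apply: integral_ge0 => x _; rewrite lee_fin addr_ge0 ?sqr_ge0.
(* The estimate covers every finite set containing [F m], which is what convergence along inclusion
   requires. *)
have VF G m : {subset F m <= G} -> (V G <= (4 ^- m)%:E)%E.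
  move=> FG; apply: (@fatou_dist G m) => n; apply: dist2 => k kF.
  by rewrite (FG _ kF) (F_mono _ kF)// leq_addl.
have FT := @summability.totally_filter (int * int)%type.
have nearF m : \forall G \near summability.totally, {subset F m <= G}.
  by exists (F m) => // G /fsubsetP.
have Vfin : \forall G \near summability.totally, V G \is a fin_num.
  apply: filterS (nearF 0%N) => G /VF h; rewrite ge0_fin_numE//.
  by apply: (le_lt_trans h); exact: ltry.
apply: cvg_EFin => //; apply/cvgrPdist_le => e e0.
have [m me] : exists m, 4 ^- m <= e :> R.
  have h0 : (4 ^- n : R) @[n --> \oo] --> (0 : R).
    under eq_fun do rewrite -exprVn; apply: cvg_expr.
    by rewrite ger0_norm// invf_lt1// ltr1n.
  have /cvgrPdist_le /(_ _ e0) [m _ /(_ m (leqnn m))] := h0.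
  rewrite /= sub0r normrN => h; exists m; apply: le_trans h; exact: ler_norm.
apply: filterS2 Vfin (nearF m) => G GV /VF h.
rewrite sub0r normrN ger0_norm ?fine_ge0//.
by rewrite -lee_fin fineK// (le_trans h).
Qed.

End fourier_series.

(** * Mollified kernels *)

Section parametric_integral.
Local Open Scope ereal_scope.
Context d1 d2 (T1 : measurableType d1) (T2 : measurableType d2) (R : realType)
  (m : {sigma_finite_measure set T2 -> \bar R}).

(** Tonelli is applied to the two parts of [f], since integrability can fail at individual
    parameters. *)
Lemma measurable_fun_integral (f : T1 * T2 -> \bar R) : measurable_fun setT f ->
  measurable_fun setT (fun x => \int[m]_y f (x, y)).
Proof.
move=> mf.
rewrite (_ : (fun _ => _) = fun x => \int[m]_y f^\+ (x, y) - \int[m]_y f^\- (x, y)).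
  apply: emeasurable_funB.
  - apply: (measurable_fun_fubini_tonelli_F f^\+) => //; exact: measurable_funepos.
  - apply: (measurable_fun_fubini_tonelli_F f^\-) => //; exact: measurable_funeneg.
apply/funext => x; rewrite integralE.
by congr (_ - _); apply: eq_integral => y _; rewrite ?funeposE ?funenegE.
Qed.

Lemma measurable_fun_Rintegral (f : T1 * T2 -> R) : measurable_fun setT f ->
  measurable_fun setT (fun x => (\int[m]_y f (x, y))%R).
Proof.
move=> mf; apply: measurableT_comp => //.
by apply: (measurable_fun_integral (f := EFin \o f)); exact/measurable_EFinP.
Qed.

End parametric_integral.

Section continuous_plane.
Variable R : realType.
Local Notation T2 := (measurableTypeR R * measurableTypeR R)%type.

(** Balls of the plane are squares here, so an open set is the union of the countably many rational
    squares that it contains. *)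
Lemma open_measurable_plane (U : set (R * R)) : open U -> measurable (U : set T2).
Proof.
move=> oU.
pose box (q : rat * rat * rat) : set (R * R) :=
  `](ratr q.1.1 - ratr q.2), (ratr q.1.1 + ratr q.2)[%classic `*`
  `](ratr q.1.2 - ratr q.2), (ratr q.1.2 + ratr q.2)[%classic.
rewrite (_ : U = \bigcup_(q in [set q | box q `<=` U]) box q).
  rewrite bigcup_mkcond; apply: countable_bigcupT_measurable => [|q]; first exact: countableP.
  by case: ifP => // _; exact: measurableX.
apply/seteqP; split => [[x y] Uxy|x [q /= qU qx]]; last exact: qU.
have /nbhs_ballP[e /= e0 eU] := open_nbhs_nbhs (conj oU Uxy).
have [r] := @rat_in_itvoo R 0 (e / 2) ltac:(by rewrite divr_gt0).
rewrite in_itv /= => /andP[r0 re].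
have near (t : R) : exists q : rat, t - ratr r < ratr q < t + ratr r.
  have [|q] := @rat_in_itvoo R (t - ratr r) (t + ratr r); last by rewrite in_itv; exists q.
  by lra.
have [p /andP[p1 p2]] := near x; have [q /andP[q1 q2]] := near y.
exists (p, q, r) => /=; last by split; rewrite /= in_itv /=; apply/andP; split; lra.
move=> [u v] [] /=; rewrite !in_itv /= => /andP[u1 u2] /andP[v1 v2].
by apply: eU; split; rewrite /ball /= ltr_norml; apply/andP; split; lra.
Qed.

Lemma continuous_measurable_plane (f : R * R -> R) : continuous f ->
  measurable_fun [set: T2] f.
Proof.
move=> cf; apply: (measurability (RGenOInfty.G (R := R))).
  exact: RGenOInfty.measurableE.
move=> _ [_ [a ->] <-]; rewrite setTI; apply: open_measurable_plane.
by apply: open_comp => // *; exact: cf.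
Qed.

Lemma continuous_periodic_bounded (f : R * R -> R) : continuous f ->
  torus_periodic f -> exists M, forall x, `|f x| <= M.
Proof.
move=> cf pf.
pose D : set (R * R) := `[0, 2 * pi]%classic `*` `[0, 2 * pi]%classic.
have cD : compact D by apply: compact_setX; exact: segment_compact.
have := compact_bounded (continuous_compact (continuous_subspaceT cf) cD).
move=> [M [_ hM]]; exists (M + 1) => x.
have [n1 h1] := @cell1_translate R 1 x.1 erefl.
have [n2 h2] := @cell1_translate R 1 x.2 erefl.
have cell_itv t n : cell1 (t + 2 * pi * 1%:~R * n%:~R) = (n == n)%:R :> R ->
    t + 2 * pi * n%:~R \in `[0, 2 * pi].
  rewrite mulr1 eqxx /cell1 in_itv /=; case: (boolP (_ <= _ < _)) => [/andP[-> /ltW ->]//|_].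
  by move=> /eqP; rewrite eq_sym oner_eq0.
rewrite -(pf x (n1, n2)); apply: (hM (M + 1)); first by rewrite ltrDl.
exists (x + (2 * pi) *: intpt R (n1, n2)) => //.
by split; [exact: cell_itv (h1 n1)|exact: cell_itv (h2 n2)].
Qed.
End continuous_plane.

Lemma measurable_fun_inv (R : realType) :
  measurable_fun [set: measurableTypeR R] (fun x : R => x^-1).
Proof.
have o0 : open (~` [set 0 : R]).
  rewrite (_ : ~` _ = [set x | x != 0]); first exact: open_neq.
  by apply/seteqP; split => x /= /eqP.
rewrite -(setvU [set 0 : R]); apply/measurable_funU => //.
  exact: measurableC.
split; last exact: measurable_fun_set1.
apply: open_continuous_measurable_fun => // x /set_mem /eqP x0.
exact: inv_continuous.
Qed.

Section mollifier.
Variable R : realType.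
Local Notation mu := (@lebesgue_measure R).
Local Notation leb2 := (mu \x mu)%E.
Local Notation T2 := (measurableTypeR R * measurableTypeR R)%type.
Variable theta : R * R -> R.
Hypothesis theta_mollifier : symmetric_mollifier theta.

Let theta0 z : 0 <= theta z. Proof. by case: theta_mollifier. Qed.

Let thetaN z : theta (- z) = theta z. Proof. by case: theta_mollifier. Qed.

Lemma measurable_theta : measurable_fun [set: T2] theta.
Proof.
case: theta_mollifier => /(_ 0%N)[ctheta _] _ _ _ _.
exact: continuous_measurable_plane.
Qed.

Let int_theta : (\int[leb2]_z (theta z)%:E = 1)%E.
Proof. by case: theta_mollifier. Qed.

Let profile (l : R) (x : R * R) := (l ^- 2 * theta (l^-1 *: x))%:E.

Let profile_ge0 l x : (0 <= profile l x)%E.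
Proof. by rewrite lee_fin mulr_ge0// invr_ge0 sqr_ge0. Qed.

Let measurable_profile (m : int * int) : measurable_fun [set: measurableTypeR R * T2]
  (fun p : measurableTypeR R * T2 => profile p.1 ((p.2 : R * R) + (2 * pi) *: intpt R m)).
Proof.
apply/measurable_EFinP; apply: measurable_funM.
  have m1 : measurable_fun [set: measurableTypeR R * T2]
      (fun p : measurableTypeR R * T2 => p.1 ^+ 2).
    by apply: measurable_funX; exact: measurable_fst.
  exact: (measurableT_comp (@measurable_fun_inv R) m1).
have minv : measurable_fun [set: measurableTypeR R * T2] (fun p : measurableTypeR R * T2 => p.1^-1).
  exact: (measurableT_comp (@measurable_fun_inv R) measurable_fst).
have m2 : measurable_fun [set: measurableTypeR R * T2]
    (fun p : measurableTypeR R * T2 => (p.2 : R * R) + (2 * pi) *: intpt R m : T2).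
  exact: (measurableT_comp (measurable_pair_translate _) measurable_snd).
have h : measurable_fun [set: measurableTypeR R * T2] (fun p : measurableTypeR R * T2 =>
    (p.1^-1 * (p.2 + (2 * pi) *: intpt R m).1, p.1^-1 * (p.2 + (2 * pi) *: intpt R m).2) : T2).
  apply: measurable_fun_pair.
  - by apply: measurable_funM => //; exact: (measurableT_comp measurable_fst m2).
  - by apply: measurable_funM => //; exact: (measurableT_comp measurable_snd m2).
exact: (measurableT_comp measurable_theta h).
Qed.

Let periodized (l : R) (x : R * R) :=
  (\esum_(m in [set: int * int]) profile l (x + (2 * pi) *: intpt R m)%R)%E.

Let periodized_ge0 l x : (0 <= periodized l x)%E.
Proof. by apply: esum_ge0 => m _. Qed.

Let measurable_periodized : measurable_fun [set: measurableTypeR R * T2]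
  (fun p : measurableTypeR R * T2 => periodized p.1 p.2).
Proof. exact: (measurable_fun_esum measurable_profile). Qed.

Lemma mollifier_ge0 l x : 0 <= mollifier theta l x.
Proof. exact: (mulr_ge0 (sqr_ge0 _) (fine_ge0 (periodized_ge0 l x))). Qed.

Lemma measurable_mollifier : measurable_fun [set: measurableTypeR R * T2]
  (fun p : measurableTypeR R * T2 => mollifier theta p.1 p.2).
Proof.
apply: measurable_funM => //.
exact: (measurableT_comp (@fine_measurable R _ measurableT) measurable_periodized).
Qed.

Let measurable_profile1 l : measurable_fun [set: T2] (profile l).
Proof.
rewrite (_ : profile l = (fun p : measurableTypeR R * T2 =>
    profile p.1 ((p.2 : R * R) + (2 * pi) *: intpt R 0)) \o pair l).
  exact: (measurableT_comp (measurable_profile _) (pair1_measurable _)).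
by apply/funext => x /=; rewrite (_ : intpt R 0 = 0)// scaler0 addr0.
Qed.

Let measurable_periodized1 l : measurable_fun [set: T2] (periodized l).
Proof. exact: (measurableT_comp measurable_periodized (pair1_measurable l)). Qed.

Lemma measurable_mollifier1 l : measurable_fun [set: T2] (mollifier theta l).
Proof. exact: (measurableT_comp measurable_mollifier (pair1_measurable l)). Qed.

Lemma torus_periodic_mollifier l : torus_periodic (mollifier theta l).
Proof.
move=> x n; congr (_ * fine _).
rewrite (reindex_esum [set: int * int] [set: int * int] (fun m => m - n)).
  apply: eq_esum => m _; congr (_ * theta (_ *: _))%:E.
  by rewrite -addrA -scalerDr; congr (_ + _ *: _); rewrite /intpt /=; congr pair;
    rewrite -intrD addrC subrK.
split => //=.
  by move=> m1 m2 _ _ /= /addIr.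
by move=> m _; exists (m + n) => //=; rewrite addrK.
Qed.

(** A periodic [g] passes inside the sum over translates, the sum unfolds to the plane, and the
    scaling by [l] absorbs l^-2. *)
Let ge0_integral_periodized l (g : R * R -> R) : l != 0 ->
  measurable_fun [set: T2] g -> (forall x, 0 <= g x) -> torus_periodic g ->
  (((2 * pi) ^+ 2)%:E * \int[haar R]_y (periodized l y * (g y)%:E) =
   \int[leb2]_z (theta z * g (l *: z))%:E)%E.
Proof.
move=> l0 mg g0 pg.
pose h x := (profile l x * (g x)%:E)%E.
have mg' : measurable_fun [set: T2] (fun x => (g x)%:E) by exact/measurable_EFinP.
have h0 x : (0 <= h x)%E by rewrite mule_ge0// lee_fin.
have mh : measurable_fun [set: T2] h by apply: emeasurable_funM.
transitivity (\int[leb2]_x h x)%E.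
  rewrite ge0_integral_unfold//; congr (_ * _)%E; apply: eq_integral => x _.
  rewrite muleC -ge0_esumZl//; apply: eq_esum => m _.
  by rewrite /h pg muleC.
have mgl : measurable_fun [set: T2] (fun x : T2 => g (l *: (x : R * R))).
  rewrite (_ : (fun _ => _) = fun x : T2 => g (l *: (x : R * R) + 0)).
    exact: (measurableT_comp mg (measurable_pair_affine l 0)).
  by apply/funext => x; rewrite addr0.
pose H z := (theta z * g (l *: z))%:E.
have mH : measurable_fun [set: T2] H.
  by apply/measurable_EFinP; apply: measurable_funM => //; exact: measurable_theta.
have H0 x : (0 <= H x)%E by rewrite lee_fin mulr_ge0.
have := ge0_integral_pair_affine 0 (invr_neq0 l0) mH H0.
rewrite exprVn invrK => E.
transitivity (\int[leb2]_x ((l ^- 2)%:E * H (l^-1 *: x + 0)%R))%E.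
  apply: eq_integral => x _; rewrite /h /profile /H addr0 scalerA divff// scale1r.
  by rewrite -!EFinM mulrA.
rewrite ge0_integralZl//; last 2 first.
- exact: (measurableT_comp mH (measurable_pair_affine _ _)).
- by rewrite lee_fin invr_ge0 sqr_ge0.
by rewrite E muleA -EFinM mulVf ?expf_neq0// mul1e.
Qed.

(** [mollifier] is a multiple of [fine] of this sum; finiteness almost everywhere makes [fine]
    harmless under integrals. *)
Let periodized_ae_fin l : l != 0 ->
  {ae haar R, forall x : T2, periodized l x \is a fin_num}.
Proof.
move=> l0; have p0 : 0 < (2 * pi) ^+ 2 :> R by rewrite exprn_gt0 ?two_pi_gt0.
have h := @ge0_integral_periodized l (cst 1) l0 (measurable_cst _) (fun=> ler01) (fun _ _ => erefl).
have ip : (haar R).-integrable [set: T2] (periodized l).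
  apply/integrableP; split => //.
  have -> : (\int[haar R]_x `|periodized l x| =
      \int[haar R]_x (periodized l x * (cst 1 x)%:E))%E.
    by apply: eq_integral => x _; rewrite mule1 gee0_abs.
  rewrite ltey; apply/eqP => Ioo; move: h; rewrite Ioo gt0_muley ?lte_fin//.
  by under eq_integral do rewrite mulr1; rewrite int_theta.
by apply: filterS (integrable_ae measurableT ip) => x; apply.
Qed.

Lemma ge0_integral_mollifier l (g : R * R -> R) : l != 0 ->
  measurable_fun [set: T2] g -> (forall x, 0 <= g x) -> torus_periodic g ->
  (\int[haar R]_y (mollifier theta l y * g y)%:E =
   \int[leb2]_z (theta z * g (l *: z))%:E)%E.
Proof.
move=> l0 mg g0 pg; rewrite -ge0_integral_periodized//.
have mg' : measurable_fun [set: T2] (fun x => (g x)%:E) by exact/measurable_EFinP.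
rewrite -ge0_integralZl//; last 3 first.
- exact: emeasurable_funM.
- by move=> x _; rewrite mule_ge0// lee_fin.
- by rewrite lee_fin sqr_ge0.
apply: ae_eq_integral => //.
- by apply/measurable_EFinP; apply: measurable_funM => //; exact: measurable_mollifier1.
- by apply: emeasurable_funM => //; exact: emeasurable_funM.
- apply: filterS (periodized_ae_fin l0) => x px _.
  by rewrite muleA EFinM; congr (_ * _)%E; rewrite /mollifier EFinM fineK.
Qed.

(** The inverse of 0 is 0 by convention. Thanks to it the L^1 bounds hold at every real scale,
    including those that L takes on a null set. *)
Lemma mollifier0 x : mollifier theta 0 x = 0.
Proof.
rewrite /mollifier esum1 ?mulr0// => m _.
by rewrite expr0n invr0 mul0r.
Qed.

Lemma integral_mollifier l : l != 0 -> (\int[haar R]_y (mollifier theta l y)%:E = 1)%E.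
Proof.
move=> l0; rewrite -int_theta.
have := @ge0_integral_mollifier l (cst 1) l0 (measurable_cst _) (fun=> ler01) (fun _ _ => erefl).
by under eq_integral do rewrite mulr1; under [in RHS]eq_integral do rewrite mulr1.
Qed.

Lemma integral_mollifier_le1 l : (\int[haar R]_y (mollifier theta l y)%:E <= 1)%E.
Proof.
have [->|l0] := eqVneq l 0; last by rewrite integral_mollifier.
by under eq_integral do rewrite mollifier0; rewrite integral0.
Qed.

Lemma integrable_mollifier l : (haar R).-integrable [set: T2] (EFin \o mollifier theta l).
Proof.
apply/integrableP; split.
  by apply/measurable_EFinP; exact: measurable_mollifier1.
under eq_integral do rewrite /= ger0_norm ?mollifier_ge0//.
by apply: le_lt_trans (integral_mollifier_le1 l) _; exact: ltry.
Qed.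

Let integrable_theta : leb2.-integrable [set: T2] (EFin \o theta).
Proof.
apply/integrableP; split; first by apply/measurable_EFinP; exact: measurable_theta.
by under eq_integral do rewrite /= ger0_norm//; rewrite int_theta ltry.
Qed.

Let Rintegral_theta : \int[leb2]_z theta z = 1.
Proof. by rewrite /Rintegral int_theta. Qed.

Let measurable_dot_real (xi : R * R) : measurable_fun [set: T2] (dot xi).
Proof. by apply: measurable_funD; apply: measurable_funM. Qed.

Let bounded_cos_dot (xi : R * R) : bounded_measurable ((fun z => cos (dot xi z)) : T2 -> R).
Proof.
split; last by exists 1 => x; rewrite ler_norml cos_geN1 cos_le1.
apply: (measurableT_comp _ (measurable_dot_real xi)).
by apply: continuous_measurable_fun; exact: continuous_cos.
Qed.

Let bounded_sin_dot (xi : R * R) : bounded_measurable ((fun z => sin (dot xi z)) : T2 -> R).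
Proof.
split; last by exists 1 => x; rewrite ler_norml sin_geN1 sin_le1.
apply: (measurableT_comp _ (measurable_dot_real xi)).
by apply: continuous_measurable_fun; exact: continuous_sin.
Qed.

(** The available changes of variables concern nonnegative functions: they are applied to 1 plus a
    sine or cosine, and this removes the 1. *)
Let Rintegral_theta_1D (g : R * R -> R) : bounded_measurable (g : T2 -> R) ->
  \int[leb2]_z (theta z * (1 + g z)) = 1 + \int[leb2]_z (theta z * g z).
Proof.
move=> bg; have itg := integrable_bounded_mul integrable_theta bg.
under eq_Rintegral do rewrite mulrDr mulr1.
by rewrite RintegralD// Rintegral_theta.
Qed.

(** The Fourier transform of theta, which is real because theta is even. *)
Definition theta_hat (xi : R * R) : R := \int[leb2]_z (theta z * cos (dot xi z)).

Lemma integral_theta_sin (xi : R * R) : \int[leb2]_z (theta z * sin (dot xi z)) = 0.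
Proof.
have bs := bounded_sin_dot xi; have [ms _] := bs.
have bs' : bounded_measurable ((fun z => - sin (dot xi z)) : T2 -> R).
  by split; [exact: measurable_funN|exists 1 => x; rewrite normrN ler_norml sin_geN1 sin_le1].
have := @ge0_integral_pair_affine R (-1) 0 (fun z => (theta z * (1 + sin (dot xi z)))%:E).
rewrite sqrrN expr1n invr1 mul1e => h.
have : \int[leb2]_z (theta z * (1 - sin (dot xi z))) =
       \int[leb2]_z (theta z * (1 + sin (dot xi z))).
  congr fine; rewrite -h.
  - by apply: eq_integral => z _; rewrite addr0 scaleN1r thetaN dotNr sinN.
  - by rewrite oppr_eq0 oner_eq0.
  - apply/measurable_EFinP; apply: measurable_funM; first exact: measurable_theta.
    by apply: measurable_funD.
  - by move=> z; rewrite lee_fin mulr_ge0// -lerBlDl sub0r sin_geN1.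
rewrite !Rintegral_theta_1D// => /addrI.
have is_ := integrable_bounded_mul integrable_theta bs.
rewrite (_ : \int[leb2]_z (theta z * - sin (dot xi z)) =
  - \int[leb2]_z (theta z * sin (dot xi z))); first lra.
rewrite -mulN1r -RintegralZl//.
by apply: eq_Rintegral => z _; ring.
Qed.

Lemma integral_mollifier_trig l k b : l != 0 ->
  \int[haar R]_y (mollifier theta l y * trig (k, b) y) =
  if b then theta_hat (l *: intpt R k) else 0.
Proof.
move=> l0; have bt := bounded_trig R (k, b).
have it := integrable_bounded_mul (integrable_mollifier l) bt.
have dE z : dot (intpt R k) (l *: z) = dot (l *: intpt R k) z.
  by rewrite dotZr [RHS]dotC dotZr dotC.
transitivity (\int[leb2]_z (theta z * trig (k, b) (l *: z))); last first.
  rewrite /trig /=; case: b {bt it}; last rewrite -[RHS](integral_theta_sin (l *: intpt R k)).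
    by apply: eq_Rintegral => z _; rewrite dE.
  by apply: eq_Rintegral => z _; rewrite dE.
have btl : bounded_measurable ((fun z => trig (k, b) (l *: z)) : T2 -> R).
  rewrite /trig /=; case: b {bt it}.
    by under eq_fun do rewrite dE; exact: bounded_cos_dot.
  by under eq_fun do rewrite dE; exact: bounded_sin_dot.
apply: (@addrI _ 1); rewrite -Rintegral_theta_1D//.
have h : \int[haar R]_y (mollifier theta l y * (1 + trig (k, b) y)) =
         \int[leb2]_z (theta z * (1 + trig (k, b) (l *: z))).
  congr fine; apply: (ge0_integral_mollifier (g := fun y => 1 + trig (k, b) y)) => //.
  - by apply: measurable_funD => //; exact: measurable_trig.
  - by move=> x; rewrite -lerBlDl sub0r; have := trig_le1 (k, b) x; rewrite ler_norml => /andP[].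
  - by move=> x m; rewrite torus_periodic_trig.
rewrite -h; under [RHS]eq_Rintegral do rewrite mulrDr mulr1.
rewrite RintegralD//; last exact: integrable_mollifier.
by congr (_ + _); rewrite /Rintegral integral_mollifier.
Qed.

Lemma theta_hat_le1 xi : `|theta_hat xi| <= 1.
Proof.
have ic := integrable_bounded_mul integrable_theta (bounded_cos_dot xi).
apply: (le_trans (le_normr_Rintegral measurableT ic)).
rewrite -Rintegral_theta; apply: le_Rintegral => //.
  rewrite (_ : _ \o _ = abse \o (EFin \o (fun z => theta z * cos (dot xi z)))).
    exact: integrable_abse.
  by apply/funext => z.
by move=> z _; rewrite normrM (ger0_norm (theta0 z)) ler_piMr// ler_norml cos_geN1 cos_le1.
Qed.

Lemma normc_fourier_transform xi :
  Normc.normc (fourier_transform theta xi) ^+ 2 = theta_hat xi ^+ 2.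
Proof.
rewrite /fourier_transform /cintegral /= sqr_sqrtr ?addr_ge0 ?sqr_ge0//.
have -> : \int[leb2]_z (theta z * cos (- dot xi z) - 0 * sin (- dot xi z)) = theta_hat xi.
  by apply: eq_Rintegral => z _; rewrite mul0r subr0 cosN.
have -> : \int[leb2]_z (theta z * sin (- dot xi z) + 0 * cos (- dot xi z)) =
    -1 * \int[leb2]_z (theta z * sin (dot xi z)).
  have is_ := integrable_bounded_mul integrable_theta (bounded_sin_dot xi).
  by rewrite -RintegralZl//; apply: eq_Rintegral => z _; rewrite sinN; ring.
by rewrite integral_theta_sin mulr0 expr0n addr0.
Qed.

End mollifier.

(** * Real-valued Fubini and convolution with the mollifier *)

Section fubini_real.
Context d1 d2 (T1 : measurableType d1) (T2 : measurableType d2) (R : realType)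
  (m1 : {sigma_finite_measure set T1 -> \bar R})
  (m2 : {sigma_finite_measure set T2 -> \bar R}).
Variable F : T1 * T2 -> R.
Hypothesis iF : (m1 \x m2)%E.-integrable setT (EFin \o F).

Let mF : measurable_fun setT F.
Proof. by apply/measurable_EFinP; exact: (measurable_int _ iF). Qed.

(** The real-valued inner integral applies [fine], so it agrees with the extended one only where the
    latter is finite. *)
Lemma ae_Rintegral_fst :
  {ae m1, forall x, (\int[m2]_y F (x, y))%:E = (\int[m2]_y (F (x, y))%:E)%E}.
Proof.
apply: filterS (ae_integrable1 iF) => x ix.
by rewrite fineK//; exact: integrable_fin_num.
Qed.

Lemma integrable_Rintegral_fst :
  m1.-integrable setT (fun x => (\int[m2]_y F (x, y))%:E).
Proof.
have mR : measurable_fun setT (fun x => \int[m2]_y F (x, y)).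
  exact: measurable_fun_Rintegral.
have iG := integrable_fubini_F iF; have /integrableP[mG Goo] := iG.
apply/integrableP; split; first exact/measurable_EFinP.
rewrite (ae_eq_integral (fun x => `|fubini_F m2 (EFin \o F) x|%E))//.
- by apply: measurableT_comp => //; exact/measurable_EFinP.
- exact: measurableT_comp.
- by apply: filterS ae_Rintegral_fst => x -> _.
Qed.

Lemma Rintegral_Fubini_mul (t : T1 -> R) : bounded_measurable t ->
  \int[m1]_x ((\int[m2]_y F (x, y)) * t x) =
  \int[m2]_y \int[m1]_x (F (x, y) * t x).
Proof.
move=> [mt [M tM]].
have bt : bounded_measurable (fun z : T1 * T2 => t z.1).
  by split; [exact: (measurableT_comp mt measurable_fst)|exists M => z].
have iF' := integrable_bounded_mul iF bt.
have mF' := measurable_int _ iF'.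
congr fine.
rewrite (ae_eq_integral (fubini_F m2 (EFin \o (fun z => F z * t z.1))))//.
- rewrite [LHS](Fubini iF'); apply: ae_eq_integral => //.
  + exact: (measurable_fubini_G iF').
  + apply/measurable_EFinP.
    apply: (measurable_fun_Rintegral m1 (f := fun w : T2 * T1 => F (w.2, w.1) * t w.2)).
    apply: measurable_funM; last exact: (measurableT_comp mt measurable_snd).
    have sw : measurable_fun setT (fun w : T2 * T1 => (w.2, w.1)).
      by apply: measurable_fun_pair; [exact: measurable_snd|exact: measurable_fst].
    exact: (measurableT_comp mF sw).
  + apply: filterS (ae_integrable2 iF') => y iy _.
    by rewrite fineK//; exact: integrable_fin_num.
- apply/measurable_EFinP; apply: measurable_funM => //.
  exact: measurable_fun_Rintegral.
- exact: (measurable_fubini_F iF').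
- apply: filterS (ae_integrable1 iF) => x ix _.
  rewrite -RintegralZr// /fubini_F fineK//; apply: integrable_fin_num => //.
  by have := integrableZr measurableT (t x) ix; apply: eq_integrable => // y _ /=; rewrite EFinM.
Qed.

End fubini_real.

Section mollified.
Variable R : realType.
Local Notation T2 := (measurableTypeR R * measurableTypeR R)%type.
Context (theta phi : R * R -> R).
Hypotheses (theta_mollifier : symmetric_mollifier theta)
  (iphi : (haar R).-integrable [set: T2] (EFin \o phi))
  (pphi : torus_periodic phi).

Definition mollified (l : R) (z : R * R) : R :=
  \int[haar R]_y (phi (z - y) * mollifier theta l y).

Let mphi : measurable_fun [set: T2] phi.
Proof. by apply/measurable_EFinP; exact: (measurable_int _ iphi). Qed.

Lemma measurable_pairB : measurable_fun [set: T2 * T2]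
  (fun p : T2 * T2 => ((p.1 : R * R) - (p.2 : R * R))%R : T2).
Proof.
have m1 : measurable_fun [set: T2 * T2] (fun p : T2 * T2 => p.1.1 - p.2.1 : measurableTypeR R).
  apply: measurable_funB.
  - exact: (measurableT_comp measurable_fst measurable_fst).
  - exact: (measurableT_comp measurable_fst measurable_snd).
have m2 : measurable_fun [set: T2 * T2] (fun p : T2 * T2 => p.1.2 - p.2.2 : measurableTypeR R).
  apply: measurable_funB.
  - exact: (measurableT_comp measurable_snd measurable_fst).
  - exact: (measurableT_comp measurable_snd measurable_snd).
exact: (measurable_fun_pair m1 m2).
Qed.

Lemma torus_periodicN (T : Type) (f : R * R -> T) (x : R * R) (m : int * int) :
  torus_periodic f -> f (x - (2 * pi) *: intpt R m) = f x.
Proof. by move=> pf; rewrite -(pf (x - _) m) subrK. Qed.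

Lemma measurable_mollified : measurable_fun [set: measurableTypeR R * T2]
  (fun p : measurableTypeR R * T2 => mollified p.1 p.2).
Proof.
pose f (q : (measurableTypeR R * T2) * T2) :=
  phi ((q.1.2 : R * R) - (q.2 : R * R)) * mollifier theta q.1.1 q.2.
apply: (measurable_fun_Rintegral (haar R) (f := f)).
have s1 : measurable_fun [set: (measurableTypeR R * T2) * T2]
    (fun q : (measurableTypeR R * T2) * T2 => (q.1.2, q.2)).
  apply: measurable_fun_pair; last exact: measurable_snd.
  exact: (measurableT_comp measurable_snd measurable_fst).
have s2 : measurable_fun [set: (measurableTypeR R * T2) * T2]
    (fun q : (measurableTypeR R * T2) * T2 => (q.1.1, q.2)).
  apply: measurable_fun_pair; last exact: measurable_snd.
  exact: (measurableT_comp measurable_fst measurable_fst).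
apply: measurable_funM.
- exact: (measurableT_comp (measurableT_comp mphi measurable_pairB) s1).
- exact: (measurableT_comp (measurable_mollifier theta_mollifier) s2).
Qed.

Lemma measurable_mollified1 l : measurable_fun [set: T2] (mollified l).
Proof. exact: (measurableT_comp measurable_mollified (pair1_measurable l)). Qed.

Lemma torus_periodic_mollified l : torus_periodic (mollified l).
Proof.
by move=> x m; apply: eq_Rintegral => y _; rewrite addrAC pphi.
Qed.

(** Translating y by x0 proves this at every point, whether or not the convolution converges
    there. *)
Lemma smoothed_kernelE l x x0 :
  \int[haar R]_y (phi (x - y) * mollifier theta l (y - x0)) = mollified l (x - x0).
Proof.
rewrite /mollified; congr fine.
pose h y := (phi (x - y) * mollifier theta l (y - x0))%:E.
have mh : measurable_fun [set: T2] h.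
  apply/measurable_EFinP; apply: measurable_funM.
  - exact: (measurableT_comp (measurableT_comp mphi measurable_pairB) (pair1_measurable (x : T2))).
  - exact: (measurableT_comp (measurable_mollifier1 theta_mollifier l)
      (measurable_pair_translate _)).
have ph : torus_periodic h.
  move=> y m; congr EFin; congr (_ * _).
    by rewrite opprD addrA torus_periodicN.
  by rewrite addrAC; apply: torus_periodic_mollifier.
rewrite -[LHS](integral_haar_affine (s := 1) x0 erefl mh ph).
apply: eq_integral => y _; rewrite /h scale1r addrK; congr (phi _ * _)%:E.
by rewrite opprD addrA addrAC.
Qed.

Let H l (p : T2 * T2) : R := phi ((p.1 : R * R) - (p.2 : R * R)) * mollifier theta l p.2.

Let mH l : measurable_fun setT (H l).
Proof.
apply: measurable_funM; first exact: (measurableT_comp mphi measurable_pairB).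
exact: (measurableT_comp (measurable_mollifier1 theta_mollifier l) measurable_snd).
Qed.

(** Young's inequality: the mollifier is nonnegative with mass at most 1, so the bound is uniform in
    the scale. *)
Let L1_bound l : (\int[haar R]_y \int[haar R]_z `|(H l (z, y))%:E| <=
  \int[haar R]_z `|(phi z)%:E|)%E.
Proof.
set N := (\int[haar R]_z `|(phi z)%:E|)%E.
have mabs : measurable_fun [set: T2] (fun z => `|(phi z)%:E|%E).
  by apply: measurableT_comp => //; exact/measurable_EFinP.
have N0 : (0 <= N)%E by apply: integral_ge0.
apply: (@le_trans _ _ (\int[haar R]_y ((mollifier theta l y)%:E * N))%E); last first.
  have mm : measurable_fun [set: T2] (fun y => (mollifier theta l y)%:E).
    by apply/measurable_EFinP; exact: measurable_mollifier1.
  rewrite ge0_integralZr//; last by move=> y _; rewrite lee_fin mollifier_ge0.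
  rewrite -[leRHS]mul1e; apply: lee_pmul => //; last exact: integral_mollifier_le1.
  by apply: integral_ge0 => y _; rewrite lee_fin mollifier_ge0.
rewrite le_eqVlt; apply/orP; left; apply/eqP; apply: eq_integral => y _.
have pabs : torus_periodic (fun z => `|(phi z)%:E|%E) by move=> x m; rewrite pphi.
rewrite /N -(integral_haar_translate y mabs pabs) -ge0_integralZl//; last 2 first.
- exact: (measurableT_comp mabs (measurable_pair_translate _)).
- by rewrite lee_fin mollifier_ge0.
apply: eq_integral => z _; rewrite /H /= normrM (ger0_norm (mollifier_ge0 theta_mollifier _ _)).
by rewrite -EFinM mulrC.
Qed.

Let iH l : (haar R \x haar R)%E.-integrable setT (EFin \o H l).
Proof.
apply/integrable21ltyP; first by apply/measurable_EFinP.
by apply: (le_lt_trans (L1_bound l)); have /integrableP[] := iphi.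
Qed.

Lemma integral_mollified_le l :
  (\int[haar R]_z `|(mollified l z)%:E| <= \int[haar R]_z `|(phi z)%:E|)%E.
Proof.
apply: le_trans (L1_bound l).
have mE : measurable_fun setT (fun p => `|(H l p)%:E|%E).
  by apply: measurableT_comp => //; exact/measurable_EFinP.
rewrite -[leRHS](fubini_tonelli (fun p : T2 * T2 => `|(H l p)%:E|%E))//.
apply: ge0_le_integral => //.
- by apply: measurableT_comp => //; apply/measurable_EFinP; exact: measurable_mollified1.
- exact: (measurable_fun_fubini_tonelli_F _ mE).
move=> z _; apply: (@le_trans _ _ `|\int[haar R]_y (H l (z, y))%:E|%E).
  (* [fine] sends infinite values to 0, so it never increases the absolute value. *)
  by rewrite /mollified /Rintegral; case: (integral _ _ _) => [r||] //=; rewrite normr0 leey.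
apply: le_abse_integral => //; apply/measurable_EFinP.
exact: (measurableT_comp (mH l) (pair1_measurable z)).
Qed.

(** The convolution theorem in real form. The addition formulas produce a cosine and a sine
    coefficient of the mollifier, and the latter vanishes by symmetry. *)
Lemma integral_mollified_trig l k b : l != 0 ->
  \int[haar R]_z (mollified l z * trig (k, b) z) =
  \int[haar R]_z (phi z * trig (k, b) z) * theta_hat theta (l *: intpt R k).
Proof.
move=> l0; have bt b' := bounded_trig R (k, b').
rewrite /mollified (Rintegral_Fubini_mul (F := H l) (iH l) (bt b)).
have im b' := integrable_bounded_mul iphi (bt b').
pose A := \int[haar R]_z (phi z * trig (k, true) z).
pose B := \int[haar R]_z (phi z * trig (k, false) z).
(* The sign of the second term in the addition formula: - for cosine, + for sine. *)
pose e : R := (-1) ^+ b.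
transitivity (\int[haar R]_y ((if b then A else B) * (mollifier theta l y * trig (k, true) y)
   + (e * if b then B else A) * (mollifier theta l y * trig (k, false) y))).
  apply: eq_Rintegral => y _.
  pose h z := (phi (z - y) * mollifier theta l y * trig (k, b) z)%:E.
  have mh : measurable_fun [set: T2] h.
    apply/measurable_EFinP; apply: measurable_funM; last exact: measurable_trig.
    apply: measurable_funM => //.
    exact: (measurableT_comp mphi (measurable_pair_translate _)).
  have ph : torus_periodic h.
    by move=> z m; rewrite /h torus_periodic_trig addrAC pphi.
  transitivity (\int[haar R]_z
    (mollifier theta l y * trig (k, true) y * (phi z * trig (k, b) z) +
     mollifier theta l y * trig (k, false) y * e * (phi z * trig (k, ~~ b) z))).
    congr fine; rewrite -[LHS](integral_haar_affine (s := 1) y erefl mh ph).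
    apply: eq_integral => z _; congr EFin.
    rewrite /h scale1r addrK /trig /= dotDr cosD sinD /e.
    by case: (b) => /=; rewrite ?expr1 ?expr0; ring.
  rewrite RintegralD//; [|exact: (integrableZl _ _ (im b))|exact: (integrableZl _ _ (im (~~ b)))].
  by rewrite !RintegralZl// /A /B; case: (b) => /=; ring.
have imt b' := integrable_bounded_mul (integrable_mollifier theta_mollifier l) (bt b').
rewrite RintegralD//; [|exact: (integrableZl _ _ (imt true))|exact: (integrableZl _ _ (imt false))].
rewrite !RintegralZl// !integral_mollifier_trig// mulr0 addr0.
by case: (b).
Qed.

End mollified.

Section product_integral.
Context d1 d2 (T1 : measurableType d1) (T2 : measurableType d2) (R : realType)
  (m1 : {sigma_finite_measure set T1 -> \bar R})
  (m2 : {sigma_finite_measure set T2 -> \bar R}).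
Lemma ge0_integral_prod (a : T1 -> R) (b : T2 -> R) :
  measurable_fun setT a -> measurable_fun setT b ->
  (forall x, 0 <= a x) -> (forall y, 0 <= b y) ->
  (\int[m1 \x m2]_z (a z.1 * b z.2)%:E =
   \int[m1]_x (a x)%:E * \int[m2]_y (b y)%:E)%E.
Proof.
move=> ma mb a0 b0.
have ma' : measurable_fun setT (EFin \o a) by exact/measurable_EFinP.
have mb' : measurable_fun setT (EFin \o b) by exact/measurable_EFinP.
rewrite fubini_tonelli1; last 2 first.
- apply/measurable_EFinP; apply: measurable_funM.
  + exact: (measurableT_comp ma measurable_fst).
  + exact: (measurableT_comp mb measurable_snd).
- by move=> z; rewrite lee_fin mulr_ge0.
have a0' x : [set: T1] x -> (0 <= (a x)%:E)%E by rewrite lee_fin.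
have b0' y : [set: T2] y -> (0 <= (b y)%:E)%E by rewrite lee_fin.
rewrite -ge0_integralZr//; last by apply: integral_ge0.
by apply: eq_integral => x _; rewrite /fubini_F /= -ge0_integralZl// a0'.
Qed.

Context (a : T1 -> R) (b : T2 -> R).
Hypotheses (ia : m1.-integrable setT (EFin \o a)) (ib : m2.-integrable setT (EFin \o b)).

Lemma integrable_prod : (m1 \x m2)%E.-integrable setT (fun z => (a z.1 * b z.2)%:E).
Proof.
have /integrableP[/measurable_EFinP ma aoo] := ia.
have /integrableP[/measurable_EFinP mb boo] := ib.
apply/integrableP; split.
  apply/measurable_EFinP; apply: measurable_funM.
  - exact: (measurableT_comp ma measurable_fst).
  - exact: (measurableT_comp mb measurable_snd).
under eq_integral do rewrite /= normrM.
rewrite (ge0_integral_prod (a := fun x => `|a x|) (b := fun y => `|b y|))//.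
- by apply: lte_mul_pinfty => //; [exact: integral_ge0|rewrite ge0_fin_numE//; exact: integral_ge0].
- exact: measurableT_comp.
- exact: measurableT_comp.
Qed.

Lemma Rintegral_prod :
  fine (\int[m1 \x m2]_z (a z.1 * b z.2)%:E)%E = \int[m1]_x a x * \int[m2]_y b y.
Proof.
rewrite -integral12_prod_meas1; last exact: integrable_prod.
rewrite /fubini_F /= -RintegralZr//; congr fine; apply: eq_integral => x _.
rewrite -RintegralZl// /Rintegral fineK//.
by apply: integrable_fin_num => //; exact: (integrableZl _ (a x) ib).
Qed.

End product_integral.

(** Pointwise, |Gamma|^2 <= 1 + |Gamma|^p. *)
Lemma expectation_sqr_lty (R : realType) d (Omega : measurableType d)
    (P : probability Omega R) (Gamma : {RV P >-> R}) (p : R) : 2 < p ->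
  ('E_P[fun w => (`|Gamma w| `^ p)%R] < +oo)%E ->
  (\int[P]_w (Gamma w ^+ 2)%:E < +oo)%E.
Proof.
move=> p2; rewrite unlock => pint.
have mG : measurable_fun setT Gamma by [].
apply: (@le_lt_trans _ _ (\int[P]_w (1%:E + (`|Gamma w| `^ p)%:E))%E).
  apply: ge0_le_integral => //.
  - by move=> w _; rewrite lee_fin sqr_ge0.
  - by apply/measurable_EFinP; exact: measurable_funX.
  - apply/measurable_EFinP; apply: measurable_funD => //.
    by apply: (measurableT_comp (measurable_powR p)); exact: measurableT_comp.
  move=> w _; rewrite -EFinD lee_fin -[leLHS]real_normK ?num_real//.
  have [g1|g1] := leP `|Gamma w| 1.
    by rewrite (le_trans (exprn_ile1 _ _ g1))// lerDl powR_ge0.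
  rewrite (le_trans (y := `|Gamma w| `^ p))// ?lerDr//.
  by rewrite -powR_mulrn// ler_powR// ltW.
have mp : measurable_fun setT (fun w => (`|Gamma w| `^ p)%:E).
  apply/measurable_EFinP.
  by apply: (measurableT_comp (measurable_powR p)); exact: measurableT_comp.
have p0 w : setT w -> (0 <= (`|Gamma w| `^ p)%:E)%E by rewrite lee_fin powR_ge0.
rewrite ge0_integralD//.
rewrite integral_cst// mul1e; apply: lte_add_pinfty => //.
by apply: (le_lt_trans (probability_le1 P measurableT)); exact: ltry.
Qed.

(** * The covariance of the vortex field *)

Section vortex_field.
Context (R : realType) (d : measure_display) (Omega : measurableType d)
  (P : probability Omega R) (theta : R * R -> R) (K : R * R -> 'cV[R]_2)
  (Gamma L : {RV P >-> R}) (X0 : {RV P >-> (R * R)%type}).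
Local Notation T2 := (measurableTypeR R * measurableTypeR R)%type.
Hypotheses (theta_mollifier : symmetric_mollifier theta) (bsK : biot_savart K)
  (Gamma2 : (\int[P]_w (Gamma w ^+ 2)%:E < +oo)%E).

Let phi (j : 'I_2) (x : R * R) : R := K x j 0.

Let iphi j : (haar R).-integrable [set: T2] (EFin \o phi j).
Proof. by case: bsK => _ h _; exact: (h j). Qed.

Let pphi j : torus_periodic (phi j).
Proof. by case: bsK => pK _ _ x m; rewrite /phi pK. Qed.

Let g j := mollified theta (phi j).

Let U w x := Gamma w *: smoothed_kernel K theta (L w) x (X0 w).

Lemma vortex_fieldE w x j : U w x j 0 = Gamma w * g j (L w) (x - X0 w).
Proof.
rewrite /U mxE mxE /g; congr (_ * _).
exact: (smoothed_kernelE theta_mollifier (iphi j) (@pphi j)).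
Qed.

Lemma measurable_vortex_field j : measurable_fun [set: T2 * Omega]
  (fun q : T2 * Omega => U q.2 q.1 j 0).
Proof.
rewrite (_ : (fun _ => _) = fun q : T2 * Omega =>
  Gamma q.2 * g j (L q.2) ((q.1 : R * R) - X0 q.2)); last first.
  by apply/funext => q; exact: vortex_fieldE.
apply: measurable_funM; first exact: (measurableT_comp _ measurable_snd).
have mX : measurable_fun [set: T2 * Omega] (fun q : T2 * Omega => (q.1, X0 q.2 : T2)).
  apply: measurable_fun_pair; first exact: measurable_fst.
  exact: (measurableT_comp (measurable_funP X0) measurable_snd).
have mB := measurableT_comp (@measurable_pairB R) mX.
have mL : measurable_fun [set: T2 * Omega] (fun q : T2 * Omega => L q.2 : measurableTypeR R).
  exact: (measurableT_comp (measurable_funP L) measurable_snd).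
exact: (measurableT_comp (measurable_mollified theta_mollifier (iphi j))
  (measurable_fun_pair mL mB)).
Qed.

Let kappa j : \bar R := (\int[haar R]_x `|(phi j x)%:E|)%E.

Let kappa_fin j : kappa j \is a fin_num.
Proof.
have /integrableP[_ h] := iphi j.
by rewrite ge0_fin_numE//; exact: integral_ge0.
Qed.

Let mU w j : measurable_fun [set: T2] (fun x => U w x j 0).
Proof. exact: (measurableT_comp (measurable_vortex_field j) (pair2_measurable w)). Qed.

Lemma integral_vortex_field_le w j :
  (\int[haar R]_x `|(U w x j 0)%:E| <= `|Gamma w|%:E * kappa j)%E.
Proof.
have mg := measurable_mollified1 theta_mollifier (iphi j) (L w).
have mga : measurable_fun [set: T2] (fun x => `|(g j (L w) x)%:E|%E).
  by apply: measurableT_comp => //; exact/measurable_EFinP.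
have pg : torus_periodic (fun x => `|(g j (L w) x)%:E|%E).
  by move=> x m; rewrite /g (torus_periodic_mollified _ (@pphi j)).
under eq_integral do rewrite vortex_fieldE EFinM abseM.
rewrite ge0_integralZl//; last first.
  exact: (measurableT_comp mga (measurable_pair_translate _)).
rewrite (integral_haar_translate _ mga pg) /= lee_wpmul2l//.
exact: (integral_mollified_le theta_mollifier (iphi j)).
Qed.

Lemma integrable_vortex_field w j : (haar R).-integrable [set: T2] (fun x => (U w x j 0)%:E).
Proof.
apply/integrableP; split; first exact/measurable_EFinP.
apply: (le_lt_trans (integral_vortex_field_le w j)).
by rewrite -(fineK (kappa_fin j)) -EFinM ltry.
Qed.

Let Phi i j (q : (T2 * T2) * Omega) : R := U q.2 q.1.1 i 0 * U q.2 q.1.2 j 0.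

Let mPhi i j : measurable_fun setT (Phi i j).
Proof.
have s1 : measurable_fun [set: (T2 * T2) * Omega] (fun q : (T2 * T2) * Omega => (q.1.1, q.2)).
  apply: measurable_fun_pair; last exact: measurable_snd.
  exact: (measurableT_comp measurable_fst measurable_fst).
have s2 : measurable_fun [set: (T2 * T2) * Omega] (fun q : (T2 * T2) * Omega => (q.1.2, q.2)).
  apply: measurable_fun_pair; last exact: measurable_snd.
  exact: (measurableT_comp measurable_snd measurable_fst).
by apply: measurable_funM; [exact: (measurableT_comp (measurable_vortex_field i) s1)
  |exact: (measurableT_comp (measurable_vortex_field j) s2)].
Qed.

Let haar2 : probability (T2 * T2)%type R := (haar R \x haar R)%E.

(** Integrating over the two points first splits the product into two L^1 norms; the result is at
    most Gamma^2 times a constant. *)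
Let iPhi i j : (haar2 \x P)%E.-integrable setT (EFin \o Phi i j).
Proof.
have mE : measurable_fun setT (EFin \o Phi i j) by exact/measurable_EFinP.
apply/(integrable21ltyP haar2 P mE).
apply: (@le_lt_trans _ _ (\int[P]_w ((Gamma w ^+ 2)%:E * (kappa i * kappa j)))%E).
  apply: ge0_le_integral => //.
  - by move=> w _; exact: integral_ge0.
  - apply: (measurable_fun_fubini_tonelli_G (fun q => `|(Phi i j q)%:E|%E)) => //.
    by apply: measurableT_comp => //; exact/measurable_EFinP.
  - apply: emeasurable_funM => //; apply/measurable_EFinP; exact: measurable_funX.
  move=> w _.
  rewrite (eq_integral (fun z : T2 * T2 => (`|U w z.1 i 0| * `|U w z.2 j 0|)%:E)); last first.
    by move=> z _; rewrite /Phi /= normrM.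
  rewrite (@ge0_integral_prod _ _ T2 T2 R (haar R) (haar R)
    (fun x => `|U w x i 0|) (fun x => `|U w x j 0|))//; try exact: measurableT_comp.
  rewrite -[(Gamma w ^+ 2)%R]real_normK ?num_real// expr2 EFinM muleACA.
  by apply: lee_pmul; [exact: integral_ge0|exact: integral_ge0
    |exact: integral_vortex_field_le|exact: integral_vortex_field_le].
rewrite -(fineK (kappa_fin i)) -(fineK (kappa_fin j)) -EFinM.
have k0 : 0 <= fine (kappa i) * fine (kappa j).
  by rewrite mulr_ge0// fine_ge0// integral_ge0.
rewrite ge0_integralZr//.
- by rewrite muleC; apply: lte_mul_pinfty.
- by apply/measurable_EFinP; exact: measurable_funX.
- by move=> w _; rewrite lee_fin sqr_ge0.
Qed.

Lemma vortex_covariance_ae_defined : covariance_ae_defined P U.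
Proof.
have H i j := ae_integrable1 (iPhi i j).
have ord2 (i : 'I_2) : i = ord0 \/ i = ord_max.
  by case: i => -[|[|//]] h; [left|right]; exact/val_inj.
apply: filterS (filterI (filterI (H ord0 ord0) (H ord0 ord_max))
  (filterI (H ord_max ord0) (H ord_max ord_max))) => z [[h1 h2] [h3 h4]] i j.
by case: (ord2 i) => ->; case: (ord2 j) => ->.
Qed.

Let covE z1 z2 i j : covariance_fun P U z1 z2 i j = \int[P]_w Phi i j ((z1, z2), w).
Proof. by rewrite /covariance_fun mxE unlock. Qed.

Let mcov i j : measurable_fun [set: T2 * T2]
  (fun z : T2 * T2 => covariance_fun P U z.1 z.2 i j).
Proof.
have := measurable_fun_Rintegral P (mPhi i j).
by apply: eq_measurable_fun => // -[z1 z2] _; rewrite covE.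
Qed.

Let i0 : 'I_2 := ord0.
Let i1 : 'I_2 := lift ord0 ord0.

Let pair_with (v : R * R -> 'cV[R]_2) w x : R :=
  U w x i0 0 * v x i0 0 + U w x i1 0 * v x i1 0.

Let field_pairingE v w : field_pairing (U w) v = \int[haar R]_x pair_with v w x.
Proof.
apply: eq_Rintegral => x _; rewrite mxE big_ord_recl big_ord_recl big_ord0 addr0.
by rewrite ![trmx _ _ _]mxE.
Qed.

Let bounded_field v i : smooth_field v -> bounded_measurable ((fun x => v x i 0) : T2 -> R).
Proof.
move=> [pv sv]; have [cv _] := sv i 0%N; split; first exact: continuous_measurable_plane.
by apply: continuous_periodic_bounded => // x m; rewrite pv.
Qed.

Let integrable_pair_with v w : smooth_field v ->
  (haar R).-integrable [set: T2] (EFin \o pair_with v w).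
Proof.
move=> sv.
have h i := integrable_bounded_mul (integrable_vortex_field w i) (bounded_field i sv).
by have := integrableD measurableT (h i0) (h i1).
Qed.

(** Fubini for [Psi]: integrating over the outcome first gives the left side, for almost every pair,
    and over the two points first gives the product of the pairings. *)
Lemma vortex_covariance_identity : covariance_identity P U (covariance_fun P U).
Proof.
move=> v w sv sw vQw.
pose c i j (z : T2 * T2) : R := v z.1 i 0 * w z.2 j 0.
have bc i j : bounded_measurable (fun q : (T2 * T2) * Omega => c i j q.1).
  have [mv [M vM]] := bounded_field i sv; have [mw [N wN]] := bounded_field j sw.
  split; last by exists (M * N) => q; rewrite normrM ler_pM.
  apply: measurable_funM.
  - exact: (measurableT_comp mv (measurableT_comp measurable_fst measurable_fst)).
  - exact: (measurableT_comp mw (measurableT_comp measurable_snd measurable_fst)).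
pose Psi (q : (T2 * T2) * Omega) : R := pair_with v q.2 q.1.1 * pair_with w q.2 q.1.2.
have PsiE : Psi = fun q => (Phi i0 i0 q * c i0 i0 q.1 + Phi i1 i0 q * c i1 i0 q.1) +
    (Phi i0 i1 q * c i0 i1 q.1 + Phi i1 i1 q * c i1 i1 q.1).
  by apply/funext => q; rewrite /Psi /pair_with /Phi /c; ring.
have iPsi : (haar2 \x P)%E.-integrable setT (EFin \o Psi).
  have h i j := integrable_bounded_mul (iPhi i j) (bc i j).
  rewrite PsiE; have := integrableD measurableT
    (integrableD measurableT (h i0 i0) (h i1 i0)) (integrableD measurableT (h i0 i1) (h i1 i1)).
  by apply: eq_integrable.
have vQwE z : vQw z = (covariance_fun P U z.1 z.2 i0 i0 * c i0 i0 z +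
     covariance_fun P U z.1 z.2 i1 i0 * c i1 i0 z) +
    (covariance_fun P U z.1 z.2 i0 i1 * c i0 i1 z +
     covariance_fun P U z.1 z.2 i1 i1 * c i1 i1 z).
  rewrite /vQw /c mxE big_ord_recl big_ord_recl big_ord0 addr0.
  rewrite ![(_ *m covariance_fun _ _ _ _) _ _]mxE !big_ord_recl !big_ord0 !addr0.
  by rewrite ![trmx _ _ _]mxE /i0 /i1; ring.
have mvQw : measurable_fun [set: T2 * T2] (vQw : T2 * T2 -> R).
  have mc i j : measurable_fun [set: T2 * T2] (c i j).
    have [mv _] := bounded_field i sv; have [mw _] := bounded_field j sw.
    have h1 := measurableT_comp mv (@measurable_fst _ _ T2 T2).
    have h2 := measurableT_comp mw (@measurable_snd _ _ T2 T2).
    exact: (measurable_funM h1 h2).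
  have mcc i j := measurable_funM (mcov i j) (mc i j).
  have := measurable_funD (measurable_funD (mcc i0 i0) (mcc i1 i0))
    (measurable_funD (mcc i0 i1) (mcc i1 i1)).
  by apply: eq_measurable_fun => z _; rewrite vQwE.
have ae_vQw : {ae haar2, forall z : T2 * T2,
    (vQw z)%:E = (\int[P]_w (Psi (z, w))%:E)%E}.
  have ae_def : {ae haar2, forall z : T2 * T2, forall i j,
    P.-integrable setT (fun w => (U w z.1 i 0 * U w z.2 j 0)%:E)} := vortex_covariance_ae_defined.
  apply: filterS ae_def => -[z1 z2] iz.
  have iPz i j : P.-integrable setT (EFin \o (fun w => Phi i j ((z1, z2), w) * c i j (z1, z2))).
    by have := integrableZr measurableT (c i j (z1, z2)) (iz i j); apply: eq_integrable.
  have iD i j i' j' := integrableD measurableT (iPz i j) (iPz i' j').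
  rewrite vQwE !covE /= -!RintegralZr//; try exact: iz.
  rewrite -RintegralD//.
  rewrite -[X in _ + X]RintegralD//.
  rewrite -RintegralD//; [|exact: iD|exact: iD].
  rewrite /Rintegral fineK; last first.
    apply: integrable_fin_num => //.
    by have := integrableD measurableT (iD i0 i0 i1 i0) (iD i0 i1 i1 i1); apply: eq_integrable.
  by apply: eq_integral => w' _; rewrite PsiE.
have iF := integrable_fubini_F iPsi.
have mF := measurable_fubini_F iPsi.
have mvE : measurable_fun [set: T2 * T2] (EFin \o vQw) by exact/measurable_EFinP.
have ae_eqF : ae_eq haar2 setT (EFin \o vQw) (fubini_F P (EFin \o Psi)).
  by apply: filterS ae_vQw => z + _.
split.
  have /integrableP[_ Foo] := iF.
  apply/integrableP; split => //.
  have absE : (\int[haar2]_z `|(EFin \o vQw) z| =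
      \int[haar2]_z `|fubini_F P (EFin \o Psi) z|)%E.
    apply: ae_eq_integral => //; try exact: measurableT_comp.
    by apply: filterS ae_eqF => z + zT => /(_ zT) ->.
  exact: (eq_ind_r (fun a => (a < +oo)%E) Foo absE).
have intE : (\int[haar2]_z (EFin \o vQw) z = \int[haar2]_z fubini_F P (EFin \o Psi) z)%E.
  exact: ae_eq_integral.
rewrite unlock; apply: (eq_trans intE); apply: (eq_trans (Fubini iPsi)).
apply: eq_integral => om _.
rewrite !field_pairingE -(Rintegral_prod (integrable_pair_with om sv) (integrable_pair_with om sw)).
rewrite fineK//; apply: integrable_fin_num => //.
exact: (integrable_prod (integrable_pair_with om sv) (integrable_pair_with om sw)).
Qed.

End vortex_field.

(** * Averaging over the uniform translation *)

Lemma measurable_trig_coef (R : realType) (a : R -> R * R -> R) kb :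
  measurable_fun [set: measurableTypeR R * (measurableTypeR R * measurableTypeR R)]
    (fun q => a q.1 q.2) ->
  measurable_fun [set: measurableTypeR R]
    (fun l => \int[haar R]_z (a l z * trig kb z)).
Proof.
move=> ma; apply: (measurable_fun_Rintegral (haar R) (f := fun q => a q.1 q.2 * trig kb q.2)).
by apply: measurable_funM => //; exact: (measurableT_comp (@measurable_trig R kb) measurable_snd).
Qed.

Section uniform_translate.
Local Open Scope ereal_scope.
Context d d1 (R : realType) (Omega : measurableType d) (T1 : measurableType d1)
  (P : probability Omega R) (Y : {RV P >-> T1})
  (X0 : {RV P >-> (measurableTypeR R * measurableTypeR R)%type}).
Local Notation T2 := (measurableTypeR R * measurableTypeR R)%type.
Hypotheses (X0_uniform : forall A, measurable A -> distribution P X0 A = haar R A)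
  (X0Y : independent P X0 Y).
Variables (h : T1 * T2 -> \bar R) (a : R * R).
Hypotheses (mh : measurable_fun setT h)
  (ph : forall y, torus_periodic (fun x => h (y, x))).

Let shift (f : T1 * T2 -> \bar R) (q : T1 * T2) := f (q.1, ((q.2 : R * R) + a)%R : T2).

Let measurable_shift f : measurable_fun setT f -> measurable_fun setT (shift f).
Proof.
move=> mf.
have mq : measurable_fun [set: T1 * T2] (fun q : T1 * T2 => (q.1, ((q.2 : R * R) + a)%R : T2)).
  apply: measurable_fun_pair; first exact: measurable_fst.
  exact: (measurableT_comp (measurable_pair_translate a) measurable_snd).
exact: (measurableT_comp mf mq).
Qed.

Let ge0_shift f : measurable_fun setT f -> (forall q, 0 <= f q) ->
  (forall y, torus_periodic (fun x => f (y, x))) ->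
  \int[P]_w shift f (Y w, X0 w) = \int[P]_w f (Y w, X0 w).
Proof.
move=> mf f0 pf.
have E1 := ge0_expectation_independent (m := haar R) X0_uniform X0Y mf f0.
have E2 := ge0_expectation_independent (m := haar R) X0_uniform X0Y (measurable_shift mf)
  (fun q => f0 (q.1, ((q.2 : R * R) + a)%R : T2)).
apply: (eq_trans E2); apply: (eq_trans _ (esym E1)).
apply: eq_integral => w _.
have mfw : measurable_fun [set: T2] (fun x => f (Y w, x)).
  exact: (measurableT_comp mf (pair1_measurable (Y w))).
rewrite -[RHS](integral_haar_affine (s := 1) a erefl mfw (pf (Y w))).
by apply: eq_integral => x _; rewrite /shift scale1r.
Qed.

(** Independence replaces X0 by an integral over the torus, which is translation invariant. Each
    part of [h] is handled alone, so the equality also covers divergent expectations. *)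
Lemma expectation_translate :
  \int[P]_w h (Y w, ((X0 w : R * R) + a)%R) = \int[P]_w h (Y w, X0 w).
Proof.
rewrite integralE [RHS]integralE; congr (_ - _).
- have pp y : torus_periodic (fun x => h^\+ (y, x)).
    by move=> x m; rewrite !funeposE ph.
  apply: (eq_trans _ (eq_trans (ge0_shift (measurable_funepos mh) (funepos_ge0 h) pp) _));
    by apply: eq_integral => w _; rewrite /shift !funeposE.
- have pn y : torus_periodic (fun x => h^\- (y, x)).
    by move=> x m; rewrite !funenegE ph.
  apply: (eq_trans _ (eq_trans (ge0_shift (measurable_funeneg mh) (funeneg_ge0 h) pn) _));
    by apply: eq_integral => w _; rewrite /shift !funenegE.
Qed.

End uniform_translate.

Section random_translate.
Context (R : realType) (d : measure_display) (Omega : measurableType d)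
  (P : probability Omega R) (Gamma L : {RV P >-> R}) (X0 : {RV P >-> (R * R)%type}).
Local Notation T2 := (measurableTypeR R * measurableTypeR R)%type.
Hypotheses (X0_uniform : uniform_on_torus X0)
  (X0GL : independent P X0 (fun w => (Gamma w, L w)))
  (Gamma2 : (\int[P]_w (Gamma w ^+ 2)%:E < +oo)%E).

Let gl (w : Omega) : T2 := (Gamma w, L w).

Let mgl : measurable_fun setT gl.
Proof. exact: (measurable_fun_pair (measurable_funP Gamma) (measurable_funP L)). Qed.

Let GL : {RV P >-> T2}.
Proof. exact: (HB.pack gl (@isMeasurableFun.Build _ _ _ _ gl mgl)). Defined.

(* [R] and [measurableTypeR R] carry the same sigma-algebra under different
   measurable structures; [haar R] is built on the latter. *)
Let XX : {RV P >-> T2}.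
Proof.
exact: (HB.pack (X0 : Omega -> T2)
  (@isMeasurableFun.Build _ _ _ _ (X0 : Omega -> T2) (measurable_funP X0))).
Defined.

Let XX_uniform A : measurable A -> distribution P XX A = haar R A.
Proof. exact: X0_uniform. Qed.

Let XXGL : independent P XX GL.
Proof. exact: X0GL. Qed.

Variables (a b : R -> R * R -> R) (ka kb : R).
Hypotheses
  (ma : measurable_fun [set: measurableTypeR R * T2] (fun p => a p.1 p.2))
  (mb : measurable_fun [set: measurableTypeR R * T2] (fun p => b p.1 p.2))
  (pa : forall l, torus_periodic (a l)) (pb : forall l, torus_periodic (b l))
  (ka_bound : forall l, (\int[haar R]_x `|(a l x)%:E| <= ka%:E)%E)
  (kb_bound : forall l, (\int[haar R]_x `|(b l x)%:E| <= kb%:E)%E).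

Let h (x x' : R * R) (q : T2 * T2) : R :=
  q.1.1 ^+ 2 * (a q.1.2 (x - (q.2 : R * R)) * b q.1.2 (x' - (q.2 : R * R))).

Let measurable_sub_snd (f : R -> R * R -> R) (x : R * R) :
  measurable_fun [set: measurableTypeR R * T2] (fun p => f p.1 p.2) ->
  measurable_fun [set: T2 * T2] (fun q : T2 * T2 => f q.1.2 (x - (q.2 : R * R))).
Proof.
move=> mf.
have m1 : measurable_fun [set: T2 * T2] (fun q : T2 * T2 => q.1.2).
  exact: (measurableT_comp measurable_snd measurable_fst).
have m2 : measurable_fun [set: T2 * T2] (fun q : T2 * T2 => (x - (q.2 : R * R))%R : T2).
  exact: (measurableT_comp (measurableT_comp (@measurable_pairB R) (pair1_measurable (x : T2)))
    measurable_snd).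
exact: (measurableT_comp mf (measurable_fun_pair m1 m2)).
Qed.

Let mh x x' : measurable_fun setT (EFin \o h x x').
Proof.
apply/measurable_EFinP; apply: measurable_funM.
  apply: measurable_funX.
  exact: (measurableT_comp measurable_fst measurable_fst).
exact: (measurable_funM (measurable_sub_snd x ma) (measurable_sub_snd x' mb)).
Qed.

Let periodic_sub (f : R * R -> R) (x y : R * R) (m : int * int) : torus_periodic f ->
  f (x - (y + (2 * pi) *: intpt R m)) = f (x - y).
Proof. by move=> pf; rewrite opprD addrA torus_periodicN. Qed.

(** Replacing X0 by X0 + x' turns x - X0 and x' - X0 into x - x' - X0 and - X0. *)
Lemma homogeneous_expectation x x' :
  (\int[P]_w (Gamma w ^+ 2 * (a (L w) (x - X0 w) * b (L w) (x' - X0 w)))%:E =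
   \int[P]_w (Gamma w ^+ 2 * (a (L w) (x - x' - X0 w) * b (L w) (0 - X0 w)))%:E)%E.
Proof.
have ph y : torus_periodic (fun z => (h x x' (y, z))%:E).
  by move=> z m; rewrite /h /= !periodic_sub.
have := expectation_translate XX_uniform XXGL x' (mh x x') ph.
move=> /esym E; apply: (eq_trans E); apply: eq_integral => w _.
rewrite /= /h /=; congr (_ * (a _ _ * b _ _))%:E.
  by rewrite opprD addrA addrAC.
by rewrite opprD addrCA subrr addr0 add0r.
Qed.

Let haar_reflect (f : R * R -> \bar R) :
  measurable_fun [set: T2] f -> torus_periodic f ->
  (\int[haar R]_x f (0 - x)%R = \int[haar R]_x f x)%E.
Proof.
move=> mf pf; rewrite -[RHS](integral_haar_affine (s := -1) 0 erefl mf pf).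
by apply: eq_integral => x _; rewrite addr0 scaleN1r sub0r.
Qed.

Let ma1 l : measurable_fun [set: T2] (a l).
Proof. exact: (measurableT_comp ma (pair1_measurable (l : measurableTypeR R))). Qed.

Let mb1 l : measurable_fun [set: T2] (b l).
Proof. exact: (measurableT_comp mb (pair1_measurable (l : measurableTypeR R))). Qed.

Let ia l : (haar R).-integrable [set: T2] (EFin \o a l).
Proof.
apply/integrableP; split; first exact/measurable_EFinP.
exact: (le_lt_trans (ka_bound l) (ltry _)).
Qed.

Let ib l : (haar R).-integrable [set: T2] (EFin \o b l).
Proof.
apply/integrableP; split; first exact/measurable_EFinP.
exact: (le_lt_trans (kb_bound l) (ltry _)).
Qed.

Let B (w : Omega) : R := Gamma w ^+ 2 * b (L w) (0 - X0 w).

Let hb (q : T2 * T2) : R := q.1.1 ^+ 2 * b q.1.2 (0 - (q.2 : R * R)).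

Let mhb : measurable_fun setT hb.
Proof.
apply: measurable_funM; last exact: measurable_sub_snd.
by apply: measurable_funX; exact: (measurableT_comp measurable_fst measurable_fst).
Qed.

Let iB : P.-integrable setT (EFin \o B).
Proof.
have mE : measurable_fun setT (EFin \o hb) by exact/measurable_EFinP.
apply: (integrable_independent (m := haar R) XX_uniform XXGL mE).
have kb0 : 0 <= kb.
  by rewrite -lee_fin (le_trans _ (kb_bound 0))//; exact: integral_ge0.
apply: (@le_lt_trans _ _ (\int[P]_w ((Gamma w ^+ 2)%:E * kb%:E))%E); last first.
  rewrite ge0_integralZr//.
  - by rewrite muleC; apply: lte_mul_pinfty.
  - by apply/measurable_EFinP; exact: measurable_funX.
  - by move=> w _; rewrite lee_fin sqr_ge0.
apply: ge0_le_integral => //.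
- by move=> w _; exact: integral_ge0.
- have mG : measurable_fun [set: T2] (fun y => \int[haar R]_x `|(hb (y, x))%:E|)%E.
    apply: (measurable_fun_fubini_tonelli_F (fun q => `|(hb q)%:E|%E)) => //.
    exact: measurableT_comp.
  exact: (measurableT_comp mG mgl).
- apply: emeasurable_funM => //; apply/measurable_EFinP; exact: measurable_funX.
move=> w _.
have -> : (\int[haar R]_y `|(EFin \o hb) (GL w, y)| =
    (Gamma w ^+ 2)%:E * \int[haar R]_y `|(b (L w) y)%:E|)%E.
  have mb' : measurable_fun [set: T2] (fun y => `|(b (L w) y)%:E|%E).
    by apply: measurableT_comp => //; exact/measurable_EFinP.
  have pb' : torus_periodic (fun y => `|(b (L w) y)%:E|%E) by move=> x m; rewrite pb.
  have mb'' := measurableT_comp mb' (measurableT_comp (@measurable_pairB R)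
    (pair1_measurable ((0 : R * R) : T2))).
  rewrite -(haar_reflect mb' pb') -ge0_integralZl//; last by rewrite lee_fin sqr_ge0.
  by apply: eq_integral => y _; rewrite /hb /= normrM (ger0_norm (sqr_ge0 _)) EFinM.
by rewrite lee_wpmul2l// lee_fin sqr_ge0.
Qed.

Let F (q : T2 * Omega) : R := Gamma q.2 ^+ 2 *
  (a (L q.2) ((q.1 : R * R) - X0 q.2) * b (L q.2) (0 - X0 q.2)).

Let FE z w : F (z, w) = B w * a (L w) ((z : R * R) - X0 w).
Proof. by rewrite /F /B /=; ring. Qed.

Let mF : measurable_fun setT F.
Proof.
have mX : measurable_fun [set: T2 * Omega] (fun q : T2 * Omega => (q.1, X0 q.2 : T2)).
  apply: measurable_fun_pair; first exact: measurable_fst.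
  exact: (measurableT_comp (measurable_funP X0) measurable_snd).
have mBX := measurableT_comp (@measurable_pairB R) mX.
have mL : measurable_fun [set: T2 * Omega] (fun q : T2 * Omega => L q.2 : measurableTypeR R).
  exact: (measurableT_comp (measurable_funP L) measurable_snd).
have m1 := measurableT_comp ma (measurable_fun_pair mL mBX).
have /measurable_EFinP mB := measurable_int _ iB.
have m2 := measurableT_comp mB (@measurable_snd _ _ T2 Omega).
have := measurable_funM m2 m1.
by apply: eq_measurable_fun => -[z w] _; rewrite FE.
Qed.

Lemma integrable_translate_product : (haar R \x P)%E.-integrable setT (EFin \o F).
Proof.
have mE : measurable_fun setT (EFin \o F) by exact/measurable_EFinP.
apply/(integrable21ltyP (haar R) P mE).
have ka0 : 0 <= ka.
  by rewrite -lee_fin (le_trans _ (ka_bound 0))//; exact: integral_ge0.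
have /integrableP[mB Boo] := iB.
have mB' : measurable_fun setT (fun w => `|(B w)%:E|%E) by exact: measurableT_comp.
apply: (@le_lt_trans _ _ (\int[P]_w (`|(B w)%:E| * ka%:E))%E); last first.
  by rewrite ge0_integralZr//= muleC; apply: lte_mul_pinfty.
apply: ge0_le_integral => //.
- by move=> w _; exact: integral_ge0.
- apply: (measurable_fun_fubini_tonelli_G (fun q => `|(F q)%:E|%E)) => //.
  exact: measurableT_comp.
- exact: emeasurable_funM.
move=> w _.
have -> : (\int[haar R]_z `|(EFin \o F) (z, w)| =
    `|(B w)%:E| * \int[haar R]_z `|(a (L w) z)%:E|)%E.
  have mabs : measurable_fun [set: T2] (fun z => `|(a (L w) z)%:E|%E).
    by apply: measurableT_comp => //; exact/measurable_EFinP.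
  have pabs : torus_periodic (fun z => `|(a (L w) z)%:E|%E) by move=> x m; rewrite pa.
  rewrite -(integral_haar_affine (s := 1) (- X0 w) erefl mabs pabs) -ge0_integralZl//; last first.
    have := measurableT_comp mabs (measurable_pair_translate (- (X0 w : R * R))).
    by apply: eq_measurable_fun => z _; rewrite scale1r.
  by apply: eq_integral => z _; rewrite /= FE normrM scale1r EFinM.
by rewrite lee_wpmul2l.
Qed.

Let A s k l := \int[haar R]_z (a l z * trig (k, s) z).

Let Bc s k l := \int[haar R]_z (b l z * trig (k, s) z).

(** Real form of the fact that z |-> int a(z - y) b(- y) dy has k-th coefficient equal to that of a
    times the conjugate of that of b. *)
Lemma integral_translate_product_trig k s :
  \int[haar R]_z ((\int[P]_w F (z, w)) * trig (k, s) z) =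
  \int[P]_w (Gamma w ^+ 2 * (A s k (L w) * Bc true k (L w) -
    (-1) ^+ s * A (~~ s) k (L w) * Bc false k (L w))).
Proof.
have bt s' := bounded_trig R (k, s').
have mA s' : measurable_fun [set: measurableTypeR R] (A s' k).
  exact: measurable_trig_coef ma.
have bA s' l : `|A s' k l| <= ka.
  have it := integrable_bounded_mul (ia l) (bt s').
  apply: (le_trans (le_normr_Rintegral measurableT it)).
  rewrite -lee_fin fineK; last first.
    have /integrableP[_ h1] := it.
    by rewrite ge0_fin_numE//; exact: integral_ge0.
  apply: (le_trans _ (ka_bound l)); apply: ge0_le_integral => //.
  - have /measurable_EFinP h1 := measurable_int _ it.
    by apply/measurable_EFinP; exact: measurableT_comp.
  - by apply: measurableT_comp => //; exact/measurable_EFinP.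
  by move=> z _; rewrite lee_fin normrM ler_piMr// trig_le1.
have mAs s' : measurable_fun [set: T2 * T2] (fun q : T2 * T2 => A s' k q.1.2).
  exact: (measurableT_comp (mA s') (measurableT_comp measurable_snd measurable_fst)).
have mt s' : measurable_fun [set: T2 * T2] (fun q : T2 * T2 => trig (k, s') q.2).
  exact: (measurableT_comp (@measurable_trig R (k, s')) measurable_snd).
(* What integrating out z leaves once z is translated by X0 and the addition formula is applied; it
   is bounded, so the product with [hb] stays integrable. *)
pose M (q : T2 * T2) : R := A s k q.1.2 * trig (k, true) q.2 +
  (-1) ^+ s * A (~~ s) k q.1.2 * trig (k, false) q.2.
have mM : measurable_fun setT M.
  apply: measurable_funD; apply: measurable_funM => //.
  by apply: measurable_funM.
have bM q : `|M q| <= ka + ka.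
  apply: (le_trans (ler_normD _ _)); apply: lerD; rewrite !normrM.
    by rewrite -[leRHS]mulr1 ler_pM// trig_le1.
  by rewrite normrX normrN1 expr1n mul1r -[leRHS]mulr1 ler_pM// trig_le1.
rewrite (Rintegral_Fubini_mul integrable_translate_product (bt s)).
transitivity (\int[P]_w (hb (GL w, XX w) * M (GL w, XX w))).
  apply: eq_Rintegral => w _.
  pose f z := (F (z, w) * trig (k, s) z)%:E.
  pose g z := B w * trig (k, true) (X0 w) * (a (L w) z * trig (k, s) z) +
    (-1) ^+ s * B w * trig (k, false) (X0 w) * (a (L w) z * trig (k, ~~ s) z).
  transitivity (\int[haar R]_z g z).
    have mf : measurable_fun [set: T2] f.
      apply/measurable_EFinP; apply: measurable_funM; last exact: measurable_trig.
      exact: (measurableT_comp mF (pair2_measurable w)).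
    have pf : torus_periodic f.
      by move=> z m; rewrite /f !FE torus_periodic_trig addrAC pa.
    congr fine; rewrite -[LHS](integral_haar_affine (s := 1) (X0 w) erefl mf pf).
    apply: eq_integral => z _; rewrite /f /g FE scale1r addrK /trig dotDr cosD sinD.
    by congr EFin; case: (s) => /=; rewrite ?expr1 ?expr0; ring.
  have iat s' := integrable_bounded_mul (ia (L w)) (bt s').
  rewrite RintegralD//; [|exact: (integrableZl _ _ (iat s))|exact: (integrableZl _ _ (iat (~~ s)))].
  by rewrite !RintegralZl// /hb /M /A /B /=; ring.
have iH : P.-integrable setT (fun w => (hb (GL w, XX w) * M (GL w, XX w))%:E).
  apply: (integrable_bounded_mul iB); split; last by exists (ka + ka) => w; exact: bM.
  exact: (measurableT_comp mM (measurable_fun_pair mgl (measurable_funP X0))).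
have mH : measurable_fun setT (fun q => (hb q * M q)%:E).
  by apply/measurable_EFinP; exact: measurable_funM.
have := expectation_independent (m := haar R) XX_uniform XXGL mH iH.
move=> E; rewrite /Rintegral E; congr fine; apply: eq_integral => w _.
have ibt s' := integrable_bounded_mul (ib (L w)) (bt s').
(* The reflection that turns b(- y) into b(y) keeps the cosine and changes the sign of the sine. *)
pose g z := Gamma w ^+ 2 * A s k (L w) * (b (L w) z * trig (k, true) z) -
  Gamma w ^+ 2 * (-1) ^+ s * A (~~ s) k (L w) * (b (L w) z * trig (k, false) z).
have ig : (haar R).-integrable [set: T2] (EFin \o g).
  exact: (integrableB measurableT (integrableZl _ _ (ibt true)) (integrableZl _ _ (ibt false))).
transitivity (\int[haar R]_z (g z)%:E)%E.
  have mg : measurable_fun [set: T2] (EFin \o g) := measurable_int _ ig.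
  have pg : torus_periodic (EFin \o g).
    by move=> x m; rewrite /g /= pb !torus_periodic_trig.
  rewrite -(haar_reflect mg pg); apply: eq_integral => z _.
  rewrite /hb /M /g /trig /= sub0r dotNr cosN sinN; by congr EFin; ring.
rewrite -[LHS]fineK; last exact: integrable_fin_num.
congr EFin.
rewrite -/(Rintegral _ _ _) RintegralB//;
  [|exact: (integrableZl _ _ (ibt true))|exact: (integrableZl _ _ (ibt false))].
by rewrite !RintegralZl// /Bc; ring.
Qed.

End random_translate.

(** * Coefficients of the kernel and of the covariance *)

Section coefficients.
Variable R : realType.
Local Notation T2 := (measurableTypeR R * measurableTypeR R)%type.

(** The prescribed coefficients are purely imaginary, and the exponential carries - k.x: no cosine
    part, and the opposite of the imaginary part as sine part. *)
Lemma integral_biot_savart_trig (K : R * R -> 'cV[R]_2) k b j : biot_savart K ->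
  \int[haar R]_x (K x j 0 * trig (k, b) x) =
  if b then 0 else - ((k != 0)%:R * (freq_perp R k j 0 / sqnorm R k)).
Proof.
move=> [_ iK /(_ k j)]; rewrite /fourier_coef /cintegral => kE.
have re : \int[haar R]_x (K x j 0 * trig (k, true) x) =
    \int[haar R]_x complex.Re ((K x j 0)%:C * expi (- dot (intpt R k) x)).
  by apply: eq_Rintegral => x _; rewrite /= mul0r subr0 cosN.
have im : \int[haar R]_x (K x j 0 * trig (k, false) x) =
    - \int[haar R]_x complex.Im ((K x j 0)%:C * expi (- dot (intpt R k) x)).
  have it := integrable_bounded_mul (iK j) (bounded_trig R (k, false)).
  rewrite -mulN1r -RintegralZl//.
    by apply: eq_Rintegral => x _; rewrite mulN1r /= mul0r addr0 sinN mulrN opprK.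
  have := integrableN it; apply: eq_integrable => // x _.
  by rewrite /= mul0r addr0 sinN mulrN.
case: b; [rewrite re|rewrite im]; move: kE; case: eqP => [_|k0] [h1 h2] //.
  by rewrite mul0r h2.
by rewrite mul1r h2.
Qed.

Let ord2 (i : 'I_2) : (i == ord0) || (i == ord_max).
Proof. by case: i => -[|[|]]. Qed.

Lemma leray_perp k i j : k != 0 ->
  leray R k i j = freq_perp R k i 0 * freq_perp R k j 0 / sqnorm R k.
Proof.
move=> k0; have := sqnorm_gt0 R k0; rewrite /sqnorm /dot /= => s0.
rewrite /leray /sqnorm /dot !mxE big_ord1 !mxE /=.
have sN : k.1%:~R * k.1%:~R + k.2%:~R * k.2%:~R != 0 :> R by rewrite gt_eqF.
case/orP: (ord2 i) => /eqP ->; case/orP: (ord2 j) => /eqP -> /=;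
  rewrite ?mulrNz; field; exact: sN.
Qed.

Lemma leray_le1 k i j : k != 0 -> `|leray R k i j| <= 1.
Proof.
move=> k0; rewrite leray_perp//; have := sqnorm_gt0 R k0; rewrite /sqnorm /dot /= => s0.
rewrite normrM normfV (gtr0_norm s0) ler_pdivrMr// mul1r !mxE ler_norml.
have h1 := sqr_ge0 (k.1%:~R : R); have h2 := sqr_ge0 (k.2%:~R : R).
have h3 := sqr_ge0 (k.1%:~R + k.2%:~R : R); have h4 := sqr_ge0 (k.1%:~R - k.2%:~R : R).
by case/orP: (ord2 i) => /eqP ->; case/orP: (ord2 j) => /eqP -> /=;
  rewrite ?mulrNz; apply/andP; split; nra.
Qed.

Lemma sqnormN k : sqnorm R (- k) = sqnorm R k.
Proof. by rewrite /sqnorm /dot /= !mulrNz !mulrNN. Qed.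

Lemma lerayN k : leray R (- k) = leray R k.
Proof.
rewrite /leray sqnormN; congr (_ - _ *: _).
have -> : freq R (- k) = - freq R k.
  by apply/matrixP => i j; rewrite !mxE; case: ifP => _; rewrite /= mulrNz.
by rewrite linearN /= mulNmx mulmxN opprK.
Qed.

Lemma theta_hatN (theta : R * R -> R) xi : theta_hat theta (- xi) = theta_hat theta xi.
Proof.
by apply: eq_Rintegral => z _; rewrite dotC dotNr dotC cosN.
Qed.

(** Away from 0 this is a cosine coefficient of the jointly measurable mollifier. At scale 0 the
    mollifier vanishes, so that value is supplied separately. *)
Lemma measurable_theta_hat (theta : R * R -> R) k : symmetric_mollifier theta ->
  measurable_fun [set: measurableTypeR R] (fun l => theta_hat theta (l *: intpt R k)).
Proof.
move=> mol.
have mD := measurable_trig_coef (k, true) (measurable_mollifier mol).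
have m0 : measurable_fun [set: measurableTypeR R] (fun l : measurableTypeR R => l == 0 :> R).
  by apply: measurable_fun_eqr => //; exact: measurable_cst.
have := measurable_fun_ifT m0 (measurable_cst (theta_hat theta 0)) mD.
apply: eq_measurable_fun => l _; case: eqP => [->|/eqP l0] /=.
  by rewrite scale0r.
by rewrite -(integral_mollifier_trig mol k true l0).
Qed.

End coefficients.

Theorem proposition9 (R : realType) (d : measure_display)
    (Omega : measurableType d) (P : probability Omega R)
    (theta : R * R -> R) (K : R * R -> 'cV[R]_2)
    (Gamma L : {RV P >-> R}) (X0 : {RV P >-> (R * R)%type}) (p : R) :
  symmetric_mollifier theta ->
  biot_savart K ->
  ('E_P[Gamma] = 0)%E ->
  2 < p ->
  ('E_P[fun w => (`|Gamma w| `^ p)%R] < +oo)%E ->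
  {ae P, forall w, 0 < L w} ->
  uniform_on_torus X0 ->
  independent P X0 (fun w => (Gamma w, L w)) ->
  let U w x := Gamma w *: smoothed_kernel K theta (L w) x (X0 w) in
  let Q_vortex := covariance_fun P U in
  [/\ covariance_ae_defined P U,
      covariance_identity P U Q_vortex &
      exists Q : R * R -> 'M[R]_2,
        [/\ torus_periodic Q,
            forall x x', Q_vortex x x' = Q (x - x') &
            forall i j, L2_fourier_sum (fun x => Q x i j) (fun k =>
              (fine 'E_P[fun w => Gamma w ^+ 2 *
                 Normc.normc (fourier_transform theta (L w *: intpt R k)) ^+ 2]
               * (sqnorm R k)^-1 * leray R k i j)%:C)]].
Proof.
move=> mol bsK _ p2 Gp Lpos X0u X0GL U Q_vortex.
have G2 := expectation_sqr_lty p2 Gp.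
split; first exact: vortex_covariance_ae_defined.
  exact: vortex_covariance_identity.
pose phi (j : 'I_2) x : R := K x j 0.
have pphi j : torus_periodic (phi j) by case: bsK => pK _ _ x m; rewrite /phi pK.
have iphi j : (haar R).-integrable setT (EFin \o phi j).
  by case: bsK => _ h _; exact: (h j).
pose g j := mollified theta (phi j).
have mg j := measurable_mollified mol (iphi j).
have pg j l : torus_periodic (g j l) by exact: torus_periodic_mollified.
pose kap j := fine (\int[haar R]_x `|(phi j x)%:E|)%E.
have kap_bound j l : (\int[haar R]_x `|(g j l x)%:E| <= (kap j)%:E)%E.
  rewrite fineK; first exact: (integral_mollified_le mol (iphi j)).
  have /integrableP[_ h] := iphi j.
  by rewrite ge0_fin_numE//; exact: integral_ge0.
have QE x x' i j : Q_vortex x x' i j =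
    \int[P]_w (Gamma w ^+ 2 * (g i (L w) (x - X0 w) * g j (L w) (x' - X0 w))).
  rewrite /Q_vortex /covariance_fun mxE unlock; apply: eq_Rintegral => w _.
  rewrite /U !(vortex_fieldE Gamma L X0 mol bsK).
  by rewrite expr2 mulrACA.
(* Freezing the second point at 0 represents the covariance at every pair, because homogeneity is
   exact. *)
exists (fun z => Q_vortex z 0); split.
- move=> x m; apply/matrixP => i j; rewrite !QE; apply: eq_Rintegral => w _.
  by rewrite addrAC pg.
- move=> x x'; apply/matrixP => i j; rewrite (QE x x') (QE (x - x') 0).
  exact: (congr1 fine (homogeneous_expectation X0u X0GL (mg i) (mg j) (@pg i) (@pg j) x x')).
move=> i j.
(* As the transform of theta is bounded by 1, E[Gamma^2] serves as the constant in the decay C /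
   |k|^2. *)
pose C := fine (\int[P]_w (Gamma w ^+ 2)%:E)%E.
pose e k w := Gamma w ^+ 2 * theta_hat theta (L w *: intpt R k) ^+ 2.
have me k : measurable_fun setT (e k).
  apply: measurable_funM; first exact: measurable_funX.
  have mL : measurable_fun [set: Omega] (fun w => L w : measurableTypeR R) := measurable_funP L.
  have mt := measurableT_comp (measurable_theta_hat k mol) mL.
  exact: (measurable_funX 2 mt).
have cE k : fine 'E_P[fun w => Gamma w ^+ 2 *
    Normc.normc (fourier_transform theta (L w *: intpt R k)) ^+ 2] = \int[P]_w e k w.
  by rewrite unlock; apply: eq_Rintegral => w _; rewrite (normc_fourier_transform mol).
have iG2 : P.-integrable setT (fun w => (Gamma w ^+ 2)%:E).
  apply/integrableP; split; first by apply/measurable_EFinP; exact: measurable_funX.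
  have -> : (\int[P]_w `|(Gamma w ^+ 2)%:E| = \int[P]_w (Gamma w ^+ 2)%:E)%E => //.
  by apply: eq_integral => w _; rewrite gee0_abs// lee_fin sqr_ge0.
have e0 k w : 0 <= e k w by rewrite mulr_ge0 ?sqr_ge0.
have eG k w : e k w <= Gamma w ^+ 2.
  by rewrite ler_piMr ?sqr_ge0// -real_normK ?num_real// exprn_ile1// theta_hat_le1.
have ie k : P.-integrable setT (EFin \o e k).
  apply: (le_integrable _ _ _ iG2) => //; first exact/measurable_EFinP.
  by move=> w _; rewrite /= lee_fin !ger0_norm ?sqr_ge0.
have eC k : 0 <= \int[P]_w e k w <= C.
  apply/andP; split; first by apply: Rintegral_ge0.
  exact: le_Rintegral.
have eN k : \int[P]_w e (- k) w = \int[P]_w e k w.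
  have kN : intpt R (- k) = - intpt R k by rewrite /intpt /= !mulrNz.
  by apply: eq_Rintegral => w _; rewrite /e kN scalerN theta_hatN.
have iF := integrable_translate_product X0u X0GL G2 (mg i) (mg j) (@pg i) (@pg j)
  (kap_bound i) (kap_bound j).
have coef k s : \int[haar R]_z (Q_vortex z 0 i j * trig (k, s) z) =
    s%:R * ((k != 0)%:R * (\int[P]_w e k w * (sqnorm R k)^-1 * leray R k i j)).
  have E := integral_translate_product_trig X0u X0GL G2 (mg i) (mg j) (@pg i) (@pg j)
    (kap_bound i) (kap_bound j) k s.
  transitivity (\int[P]_w (s%:R * ((k != 0)%:R * ((sqnorm R k)^-1 * leray R k i j)) * e k w)).
    under eq_Rintegral do rewrite QE.
    apply: (eq_trans E); congr fine; apply: ae_eq_integral => //.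
    - apply/measurable_EFinP; apply: measurable_funM; first exact: measurable_funX.
      have mA j' s' : measurable_fun [set: Omega]
          (fun w => \int[haar R]_z (g j' (L w) z * trig (k, s') z)).
        have mL : measurable_fun [set: Omega] (fun w => L w : measurableTypeR R) :=
          measurable_funP L.
        exact: (measurableT_comp (measurable_trig_coef (k, s') (mg j')) mL).
      have mA2 := measurable_funM (mA i (~~ s)) (mA j false).
      have := measurable_funB (measurable_funM (mA i s) (mA j true))
        (measurable_funM (measurable_cst ((-1) ^+ s : R)) mA2).
      by apply: eq_measurable_fun => w _; rewrite /= mulrA.
    - by apply/measurable_EFinP; exact: measurable_funM.
    (* The coefficient formula for the mollified kernel requires a nonzero scale, which L provides
       almost surely. *)
    apply: filterS Lpos => w Lw _; congr EFin.
    rewrite /g !(integral_mollified_trig mol (iphi _) (@pphi _) k _ (lt0r_neq0 Lw)).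
    rewrite /phi !(integral_biot_savart_trig k _ _ bsK) /e.
    (* The kernel has sine coefficients only. For the sine integral each product contains a cosine
       coefficient and vanishes; for the cosine integral the product of the two sine coefficients
       remains, and their minus signs cancel. *)
    case: s {E} => /=; last by rewrite !mul0r !mulr0 mul0r subrr mulr0.
    have [_|k0] := eqVneq k 0; first by rewrite !(mul0r, oppr0, mulr0, subr0).
    by rewrite leray_perp// expr1 !mul1r; ring.
  rewrite RintegralZl//.
  by ring.
have fint : (haar R).-integrable setT (fun z => (Q_vortex z 0 i j)%:E).
  have := integrable_Rintegral_fst iF; apply: eq_integrable => // z _.
  by rewrite /= QE.
apply: (L2_fourier_sumP (C := C) fint) => k.
- move=> k0; rewrite cE; have /andP[e1 e2] := eC k; have s0 := sqnorm_gt0 R k0.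
  rewrite !normrM normfV (ger0_norm e1) (gtr0_norm s0).
  by rewrite -[leRHS]mulr1 ler_pM ?leray_le1 ?ler_pM2r ?invr_gt0// mulr_ge0// invr_ge0 ltW.
- by rewrite (cE (- k)) (cE k) eN sqnormN lerayN.
- by rewrite coef mul1r cE.
- by rewrite coef mul0r.
Qed.
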